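(* Let $1<p<\infty$, let $k\ge1$ be an integer, let $\mu,\lambda\in A_p(\mathbb{R}^n)$ and set $\nu=\mu^{1/p}\lambda^{-1/p}$. Let $T$ be either a non-degenerate $\omega$-Calderón–Zygmund operator or a non-degenerate homogeneous Calderón–Zygmund operator on $\mathbb{R}^n$. Then there is a constant $C>0$, independent of $b$, such that for every complex-valued function $b\in L^k_{\mathrm{loc}}(\mathbb{R}^n)$, $$\|b\|_{\mathrm{BMO}_{\nu^{1/k}}}\le C\,\|C_b^k(T)\|_{L^p(\mu)\to L^p(\lambda)}^{1/k}.$$
   Context: All functions $b,f$ and kernels may be complex-valued; cubes are cubes in $\mathbb{R}^n$, $\langle f\rangle_Q=f_Q=\frac1{|Q|}\int_Qf$, and $w(Q)=\int_Qw$ for a weight $w$. A positive locally integrable function $w$ belongs to $A_p(\mathbb{R}^n)$ if $[w]_{A_p}=\sup_Q\langle w\rangle_Q\,\langle w^{-\frac1{p-1}}\rangle_Q^{p-1}<\infty$, the supremum over all cubes $Q$. $L^p(w)$ has norm $\|f\|_{L^p(w)}=(\int|f|^pw)^{1/p}$. For a weight $w$, the weighted BMO norm is $\|b\|_{\mathrm{BMO}_w}=\sup_Q\frac1{w(Q)}\int_Q|b-b_Q|$. Commutators: formally $[b,T]f=bTf-T(bf)$, $C_b^1(T)=[b,T]$ and $C_b^k(T)=[b,C_b^{k-1}(T)]$. $T$ is a linear operator associated with a kernel $K$, in the sense that $Tf(x)=\int K(x,y)f(y)\,dy$ for a.e. $x\notin\operatorname{supp}f$; correspondingly, for bounded compactly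 supported $f$ and a.e. $x\notin\operatorname{supp}f$, $$C_b^k(T)f(x)=\int_{\mathbb{R}^n}(b(x)-b(y))^kK(x,y)f(y)\,dy.$$ $\|C_b^k(T)\|_{L^p(\mu)\to L^p(\lambda)}\in[0,\infty]$ is the least constant $N$ with $\|C_b^k(T)f\|_{L^p(\lambda)}\le N\|f\|_{L^p(\mu)}$ for all bounded compactly supported $f$. $\omega$-Calderón–Zygmund kernel: a function $K(x,y)$, $x\ne y$, with $|K(x,y)|\le\frac{C_K}{|x-y|^n}$ for all $x\neq y$ and $$|K(x,y)-K(x',y)|+|K(y,x)-K(y,x')|\le\frac1{|x-y|^n}\,\omega\Big(\frac{|x-x'|}{|x-y|}\Big)\quad\text{whenever }|x-x'|<|x-y|/2,$$ where $\omega:[0,1)\to[0,\infty)$ is increasing. Homogeneous Calderón–Zygmund kernel: $K(x,y)=|x-y|^{-n}\,\Omega\big(\frac{x-y}{|x-y|}\big)$ with $\Omega\in L^1(\mathbb{S}^{n-1})$. $T$ is a non-degenerate $\omega$-Calderón–Zygmund operator if its kernel $K$ is an $\omega$-Calderón–Zygmund kernel with $\omega(t)\to0$ as $t\to0$ and there exists $c_0>0$ such that for every $y\in\mathbb{R}^n$ and $r>0$ there exists $x\in B(y,r)^c$ with $|K(x,y)|\ge\frac1{c_0r^n}$. $T$ is a non-degenerate homogeneous Calderón–Zygmund operator if its kernel is a homogeneous Calderón–Zygmund kernel with $\Omega\in L^1(\mathbb{S}^{n-1})$ and there exists a Lebesgue point $\theta_0\in\mathbb{S}^{n-1}$ of $\Omega$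 with $\Omega(\theta_0)\neq0$. *)

(* Defs.v *)
(* Built on MathComp-Analysis, with the complex numbers R[i] of
   mathcomp-real-closed.  The space R^n is 'rV[R]_n for R : realType. *)
From HB Require Import structures.
From mathcomp Require Import all_boot all_order all_algebra.
From mathcomp Require Import all_classical all_reals all_analysis.
From mathcomp Require Import measurable_realfun complex.

Set Implicit Arguments.
Unset Strict Implicit.
Unset Printing Implicit Defensive.

Import Order.TTheory GRing.Theory Num.Theory.
Import numFieldNormedType.Exports.

Local Open Scope classical_set_scope.
Local Open Scope ring_scope.

(* The sigma-algebra on 'rV[R]_n is generated by the coordinates: it is the
   Borel sigma-algebra. *)
Definition measure_rV_display : measure_display.
Proof. exact. Qed.

Section measurable_rV.
Context {R : realType}.
Variable n : nat.

Let coord (i : 'I_n) (x : 'rV[R]_n) : measurableTypeR R := x ord0 i.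

Let rV_set0 : g_sigma_preimage coord set0.
Proof. exact: sigma_algebra0. Qed.

Let rV_setC A : g_sigma_preimage coord A -> g_sigma_preimage coord (~` A).
Proof. exact: sigma_algebraC. Qed.

Let rV_bigcup (F : (set 'rV[R]_n)^nat) :
  (forall i, g_sigma_preimage coord (F i)) ->
  g_sigma_preimage coord (\bigcup_i (F i)).
Proof. exact: sigma_algebra_bigcup. Qed.

HB.instance Definition _ := @isMeasurable.Build measure_rV_display
  'rV[R]_n (g_sigma_preimage coord) rV_set0 rV_setC rV_bigcup.

Lemma measurable_coord (i : 'I_n) :
  measurable_fun setT (fun x : 'rV[R]_n => x ord0 i : measurableTypeR R).
Proof.
move=> _ Y mY; rewrite setTI; apply: sub_sigma_algebra => /=.
rewrite -bigcup_seq/=; exists i => /=; first by rewrite mem_index_enum.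
by exists Y => //; rewrite setTI.
Qed.

Lemma measurable_fun_coordP d (T : measurableType d) (f : T -> 'rV[R]_n) :
  (forall i, measurable_fun setT (fun x => f x ord0 i : measurableTypeR R)) ->
  measurable_fun setT f.
Proof.
move=> mf _ Y mY; rewrite setTI.
suff : g_sigma_preimage coord `<=` [set B | measurable (f @^-1` B)] by exact.
apply: smallest_sub.
- split => /=.
  + by rewrite preimage_set0.
  + by move=> A mA; rewrite setTD preimage_setC; exact: measurableC.
  + by move=> F mF; rewrite preimage_bigcup; exact: bigcupT_measurable.
- rewrite -bigcup_seq => A/= [i _ [B mB <-]]; rewrite setTI.
  by have := mf i measurableT B mB; rewrite setTI.
Qed.
End measurable_rV.

(* Lebesgue measure on 'rV[R]_n, by induction on n: the image of the product
   of the Lebesgue measure on R with that on 'rV[R]_n under (t, v) |-> t :: v. *)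
Section lebesgue_rV.
Context {R : realType}.

Definition cons_rV n (z : measurableTypeR R * 'rV[R]_n) : 'rV[R]_n.+1 :=
  \row_i (if unlift ord0 i is Some j then z.2 ord0 j else z.1).

Let uncons_rV n (x : 'rV[R]_n.+1) : measurableTypeR R * 'rV[R]_n :=
  (x ord0 ord0, \row_i x ord0 (lift ord0 i)).

Lemma measurable_cons_rV n : measurable_fun setT (@cons_rV n).
Proof.
apply: measurable_fun_coordP => i; rewrite /cons_rV.
case: (unliftP ord0 i) => [j|] ->.
- rewrite [X in measurable_fun _ X](_ : _ =
      (fun x : 'rV[R]_n => x ord0 j : measurableTypeR R) \o snd).
    exact: (measurableT_comp (measurable_coord j) measurable_snd).
  by apply/funext => z; rewrite mxE liftK.
- rewrite [X in measurable_fun _ X](_ : _ = fst); first exact: measurable_fst.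
  by apply/funext => z; rewrite mxE unlift_none.
Qed.

Let measurable_uncons_rV n : measurable_fun setT (@uncons_rV n).
Proof.
apply/measurable_fun_pairP; split; first exact: measurable_coord.
apply: measurable_fun_coordP => i /=.
rewrite [X in measurable_fun _ X](_ : _ =
    fun x : 'rV[R]_n.+1 => x ord0 (lift ord0 i)).
  exact: measurable_coord.
by apply/funext => x; rewrite mxE.
Qed.

Let cons_rVK n : cancel (@cons_rV n) (@uncons_rV n).
Proof.
move=> [t v]; rewrite /uncons_rV /cons_rV; congr pair => /=.
  by rewrite mxE unlift_none.
by apply/rowP => i; rewrite !mxE liftK.
Qed.

Section step.
Variables (n : nat) (m : {sigma_finite_measure set 'rV[R]_n -> \bar R}).

Definition lebesgue_rVS : set 'rV[R]_n.+1 -> \bar R :=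
  pushforward (@lebesgue_measure R \x m)%E (@cons_rV n).

Let mcons A : measurable A -> measurable (@cons_rV n @^-1` A).
Proof.
by move=> mA; rewrite -[X in measurable X]setTI; exact: measurable_cons_rV.
Qed.

Let rVS0 : lebesgue_rVS set0 = 0%E.
Proof. by rewrite /lebesgue_rVS /pushforward preimage_set0 measure0. Qed.

Let rVS_ge0 A : (0 <= lebesgue_rVS A)%E.
Proof. by rewrite /lebesgue_rVS /pushforward measure_ge0. Qed.

Let rVS_sigma_additive : semi_sigma_additive lebesgue_rVS.
Proof.
move=> F mF tF mUF; rewrite /lebesgue_rVS /pushforward preimage_bigcup.
apply: measure_semi_sigma_additive.
- by move=> i; exact: mcons.
- apply/trivIsetP => /= i j _ _ ij; rewrite -preimage_setI.
  by move/trivIsetP : tF => /(_ _ _ _ _ ij) ->//; rewrite preimage_set0.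
- by rewrite -preimage_bigcup; exact: mcons.
Qed.

HB.instance Definition _ := isMeasure.Build _ _ _ lebesgue_rVS
  rVS0 rVS_ge0 rVS_sigma_additive.

Let rVS_sigma_finite : sigma_finite setT lebesgue_rVS.
Proof.
have /sigma_finiteP[F [TF ndF Foo]] := sigma_finiteT (@lebesgue_measure R).
have /sigma_finiteP[G [TG ndG Goo]] := sigma_finiteT m.
exists (fun k => @uncons_rV n @^-1` (F k `*` G k)).
  rewrite -preimage_bigcup [X in _ @^-1` X](_ : _ = setT) ?preimage_setT//.
  rewrite -subTset => -[x y] _.
  have [i _ Fx] : (\bigcup_i F i) x by rewrite -TF.
  have [j _ Gy] : (\bigcup_i G i) y by rewrite -TG.
  exists (maxn i j) => //; split => /=.
  - by move: x Fx; exact/subsetPset/ndF/leq_maxl.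
  - by move: y Gy; exact/subsetPset/ndG/leq_maxr.
move=> k; have [mF Fk] := Foo k; have [mG Gk] := Goo k; split.
  rewrite -[X in measurable X]setTI.
  by apply: measurable_uncons_rV => //; exact: measurableX.
rewrite /lebesgue_rVS /pushforward -comp_preimage.
rewrite [X in X @^-1` _](_ : _ = id); last by apply/funext => z; exact: cons_rVK.
by rewrite preimage_id product_measure1E// lte_mul_pinfty// ge0_fin_numE.
Qed.

HB.instance Definition _ := Measure_isSigmaFinite.Build _ _ _ lebesgue_rVS
  rVS_sigma_finite.

End step.

Fixpoint lebesgue_rV n : {sigma_finite_measure set 'rV[R]_n -> \bar R} :=
  match n with
  | 0 => (@dirac _ 'rV[R]_0 0 R)
  | n'.+1 => lebesgue_rVS (lebesgue_rV n')
  end.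

Lemma lebesgue_rV_box n (A : 'I_n -> set (measurableTypeR R)) :
  (forall i, measurable (A i)) ->
  lebesgue_rV n [set x | forall i, A i (x ord0 i)] =
  (\prod_(i < n) lebesgue_measure (A i))%E.
Proof.
elim: n A => [|n IH] A mA.
  by rewrite big_ord0 /= diracE mem_set// => -[].
have mB : measurable [set v : 'rV[R]_n | forall i, A (lift ord0 i) (v ord0 i)].
  rewrite (_ : mkset _ = \bigcap_(i in [set: 'I_n])
    ((fun x : 'rV[R]_n => x ord0 i : measurableTypeR R) @^-1`
       A (lift ord0 i))); last first.
    by apply/seteqP; split => [x Ax i _|x Ax i]; [exact: Ax|exact: (Ax i)].
  apply: fin_bigcap_measurable => // i _.
  by rewrite -[X in measurable X]setTI; exact: measurable_coord.
rewrite big_ord_recl -IH; last by move=> i; exact: mA.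
rewrite /= /lebesgue_rVS /pushforward -product_measure1E//.
congr (_ _); apply/seteqP; split => [z Az|z [/= A0 Az] i].
  split => [|i].
    by have := Az ord0; rewrite mxE unlift_none.
  by have := Az (lift ord0 i); rewrite mxE liftK.
by rewrite /cons_rV mxE; case: (unliftP ord0 i) => [j|] ->.
Qed.

End lebesgue_rV.
Arguments lebesgue_rV {R} n.

Section euclidean.
Context {R : realType}.
Variable n : nat.
Implicit Types (x y : 'rV[R]_n) (r : R) (Q : set 'rV[R]_n).

(* The norm `|x| that MathComp-Analysis puts on 'rV[R]_n is the sup norm. *)
Definition enorm x : R := Num.sqrt (\sum_(i < n) x ord0 i ^+ 2).

Definition eball y r : set 'rV[R]_n := [set x | enorm (x - y) < r].

Definition unit_sphere : set 'rV[R]_n := [set x | enorm x = 1].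

Definition normalize x : 'rV[R]_n := (enorm x)^-1 *: x.

Definition cube (a : 'rV[R]_n) (l : R) : set 'rV[R]_n :=
  [set x | forall i, a ord0 i <= x ord0 i <= a ord0 i + l].

Definition is_cube Q := exists a l, 0 < l /\ Q = cube a l.

Definition punctured_unit_ball : set 'rV[R]_n := [set x | 0 < enorm x < 1].

Lemma measurable_enorm : measurable_fun setT enorm.
Proof.
apply: measurableT_comp.
  by apply: continuous_measurable_fun; exact: sqrt_continuous.
apply: measurable_sum => i; apply: measurable_funX.
exact: (measurable_coord i).
Qed.

Lemma measurable_normalize : measurable_fun setT normalize.
Proof.
apply: measurable_fun_coordP => i.
rewrite [X in measurable_fun _ X](_ : _ =
  (fun x : 'rV[R]_n => enorm x `^ (-1) * x ord0 i)); last first.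
  by apply/funext => x; rewrite mxE powR_inv1// sqrtr_ge0.
apply: measurable_funM; last exact: (measurable_coord i).
by apply: (measurableT_comp (measurable_powR _)); exact: measurable_enorm.
Qed.

Lemma measurable_punctured_unit_ball : measurable punctured_unit_ball.
Proof.
rewrite (_ : punctured_unit_ball = enorm @^-1` `]0, 1[).
  by rewrite -[X in measurable X]setTI; exact: measurable_enorm.
by apply/seteqP; split => x /=; rewrite in_itv.
Qed.

(* Surface measure on the unit sphere, as a measure on R^n carried by the
   sphere: sigma(A) is n times the volume of the cone
   {r theta | theta in A, 0 < r < 1}, so that polar coordinates hold. *)
Definition sphere_measure (A : set 'rV[R]_n) : \bar R :=
  (n%:R%:E * lebesgue_rV n (punctured_unit_ball `&` normalize @^-1` A))%E.

Let mcone A : measurable A ->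
  measurable (punctured_unit_ball `&` normalize @^-1` A).
Proof.
move=> mA; apply: measurableI; first exact: measurable_punctured_unit_ball.
by rewrite -[X in measurable X]setTI; exact: measurable_normalize.
Qed.

Let sphere_measure0 : sphere_measure set0 = 0%E.
Proof. by rewrite /sphere_measure preimage_set0 setI0 measure0 mule0. Qed.

Let sphere_measure_ge0 A : (0 <= sphere_measure A)%E.
Proof. by rewrite /sphere_measure mule_ge0. Qed.

Let sphere_measure_sigma_additive : semi_sigma_additive sphere_measure.
Proof.
move=> F mF tF mUF; rewrite /sphere_measure.
rewrite [X in X @ _ --> _](_ : _ = (fun k => n%:R%:E * \sum_(0 <= i < k)
    lebesgue_rV n (punctured_unit_ball `&` normalize @^-1` F i))%E); last first.
  by apply/funext => k; rewrite ge0_sume_distrr// => *; exact: measure_ge0.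
apply: cvgeZl => //; rewrite preimage_bigcup setI_bigcupr.
apply: measure_semi_sigma_additive.
- by move=> i; exact: mcone.
- apply/trivIsetP => /= i j _ _ ij; rewrite setIACA setIid -preimage_setI.
  by move/trivIsetP : tF => /(_ _ _ _ _ ij) ->//; rewrite preimage_set0 setI0.
- by rewrite -setI_bigcupr -preimage_bigcup; exact: mcone.
Qed.

HB.instance Definition _ := isMeasure.Build _ _ _ sphere_measure
  sphere_measure0 sphere_measure_ge0 sphere_measure_sigma_additive.

End euclidean.
Arguments sphere_measure {R} n.

Section complex_functions.
Context {R : realType}.
Variable n : nat.
Local Notation Rn := 'rV[R]_n.
Local Notation C := R[i].
Local Notation leb := (lebesgue_rV n).
Local Notation normc := (@Normc.normc R).
Implicit Types (f g b : Rn -> C) (w : Rn -> R) (p : R) (k : nat).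

Definition cmeasurable (D : set Rn) f :=
  measurable_fun D (fun x => complex.Re (f x)) /\
  measurable_fun D (fun x => complex.Im (f x)).

Definition cintegral (D : set Rn) f : C :=
  Complex (\int[leb]_(x in D) complex.Re (f x))
          (\int[leb]_(x in D) complex.Im (f x)).

Definition Lk_loc k b := cmeasurable setT b /\
  forall E : set Rn, compact E ->
    (\int[leb]_(x in E) (normc (b x) ^+ k)%:E < +oo)%E.

Definition csupp f : set Rn := closure [set x | f x != 0].

Definition L1_c f := [/\ cmeasurable setT f, compact (csupp f) &
  (\int[leb]_x (normc (f x))%:E < +oo)%E].

Definition Linfty_c f := [/\ cmeasurable setT f, compact (csupp f) &
  exists M : R, forall x, normc (f x) <= M].

Definition weight w := [/\ measurable_fun setT w, (forall x, 0 < w x) &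
  forall E : set Rn, compact E -> (\int[leb]_(x in E) (w x)%:E < +oo)%E].

Definition average (Q : set Rn) w : \bar R :=
  ((leb Q)^-1 * \int[leb]_(x in Q) (w x)%:E)%E.

Definition Ap_constant p w : \bar R := ereal_sup
  [set (average Q w *
        average Q (fun x => (w x `^ (- (p - 1)^-1))%R) `^ (p - 1))%E
  | Q in @is_cube R n].

Definition Ap p w := weight w /\ (Ap_constant p w < +oo)%E.

Definition wLnorm p w f : \bar R :=
  ((\int[leb]_x (normc (f x) `^ p * w x)%:E) `^ p^-1)%E.

Definition caverage (Q : set Rn) f : C :=
  ((fine (leb Q))^-1)%:C%C * cintegral Q f.

Definition BMO_norm w b : \bar R := ereal_sup
  [set ((\int[leb]_(x in Q) (w x)%:E)^-1 *
        \int[leb]_(x in Q) (normc (b x - caverage Q b))%:E)%E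
  | Q in @is_cube R n].

(* The diagonal values K x x are unconstrained. *)
Definition CZ_kernel (omega : R -> R) (K : Rn -> Rn -> C) :=
  [/\ (forall t, 0 <= t < 1 -> 0 <= omega t),
      (forall s t, 0 <= s -> s <= t -> t < 1 -> omega s <= omega t),
      (exists CK : R, forall x y, x != y ->
         normc (K x y) <= CK / enorm (x - y) ^+ n) &
      (forall x x' y, enorm (x - x') < enorm (x - y) / 2 ->
         normc (K x y - K x' y) + normc (K y x - K y x') <=
         (enorm (x - y) ^+ n)^-1 * omega (enorm (x - x') / enorm (x - y)))].

Definition integrable_on_sphere (Omega : Rn -> C) :=
  cmeasurable (@unit_sphere R n) Omega /\
  (\int[sphere_measure n]_(theta in @unit_sphere R n)
     (normc (Omega theta))%:E < +oo)%E.

Definition homogeneous_kernel (Omega : Rn -> C) (K : Rn -> Rn -> C) :=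
  forall x y, x != y ->
    K x y = ((enorm (x - y) ^+ n)^-1)%:C%C * Omega (normalize (x - y)).

Definition sphere_lebesgue_pt (Omega : Rn -> C) (theta : Rn) :=
  (let A r := @unit_sphere R n `&` eball theta r in
   (sphere_measure n (A r))^-1 *
   \int[sphere_measure n]_(eta in A r) (normc (Omega eta - Omega theta))%:E)%E
  @[r --> 0^'+] --> (0 : \bar R)%E.

(* T is a linear operator with kernel K.  Its domain is L1_c, so that the
   iterated commutators with every b in L^k_loc act on Linfty_c.  As T f is
   a function defined up to null sets, linearity is required a.e. *)
Definition operator_with_kernel (K : Rn -> Rn -> C)
    (T : (Rn -> C) -> (Rn -> C)) :=
  [/\ (forall f, L1_c f -> cmeasurable setT (T f)),
      (forall (c : C) f g, L1_c f -> L1_c g -> {ae leb, forall x,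
         T (fun y => c * f y + g y) x = c * T f x + T g x}) &
      (forall f, L1_c f -> {ae leb, forall x, ~ csupp f x ->
         T f x = cintegral setT (fun y => K x y * f y)})].

Definition nondegenerate_CZ_operator (omega : R -> R)
    (T : (Rn -> C) -> (Rn -> C)) :=
  exists K, [/\ operator_with_kernel K T, CZ_kernel omega K,
    omega t @[t --> 0^'+] --> (0 : R) &
    exists2 c0 : R, 0 < c0 & forall y r, 0 < r ->
      exists2 x, ~ eball y r x & (c0 * r ^+ n)^-1 <= normc (K x y)].

Definition nondegenerate_homogeneous_operator (T : (Rn -> C) -> (Rn -> C)) :=
  exists K Omega, [/\ operator_with_kernel K T, integrable_on_sphere Omega,
    homogeneous_kernel Omega K &
    exists theta0, [/\ @unit_sphere R n theta0,
      sphere_lebesgue_pt Omega theta0 & Omega theta0 != 0]].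

Definition commutator b (T : (Rn -> C) -> (Rn -> C)) : (Rn -> C) -> (Rn -> C) :=
  fun f x => b x * T f x - T (fun y => b y * f y) x.

Definition iter_commutator b k T := iter k (commutator b) T.

(* It is +oo, the infimum of the empty set, when no finite N works. *)
Definition operator_norm p (mu lambda : Rn -> R) (S : (Rn -> C) -> (Rn -> C)) :
    \bar R := ereal_inf
  [set N%:E | N in [set N : R | 0 <= N /\ forall f, Linfty_c f ->
                      (wLnorm p lambda (S f) <= N%:E * wLnorm p mu f)%E]].

End complex_functions.

(* Main.v *)
Require Import Defs.
From mathcomp Require Import all_boot all_order all_algebra.
From mathcomp Require Import all_classical all_reals all_analysis.
From mathcomp Require Import measurable_realfun complex.
From mathcomp Require Import ring lra.

Set Implicit Arguments.
Unset Strict Implicit.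
Unset Printing Implicit Defensive.

Import Order.TTheory GRing.Theory Num.Theory.
Import numFieldNormedType.Exports.

Local Open Scope classical_set_scope.
Local Open Scope ring_scope.

(** Test the commutator on functions [f] with [|f| <= 1] that are carried by a cube
    [Y], and look at it on a disjoint cube [X] of the same size at comparable
    distance.  There it is the integral of [(b x - b y)^k K x y f y] over [Y]
    ([iter_commutator_kernel]), while Hoelder's inequality and the [A_p] conditions
    bound its integral over [X] by the operator norm [N] times
    [|Y| avg(nu^(1/k))^k] ([test_bound], [weight_estimate]).  Non-degeneracy
    provides [X] such that [K] is nearly a constant [K0] of size [1 / |Y|] between
    the two cubes ([has_companion_cubes]).  For a Calderon-Zygmund kernel this
    follows from its regularity.  For a homogeneous kernel [X] is the translate of
    [Y] by a large multiple of the Lebesgue point of [Omega]; the error is small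
    in mean, by polar coordinates ([kernel_near_target]).

    So the bilinear form with kernel [(b x - b y)^k] is under control, and the
    oscillation of [b] has to be recovered from it.  As [b] is complex, the [k]-th
    power can cancel.  It does not if [b x] stays in a disc about [m] for [x] in a
    fixed share of [X], while [b y] is far from [m] compared with the radius: then
    [(b x - b y)^k] is [(m - b y)^k] up to a small relative error, its phase is a
    function of [y], and a test function removes it ([far_in_Y]).  The roles of the
    cubes may be exchanged ([far_in_X]).  Let [tau] be [N^(1/k) avg(nu^(1/k))], up
    to a constant.  Suppose that half of the values of [b] on [X] lie in a square
    of side comparable to [r].  Subdividing it, a fixed share of them lies in a
    much smaller square, and the two estimates applied to this share show that
    either [r] is at most a multiple of [tau] or half of the values lie in a
    square of half the side ([concentrated_descent]).  Hence half of the values lie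
    in a square of side comparable to [tau], and [far_in_Y] at this scale bounds
    the mean oscillation of [b] on [Y] by a multiple of [tau]
    ([mean_oscillation_le]). *)

(** * Complex numbers *)

Section complex_numbers.
Context {R : realType}.
Local Notation C := R[i].
Local Notation normc := (@Normc.normc R).
Local Notation Re := (@complex.Re R).
Local Notation Im := (@complex.Im R).
Implicit Types z w : C.

Lemma normcE z : normc z = Num.sqrt (Re z ^+ 2 + Im z ^+ 2).
Proof. by case: z. Qed.

Lemma normc_ge0 z : 0 <= normc z.
Proof. by rewrite normcE sqrtr_ge0. Qed.

Lemma normcD z w : normc (z + w) <= normc z + normc w.
Proof. exact: (@le_normcD R). Qed.

Lemma normcN z : normc (- z) = normc z.
Proof. exact: (@complex.normcN R). Qed.

Lemma normcB z w : normc (z - w) <= normc z + normc w.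
Proof. by rewrite -[normc w]normcN normcD. Qed.

Lemma normc_distC z w : normc (z - w) = normc (w - z).
Proof. by rewrite -normcN opprB. Qed.

Lemma normcX z k : normc (z ^+ k) = normc z ^+ k.
Proof.
elim: k => [|k IH]; first by rewrite !expr0 Normc.normc1.
by rewrite !exprS Normc.normcM IH.
Qed.

Lemma normc_eq0 z : (normc z == 0) = (z == 0).
Proof.
apply/eqP/eqP => [/Normc.eq0_normc//|->]; exact: Normc.normc0.
Qed.

Lemma normc_gt0 z : (0 < normc z) = (z != 0).
Proof. by rewrite lt_neqAle normc_ge0 andbT eq_sym normc_eq0. Qed.

Lemma normcR (r : R) : normc r%:C%C = `|r|.
Proof. by rewrite normcE/= expr0n addr0 sqrtr_sqr. Qed.

Lemma Re_le_normc z : `|Re z| <= normc z.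
Proof. by rewrite -sqrtr_sqr normcE ler_wsqrtr// lerDl sqr_ge0. Qed.

Lemma Im_le_normc z : `|Im z| <= normc z.
Proof. by rewrite -sqrtr_sqr normcE ler_wsqrtr// lerDr sqr_ge0. Qed.

Lemma normc_le_ReIm z : normc z <= `|Re z| + `|Im z|.
Proof.
rewrite normcE -(ler_pXn2r (_ : 0 < 2)%N) ?nnegrE ?sqrtr_ge0 ?addr_ge0//.
rewrite sqr_sqrtr ?addr_ge0 ?sqr_ge0// sqrrD !real_normK ?num_real//.
by rewrite addrAC lerDl mulrn_wge0// mulr_ge0.
Qed.

Lemma ReM z w : Re (z * w) = Re z * Re w - Im z * Im w.
Proof. by case: z w => [? ?] [? ?]. Qed.

Lemma ImM z w : Im (z * w) = Re z * Im w + Im z * Re w.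
Proof. by case: z w => [? ?] [? ?]. Qed.

Lemma ReD z w : Re (z + w) = Re z + Re w.
Proof. by case: z w => [? ?] [? ?]. Qed.

Lemma ImD z w : Im (z + w) = Im z + Im w.
Proof. by case: z w => [? ?] [? ?]. Qed.

Lemma ReN z : Re (- z) = - Re z. Proof. by case: z. Qed.
Lemma ImN z : Im (- z) = - Im z. Proof. by case: z. Qed.

Lemma ReJ z : Re z^*%C = Re z. Proof. by case: z. Qed.
Lemma ImJ z : Im z^*%C = - Im z. Proof. by case: z. Qed.

Lemma ReRM (r : R) z : Re (r%:C%C * z) = r * Re z.
Proof. by rewrite ReM/= mul0r subr0. Qed.

Lemma complex_ext z w : Re z = Re w -> Im z = Im w -> z = w.
Proof. by case: z w => [? ?] [? ?] /= -> ->. Qed.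

(** The conjugate of [z / |z|], so that multiplying by it turns [z] into its
    modulus; it is 0 at [z = 0]. *)
Definition phase z : C := (normc z)^-1%:C%C * z^*%C.

Lemma phaseE z : phase z * z = (normc z)%:C%C.
Proof.
case: z => a b; rewrite /phase; have [->|z0] := eqVneq (a +i* b)%C 0.
  by rewrite mulr0 Normc.normc0.
apply: complex_ext; rewrite !(ReM, ImM) /=; last by ring.
have n0 : Num.sqrt (a ^+ 2 + b ^+ 2) != 0 by rewrite (normc_eq0 (a +i* b)%C).
apply: (mulfI n0); rewrite -[RHS]expr2 sqr_sqrtr ?addr_ge0 ?sqr_ge0//.
by field.
Qed.

Lemma normcJ z : normc z^*%C = normc z.
Proof. by case: z => a b /=; rewrite sqrrN. Qed.

Lemma normc_phase z : normc (phase z) <= 1.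
Proof.
rewrite /phase Normc.normcM normcR normcJ ger0_norm ?invr_ge0 ?normc_ge0//.
have [->|z0] := eqVneq (normc z) 0; first by rewrite mulr0.
by rewrite mulVf.
Qed.

Lemma normc_phase1 z : z != 0 -> normc (phase z) = 1.
Proof.
move=> z0; have n0 : normc z != 0 by rewrite normc_eq0.
by apply: (mulIf n0); rewrite -Normc.normcM phaseE normcR ger0_norm ?normc_ge0// mul1r.
Qed.

(** The binomial theorem, used as a Lipschitz bound at 1. *)
Lemma normc_1BX_sub1 z k : normc z <= 1 ->
  normc ((1 - z) ^+ k - 1) <= (2 ^+ k - 1) * normc z.
Proof.
move=> z1; have n2 : normc (1 - z) <= 2.
  by apply: (le_trans (normcB _ _)); rewrite Normc.normc1; lra.
elim: k => [|k IH]; first by rewrite !expr0 !subrr Normc.normc0 mul0r.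
rewrite (_ : _ - 1 = ((1 - z) ^+ k - 1) - z * (1 - z) ^+ k); last first.
  by rewrite exprS; ring.
apply: (le_trans (normcB _ _)); rewrite Normc.normcM normcX.
have : normc z * normc (1 - z) ^+ k <= normc z * 2 ^+ k.
  by rewrite ler_wpM2l ?normc_ge0// lerXn2r ?nnegrE ?normc_ge0.
rewrite (exprS 2 k); lra.
Qed.

(** When [|w|] exceeds [|z|] by this factor, [(w - z)^k] is within a relative
    distance 1/4 of [w^k]. *)
Definition spread k : R := 4 * 2 ^+ k.

Lemma spread_ge4 k : 4 <= spread k.
Proof. by rewrite /spread ler_peMr// exprn_ege1// ler1n. Qed.

Lemma spread_gt0 k : 0 < spread k.
Proof. by apply: lt_le_trans (spread_ge4 k). Qed.

Lemma normc_1BX_div z w k : w != 0 -> spread k * normc z <= normc w ->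
  normc ((1 - z / w) ^+ k - 1) <= 4^-1.
Proof.
move=> w0 zw; have nw : 0 < normc w by rewrite normc_gt0.
have q : normc (z / w) <= (spread k)^-1.
  rewrite Normc.normcM Normc.normcV ler_pdivrMr// mulrC ler_pdivlMr ?spread_gt0//.
  by rewrite mulrC.
have q1 : normc (z / w) <= 1.
  by rewrite (le_trans q)// invf_le1 ?spread_gt0// (le_trans _ (spread_ge4 k)) ?ler1n.
apply: (le_trans (normc_1BX_sub1 _ q1)).
have e : 2 ^+ k * normc (z / w) <= 4^-1.
  rewrite -ler_pdivlMl ?exprn_gt0// (le_trans q)// /spread invfM mulrC.
  by rewrite lexx.
have := normc_ge0 (z / w); lra.
Qed.

(** Multiplying by [phase K0] turns [K0] into its modulus; the errors [e - 1] and
    [K - K0] are then subtracted from it. *)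
Lemma Re_phase_ge (e K K0 : C) : normc (e - 1) <= 4^-1 ->
  3 / 4 * normc K0 - 5 / 4 * normc (K - K0) <= Re (phase K0 * (e * K)).
Proof.
move=> he; have n5 : normc e <= 5 / 4.
  have := normcD (e - 1) 1; rewrite subrK Normc.normc1; lra.
rewrite (_ : phase K0 * _ =
    (normc K0)%:C%C * e + phase K0 * e * (K - K0)); last first.
  by rewrite -phaseE; ring.
rewrite ReD ReRM; apply: lerD.
  have Re1 : 3 / 4 <= Re e.
    have := le_trans (Re_le_normc _) he.
    rewrite ReD ReN/= ler_norml => /andP[]; lra.
  by rewrite mulrC ler_wpM2l ?normc_ge0.
rewrite -[leRHS]opprK lerN2 -ReN.
apply: (le_trans (le_trans (ler_norm _) (Re_le_normc _))).
rewrite normcN 2!Normc.normcM ler_wpM2r ?normc_ge0//.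
rewrite -[leRHS]mul1r; apply: ler_pM; rewrite ?normc_ge0//.
exact: normc_phase.
Qed.

End complex_numbers.

(** * Affine changes of variables *)

Section lebesgue_affine.
Context {R : realType}.

Lemma preimage_affine_oc (c d a b : R) : c != 0 ->
  lebesgue_measure [set t : R | a < c * t + d <= b] =
  if a < b then (`|c|^-1 * (b - a))%:E else 0%E.
Proof.
move=> c0; have [ab|ba] := ltP a b; last first.
  rewrite (_ : mkset _ = set0) ?measure0//.
  apply/seteqP; split => // t /= /andP[h1 h2].
  by move: (lt_le_trans h1 h2); rewrite ltNge ba.
have [cp|cn|ce] := ltrgt0P c; last by rewrite ce eqxx in c0.
- rewrite (_ : mkset _ = [set` `]((a - d) / c), ((b - d) / c)] ]).
    rewrite lebesgue_measure_itv/= lte_fin ltr_pM2r ?invr_gt0// ltrD2r ab.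
    by rewrite -EFinB; congr (_%:E); field.
  apply/seteqP; split => t /=; rewrite in_itv/= ltr_pdivrMr// ler_pdivlMr//;
    by rewrite ltrBlDr lerBrDr mulrC.
- rewrite (_ : mkset _ = [set` `[((b - d) / c), ((a - d) / c)[ ]).
    rewrite lebesgue_measure_itv/= lte_fin ltr_nM2r ?invr_lt0// ltrD2r ab.
    by rewrite -EFinB; congr (_%:E); field.
  apply/seteqP; split => t /=; rewrite in_itv/= ltr_ndivlMr// ler_ndivrMr//;
    by rewrite ltrBlDr lerBrDr mulrC andbC.
Qed.

Lemma lebesgue_measure_affine (c d : R) (A : set (measurableTypeR R)) :
  c != 0 -> measurable A ->
  lebesgue_measure ((fun t => c * t + d) @^-1` A) =
  ((`|c|^-1)%:E * lebesgue_measure A)%E.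
Proof.
move=> c0 mA.
have mf : measurable_fun setT
    (fun t => c * t + d : measurableTypeR R).
  by apply: measurable_funD => //; exact: measurable_funM.
pose m' := mscale (NngNum (normr_ge0 c)) (pushforward (@lebesgue_measure R)
  (fun t => c * t + d : measurableTypeR R)).
have -> : lebesgue_measure A = m' mf A.
  apply: lebesgue_measure_unique => // _ [[a b] _ <-].
  have := preimage_affine_oc d a b c0; set S := mkset _ => hS.
  have E : (fun t => c * t + d) @^-1` `]a, b] = S.
    by apply/seteqP; split => t /=; rewrite in_itv.
  transitivity (`|c|%:E * lebesgue_measure S)%E; last by rewrite -E.
  rewrite hS lebesgue_measure_itv/= lte_fin; case: ifPn => _; last by rewrite mule0.
  by rewrite -EFinM -EFinB mulrA mulfV ?mul1r// normr_eq0.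
by rewrite /m' /mscale/= muleA -EFinM mulVf ?mul1e// normr_eq0.
Qed.

Variable n : nat.
Local Notation leb := (@lebesgue_rV R n).
Local Notation Rn := 'rV[R]_n.
Implicit Types (a v x y : Rn) (c l : R) (A D : set Rn).

Definition box (B : 'I_n -> set (measurableTypeR R)) : set Rn :=
  [set x | forall i, B i (x ord0 i)].

Lemma measurable_box B : (forall i, measurable (B i)) -> measurable (box B).
Proof.
move=> mB; rewrite (_ : box B = \bigcap_(i in [set: 'I_n])
    ((fun x : Rn => x ord0 i : measurableTypeR R) @^-1` B i)); last first.
  by apply/seteqP; split => [x Ax i _|x Ax i]; [exact: Ax|exact: (Ax i)].
apply: fin_bigcap_measurable => // i _.
by rewrite -[X in measurable X]setTI; exact: measurable_coord.
Qed.

Lemma lebesgue_box B : (forall i, measurable (B i)) ->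
  leb (box B) = (\prod_(i < n) lebesgue_measure (B i))%E.
Proof. exact: lebesgue_rV_box. Qed.

Lemma measurable_affine c v : measurable_fun setT (fun x : Rn => c *: x + v).
Proof.
apply: measurable_fun_coordP => i.
rewrite [X in measurable_fun _ X](_ : _ = fun x : Rn => c * x ord0 i + v ord0 i).
  by apply: measurable_funD => //; apply: measurable_funM => //; exact: measurable_coord.
by apply/funext => x; rewrite !mxE.
Qed.

Lemma cube_box a l : cube a l = box (fun i => `[a ord0 i, a ord0 i + l]%classic).
Proof. by apply/seteqP; split => x /= h i; have := h i; rewrite /= in_itv. Qed.

Lemma measurable_cube a l : measurable (cube a l).
Proof. by rewrite cube_box; apply: measurable_box => i. Qed.

Lemma lebesgue_cube a l : 0 <= l -> leb (cube a l) = (l ^+ n)%:E.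
Proof.
move=> l0; rewrite cube_box lebesgue_box//.
rewrite (eq_bigr (fun=> l%:E)); last first.
  move=> i _; rewrite lebesgue_measure_itv/= lte_fin ltrDl.
  have [_|l0'] := ltP 0 l; first by rewrite -EFinD addrAC subrr add0r.
  by congr EFin; apply/eqP; rewrite eq_le l0 l0'.
by rewrite prodEFin prodr_const card_ord.
Qed.

Lemma lebesgue_cube_gt0 a l : 0 < l -> (0 < leb (cube a l))%E.
Proof. by move=> l0; rewrite lebesgue_cube ?lte_fin ?exprn_gt0// ltW. Qed.

Lemma compact_cube a l : compact (cube a l).
Proof.
rewrite cube_box.
apply: (@rV_compact _ _ (fun i => `[a ord0 i, a ord0 i + l]%classic : set R)) => i.
exact: segment_compact.
Qed.

Lemma closed_cube a l : closed (cube a l).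
Proof. by apply: compact_closed (@compact_cube a l); exact: norm_hausdorff. Qed.

(** Both sides are measures of [A] that agree on boxes, where the claim is
    one-dimensional; boxes generate the sigma-algebra. *)
Lemma lebesgue_rV_affine c v A : c != 0 -> measurable A ->
  leb ((fun x => c *: x + v) @^-1` A) = ((`|c|^-1 ^+ n)%:E * leb A)%E.
Proof.
move=> c0 mA.
have mf := measurable_affine c v.
pose m' := mscale (NngNum (exprn_ge0 n (normr_ge0 c)))
  (pushforward leb (fun x => c *: x + v)).
have -> : leb A = m' mf A; last first.
  by rewrite /m' /mscale/= muleA -EFinM -exprMn mulVf ?expr1n ?mul1e// normr_eq0.
pose G := [set B | exists2 A0, (forall i, measurable (A0 i)) & B = box A0].
apply: (@measure_unique _ _ _ G (fun k => cube (const_mx (- k%:R)) (2 * k%:R))) => //.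
- apply/seteqP; split => [B mB|].
    apply: (@smallest_sub _ _ _ _ _ _ B mB); first exact: smallest_sigma_algebra.
    rewrite -bigcup_seq => E/= [i _ [B' mB' <-]]; rewrite setTI.
    apply: sub_sigma_algebra; exists (fun j => if j == i then B' else setT).
      by move=> j; case: ifP.
    apply/seteqP; split => x /=; first by move=> h j; case: eqP => // ->.
    by move/(_ i); rewrite eqxx.
  apply: (@smallest_sub _ _ _ measurable) => [|_ [A0 mA0 ->]].
    exact: sigma_algebra_measurable.
  exact: measurable_box.
- move=> _ _ [A1 m1 ->] [A2 m2 ->]; exists (fun i => A1 i `&` A2 i).
    by move=> i; exact: measurableI.
  by apply/seteqP; split => [x [h1 h2] i|x h]; split => // i; have [] := h i.
- move=> k; set a : Rn := const_mx _; set l := 2 * k%:R.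
  by exists (fun i => `[a ord0 i, a ord0 i + l]%classic); rewrite -?cube_box.
- rewrite -subTset => x _.
  have [M hM] : exists M, forall i, `|x ord0 i| <= M%:R.
    exists (\max_(i < n) (Num.truncn `|x ord0 i|).+1)%N => i.
    rewrite (le_trans (ltW (truncnS_gt _)))// ler_nat.
    exact: (leq_bigmax (F := fun i : 'I_n => (Num.truncn `|x ord0 i|).+1)).
  exists M => // i; have := hM i; rewrite ler_norml mxE => /andP[h1 h2].
  by apply/andP; split => //; lra.
- move=> _ [B mB ->].
  transitivity (\prod_(i < n) lebesgue_measure (B i))%E; first exact: lebesgue_box.
  have E : (fun x => c *: x + v) @^-1` box B =
      box (fun i => (fun t => c * t + v ord0 i) @^-1` (B i)).
    by apply/seteqP; split => x /= h i; have := h i; rewrite !mxE.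
  transitivity ((`|c| ^+ n)%:E * leb (box (fun i =>
    (fun t => (c * t + v ord0 i)%R) @^-1` (B i))))%E; last by rewrite -E.
  have mB' i : measurable ((fun t : measurableTypeR R =>
      c * t + v ord0 i : measurableTypeR R) @^-1` B i).
    rewrite -[X in measurable X]setTI.
    have mg : measurable_fun setT (fun t : measurableTypeR R =>
        c * t + v ord0 i : measurableTypeR R).
      by apply: measurable_funD => //; exact: measurable_funM.
    exact: mg.
  rewrite lebesgue_box//.
  under [X in (_ * X)%E]eq_bigr do rewrite lebesgue_measure_affine//.
  rewrite big_split/= prodEFin prodr_const card_ord muleA -EFinM -exprMn.
  by rewrite mulfV ?normr_eq0// expr1n mul1e.
- move=> k; rewrite (_ : _ (cube _ _) = ((2 * k%:R) ^+ n)%:E) ?ltry//.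
  by apply: lebesgue_cube; rewrite mulr_ge0.
Qed.

End lebesgue_affine.

(** * Muckenhoupt weights *)

Section integral_lemmas.
Context d (T : measurableType d) (R : realType).
Variable mu : {measure set T -> \bar R}.
Implicit Types (D : set T) (f g : T -> R).

Lemma integral_pos_gt0 D f : measurable D -> (0 < mu D)%E ->
  measurable_fun D f -> (forall x, D x -> 0 < f x) ->
  (0 < \int[mu]_(x in D) (f x)%:E)%E.
Proof.
move=> mD D0 mf f0; rewrite lt0e integral_ge0 ?andbT//; last first.
  by move=> x Dx; rewrite lee_fin ltW// f0.
apply/eqP => I0.
have mfE : measurable_fun D (EFin \o f) by exact/measurable_EFinP.
have /(ae_eq_integral_abs mu mD mfE) : (\int[mu]_(x in D) `|(f x)%:E| = 0)%E.
  rewrite -I0; apply: eq_integral => x; rewrite inE => Dx.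
  by rewrite gee0_abs// lee_fin ltW// f0.
move=> [N [mN N0 DN]].
have : (mu D <= mu N)%E.
  apply: le_measure; rewrite ?inE// => x Dx; apply: DN => /= /(_ Dx) [] fx.
  by have := f0 _ Dx; rewrite fx ltxx.
by rewrite N0 leNgt D0.
Qed.

Lemma ln_le_affine (x v a : R) : 0 < x -> 0 < v -> 0 < a ->
  ln x <= ln (a / v) + (v / a * x - 1).
Proof.
move=> x0 v0 a0; have q : 0 < v / a * x by rewrite mulr_gt0// divr_gt0.
have := @le_ln1Dx R (v / a * x - 1).
rewrite addrCA subrr addr0 lnM ?posrE ?divr_gt0//.
have -> : ln (v / a) = - ln (a / v).
  by rewrite -lnV ?posrE ?divr_gt0// invf_div.
have : -1 < v / a * x - 1 by lra.
move=> h /(_ h); lra.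
Qed.

(** Each logarithm lies below its tangent at the average, so the sum of the
    tangents is nonnegative pointwise; integrating it leaves the claim. *)
Lemma log_jensen3 D (A B C : T -> R) (al be ga V a b c : R) :
  measurable D -> mu D = V%:E -> 0 < V ->
  measurable_fun D A -> measurable_fun D B -> measurable_fun D C ->
  (forall x, D x -> 0 < A x) -> (forall x, D x -> 0 < B x) ->
  (forall x, D x -> 0 < C x) ->
  (\int[mu]_(x in D) (A x)%:E = a%:E)%E ->
  (\int[mu]_(x in D) (B x)%:E = b%:E)%E ->
  (\int[mu]_(x in D) (C x)%:E = c%:E)%E ->
  0 <= al -> 0 <= be -> 0 <= ga ->
  (forall x, D x -> al * ln (A x) + be * ln (B x) + ga * ln (C x) = 0) ->
  0 <= al * ln (a / V) + be * ln (b / V) + ga * ln (c / V).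
Proof.
move=> mD DV V0 mA mB mC A0 B0 C0 Aa Bb Cc al0 be0 ga0 ABC.
have D0 : (0 < mu D)%E by rewrite DV lte_fin.
have a0 : 0 < a by rewrite -lte_fin -Aa integral_pos_gt0.
have b0 : 0 < b by rewrite -lte_fin -Bb integral_pos_gt0.
have c0 : 0 < c by rewrite -lte_fin -Cc integral_pos_gt0.
set S := (X in 0 <= X); rewrite leNgt; apply/negP => S0.
have : (\int[mu]_(x in D) (al + be + ga - S)%:E <=
        \int[mu]_(x in D) ((al * (V / a))%:E * (A x)%:E +
          ((be * (V / b))%:E * (B x)%:E + (ga * (V / c))%:E * (C x)%:E)))%E.
  apply: ge0_le_integral => //.
  - by move=> x Dx; rewrite lee_fin; lra.
  - by apply: emeasurable_funD; [|apply: emeasurable_funD];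
      apply: measurable_funeM; exact/measurable_EFinP.
  move=> x Dx; rewrite -!EFinM -!EFinD lee_fin.
  have := ABC _ Dx.
  have := ler_wpM2l al0 (ln_le_affine (A0 _ Dx) V0 a0).
  have := ler_wpM2l be0 (ln_le_affine (B0 _ Dx) V0 b0).
  have := ler_wpM2l ga0 (ln_le_affine (C0 _ Dx) V0 c0).
  rewrite /S -!mulrA; nra.
have nn (r : R) (f : T -> R) : 0 <= r -> (forall x, D x -> 0 < f x) ->
    forall x, D x -> (0 <= r%:E * (f x)%:E)%E.
  by move=> r0 f0 x Dx; rewrite -EFinM lee_fin mulr_ge0// ltW// f0.
have q (r s : R) : 0 <= r -> 0 < s -> 0 <= r * (V / s).
  by move=> r0 s0; rewrite mulr_ge0// divr_ge0// ltW.
have ms (r : R) (f : T -> R) : measurable_fun D f ->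
    measurable_fun D (fun x => r%:E * (f x)%:E)%E.
  by move=> mf; apply: measurable_funeM; exact/measurable_EFinP.
rewrite integral_cst// ge0_integralD//; last 4 first.
- by apply: nn => //; exact: q.
- exact: ms.
- by move=> x Dx; rewrite adde_ge0 ?nn ?q.
- by apply: emeasurable_funD; exact: ms.
rewrite ge0_integralD//; last 4 first.
- by apply: nn => //; exact: q.
- exact: ms.
- by apply: nn => //; exact: q.
- exact: ms.
rewrite !ge0_integralZl_EFin//; try (by exact/measurable_EFinP); try exact: q;
  try (by move=> x Dx; rewrite lee_fin ltW// ?A0 ?B0 ?C0).
rewrite Aa Bb Cc DV -!EFinM -!EFinD lee_fin -!mulrA.
have e (s : R) : 0 < s -> V * (s^-1 * s) = V.
  by move=> s0; rewrite mulVf ?mulr1// gt_eqF.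
rewrite !e//; nra.
Qed.

End integral_lemmas.

Section weights.
Context {R : realType}.
Variable n : nat.
Local Notation leb := (@lebesgue_rV R n).
Local Notation Rn := 'rV[R]_n.
Implicit Types (a x y : Rn) (l p : R) (w : Rn -> R).

Definition dual_weight p w : Rn -> R := fun x => w x `^ (- (p - 1)^-1).

Lemma measurable_powRf (D : set Rn) w r : measurable_fun D w ->
  measurable_fun D (fun x => w x `^ r).
Proof. by move=> mw; exact: (measurableT_comp (measurable_powR _)). Qed.

Lemma ln_dual_weight p w x : 1 < p ->
  (p - 1) * ln (dual_weight p w x) = - ln (w x).
Proof.
by move=> p1; rewrite /dual_weight ln_powR mulrA mulrN mulfV ?mulN1r// subr_eq0 gt_eqF.
Qed.

Lemma weight_cube w a l : weight w -> 0 < l ->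
  exists2 u : R, 0 < u & (\int[leb]_(x in cube a l) (w x)%:E = u%:E)%E.
Proof.
move=> [mw w0 wfin] l0.
have I0 : (0 < \int[leb]_(x in cube a l) (w x)%:E)%E.
  apply: integral_pos_gt0 => //; first exact: measurable_cube.
    exact: lebesgue_cube_gt0.
  exact: measurable_funTS.
have := wfin _ (@compact_cube R n a l).
move: I0; case: (\int[_]_(_ in _) _)%E => // r; rewrite lte_fin => r0 _.
by exists r.
Qed.

Lemma Ap_cube p w : 1 < p -> Ap p w -> exists M : R, forall a l, 0 < l ->
  exists u s : R, [/\ 0 < u, 0 < s,
    (\int[leb]_(x in cube a l) (w x)%:E = u%:E)%E,
    (\int[leb]_(x in cube a l) (dual_weight p w x)%:E = s%:E)%E &
    ln (u / l ^+ n) + (p - 1) * ln (s / l ^+ n) <= M].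
Proof.
move=> p1 [ww wA]; have [mw w0 _] := ww.
have p10 : 0 < p - 1 by rewrite subr_gt0.
exists (ln (fine (Ap_constant p w))) => a l l0.
have [u u0 uE] := weight_cube a ww l0.
have V0 : 0 < l ^+ n by rewrite exprn_gt0.
have lV : leb (cube a l) = (l ^+ n)%:E by rewrite lebesgue_cube// ltW.
have s0 : (0 < \int[leb]_(x in cube a l) (dual_weight p w x)%:E)%E.
  apply: integral_pos_gt0 => //; first exact: measurable_cube.
  - exact: lebesgue_cube_gt0.
  - by apply: measurable_funTS; exact: measurable_powRf.
  - by move=> x _; exact: powR_gt0.
have : (average (cube a l) w *
    average (cube a l) (dual_weight p w) `^ (p - 1) <= Ap_constant p w)%E.
  by apply: ereal_sup_ubound; exists (cube a l) => //; exists a, l.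
rewrite /average lV uE inver gt_eqF//.
move: s0; case: (\int[_]_(_ in _) _)%E => [s|_|] //; last first.
  rewrite mulry gtr0_sg ?invr_gt0// mul1e poweRyr ?gt_eqF// mulry gtr0_sg.
    by rewrite mul1e leye_eq => /eqP h; rewrite h ltxx in wA.
  by rewrite mulr_gt0// invr_gt0.
rewrite lte_fin => s0; rewrite -!EFinM => h.
exists u, s; split => //.
have q0 : 0 < (l ^+ n)^-1 * u * ((l ^+ n)^-1 * s) `^ (p - 1).
  by rewrite mulr_gt0// ?powR_gt0// mulr_gt0// invr_gt0.
have : (l ^+ n)^-1 * u * ((l ^+ n)^-1 * s) `^ (p - 1) <= fine (Ap_constant p w).
  move: h wA; case: (Ap_constant p w) => // r.
rewrite -ler_ln ?posrE//; last first.
  move: h wA; case: (Ap_constant p w) => // r; rewrite lee_fin => h _.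
  exact: lt_le_trans h.
have q1 : 0 < (l ^+ n)^-1 * s by rewrite mulr_gt0// invr_gt0.
have q2 : 0 < (l ^+ n)^-1 * u by rewrite mulr_gt0// invr_gt0.
have q3 : 0 < ((l ^+ n)^-1 * s) `^ (p - 1) by rewrite powR_gt0.
rewrite (lnM (q2 : _ \in Num.pos) (q3 : _ \in Num.pos)) ln_powR.
by rewrite ![(l ^+ n)^-1 * _]mulrC.
Qed.

Lemma subset_cube a a' L l : (forall i, `|a' ord0 i - a ord0 i| <= L * l) ->
  0 <= l -> 0 <= L ->
  let big := cube (a - const_mx (L * l)) ((2 * L + 1) * l) in
  cube a l `<=` big /\ cube a' l `<=` big.
Proof.
move=> aa' l0 L0 /=; split => x hx i; have := hx i; rewrite !mxE => /andP[h1 h2].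
  by apply/andP; split; nra.
have := aa' i; rewrite ler_norml => /andP[h3 h4].
by apply/andP; split; nra.
Qed.

(** Bloom's comparison: with [nu = mu^(1/p) lambda^(-1/p)], the constant that a
    bounded test function on the cube at [a] costs, after Hoelder's inequality
    on a nearby cube, is the [k]-th power of the average of [nu^(1/k)]. *)
Lemma weight_estimate p k mu lam L : 1 < p -> (0 < k)%N -> Ap p mu -> Ap p lam ->
  0 <= L ->
  let nu := fun x => mu x `^ p^-1 * lam x `^ (- p^-1) in
  exists2 W : R, 0 < W & forall a a' l J, 0 < l ->
    (forall i, `|a' ord0 i - a ord0 i| <= L * l) ->
    (\int[leb]_(x in cube a l) (nu x `^ k%:R^-1)%:E = J%:E)%E ->
    0 < J /\ exists u s : R, [/\ 0 < u, 0 < s,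
      (\int[leb]_(x in cube a l) (mu x)%:E = u%:E)%E,
      (\int[leb]_(x in cube a' l) (dual_weight p lam x)%:E = s%:E)%E &
      u `^ p^-1 * s `^ ((p - 1) / p) <= W * (J / l ^+ n) ^+ k * l ^+ n].
Proof.
move=> p1 k0 Amu Alam L0 nu.
have p0 : 0 < p by apply: lt_trans p1.
have p10 : 0 < p - 1 by rewrite subr_gt0.
have [Mm hMm] := Ap_cube p1 Amu; have [Ml hMl] := Ap_cube p1 Alam.
have [[mmu mu0 _] _] := Amu; have [[mlam lam0 _] _] := Alam.
pose c := 2 * L + 1.
have c0 : 0 < c by rewrite /c; lra.
exists (expR ((Mm + Ml + p * ln (c ^+ n)) / p)); first exact: expR_gt0.
move=> a a' l J l0 aa' hJ.
have V0 : 0 < l ^+ n by rewrite exprn_gt0.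
have lV : leb (cube a l) = (l ^+ n)%:E by rewrite lebesgue_cube// ltW.
have mnu : measurable_fun setT (fun x => nu x `^ k%:R^-1).
  by apply: measurable_powRf; apply: measurable_funM; exact: measurable_powRf.
have nu0 x : 0 < nu x `^ k%:R^-1 by rewrite powR_gt0// mulr_gt0// powR_gt0.
have J0 : 0 < J.
  rewrite -lte_fin -hJ; apply: integral_pos_gt0 => //.
  - exact: measurable_cube.
  - exact: lebesgue_cube_gt0.
  - exact: measurable_funTS.
have [u [s [u0 s0 hu hs us]]] := hMm a l l0.
have [ul [_ [ul0 _ hul _ _]]] := hMl a l l0.
have cl0 : 0 < c * l by rewrite mulr_gt0.
have [U [S [U0 S0 hU hS US]]] := hMl (a - const_mx (L * l)) (c * l) cl0.
have [s' [_ [_ s'0 _ hs' _]]] : exists s' z : R, [/\ True, 0 < s', True,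
    (\int[leb]_(x in cube a' l) (dual_weight p lam x)%:E = s'%:E)%E & True].
  by have [z [s' [_ ? _ ? _]]] := hMl a' l l0; exists s', z.
have [sub1 sub2] := subset_cube aa' (ltW l0) L0.
have ulU : ul <= U.
  rewrite -lee_fin -hul -hU; apply: ge0_subset_integral => //.
  - exact: measurable_cube.
  - exact: measurable_cube.
  - by apply/measurable_EFinP; exact: measurable_funTS.
  - by move=> x _; rewrite lee_fin ltW.
have sS : s' <= S.
  rewrite -lee_fin -hs' -hS; apply: ge0_subset_integral => //.
  - exact: measurable_cube.
  - exact: measurable_cube.
  - by apply/measurable_EFinP; apply: measurable_funTS; exact: measurable_powRf.
  - by move=> x _; rewrite lee_fin powR_ge0.
split => //; exists u, s'; split => //.
have k0' : k%:R != 0 :> R by rewrite pnatr_eq0 -lt0n.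
(* the three exponents are chosen to make [mu] and [lam] cancel *)
have jens : 0 <= p * k%:R * ln (J / l ^+ n) + (p - 1) * ln (s / l ^+ n) +
    1 * ln (ul / l ^+ n).
  apply: (@log_jensen3 _ _ _ leb (cube a l) (fun x => nu x `^ k%:R^-1)
    (dual_weight p mu) lam) => //.
  - exact: measurable_cube.
  - exact: measurable_funTS.
  - by apply: measurable_funTS; exact: measurable_powRf.
  - exact: measurable_funTS.
  - by move=> x _; exact: powR_gt0.
  - by rewrite mulr_ge0// ltW.
  - exact: ltW.
  move=> x _; rewrite ln_dual_weight// !ln_powR lnM ?posrE ?powR_gt0// !ln_powR.
  by field; rewrite gt_eqF//= k0'.
have cV0 : 0 < c ^+ n by rewrite exprn_gt0.
have eU : ln (ul / l ^+ n) - ln (c ^+ n) <= ln (U / (c * l) ^+ n).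
  rewrite -ln_div ?posrE ?divr_gt0// ler_ln ?posrE ?divr_gt0 ?exprn_gt0//.
  rewrite exprMn invfM mulrA mulrAC.
  by rewrite ler_pM2r ?invr_gt0// ler_pM2r ?invr_gt0.
have eS : ln (s' / l ^+ n) - ln (c ^+ n) <= ln (S / (c * l) ^+ n).
  rewrite -ln_div ?posrE ?divr_gt0// ler_ln ?posrE ?divr_gt0 ?exprn_gt0//.
  rewrite exprMn invfM mulrA mulrAC.
  by rewrite ler_pM2r ?invr_gt0// ler_pM2r ?invr_gt0.
have main : ln (u / l ^+ n) + (p - 1) * ln (s' / l ^+ n) <=
    Mm + Ml + p * ln (c ^+ n) + p * (k%:R * ln (J / l ^+ n)).
  have := ler_wpM2l (ltW p10) eS; lra.
have jv : 0 < J / l ^+ n by rewrite divr_gt0.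
rewrite -ler_ln ?posrE; last 2 first.
  by rewrite mulr_gt0// powR_gt0.
  by rewrite !mulr_gt0// ?exprn_gt0 ?expR_gt0.
rewrite !lnM ?posrE ?mulr_gt0 ?powR_gt0 ?exprn_gt0 ?expR_gt0//.
rewrite expRK !ln_powR (lnXn k)// -mulr_natl.
have -> : (p - 1) / p = 1 - p^-1 by rewrite mulrBl mulfV ?gt_eqF// mul1r.
rewrite -(ler_pM2l p0); move: main.
rewrite !ln_div ?posrE// => main.
rewrite !mulrDr !mulrA mulfV ?gt_eqF// mul1r mulrBr mulfV ?gt_eqF//.
rewrite [p * _ / p]mulrAC mulfV ?gt_eqF// mul1r; lra.
Qed.

End weights.

(** * Complex integration and the kernel of the commutator *)

Section complex_Rintegral.
Context d (T : measurableType d) (R : realType).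
Variable mu : {measure set T -> \bar R}.
Local Notation Re := (@complex.Re R).
Local Notation Im := (@complex.Im R).
Implicit Types (f g : T -> R[i]) (D : set T).

Lemma Rintegral_complexZ D (c : R[i]) f : measurable D ->
  mu.-integrable D (fun x => (Re (f x))%:E) ->
  mu.-integrable D (fun x => (Im (f x))%:E) ->
  \int[mu]_(x in D) Re (c * f x) =
    Re c * \int[mu]_(x in D) Re (f x) - Im c * \int[mu]_(x in D) Im (f x) /\
  \int[mu]_(x in D) Im (c * f x) =
    Re c * \int[mu]_(x in D) Im (f x) + Im c * \int[mu]_(x in D) Re (f x).
Proof.
move=> mD f1 f2; split.
  rewrite -(RintegralZl (Re c) mD f1) -(RintegralZl (Im c) mD f2).
  rewrite -(RintegralB mD (integrableZl mD (Re c) f1) (integrableZl mD (Im c) f2)).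
  by congr fine; apply: eq_integral => x _; rewrite ReM.
rewrite -(RintegralZl (Re c) mD f2) -(RintegralZl (Im c) mD f1).
rewrite -(RintegralD mD (integrableZl mD (Re c) f2) (integrableZl mD (Im c) f1)).
by congr fine; apply: eq_integral => x _; rewrite ImM.
Qed.

End complex_Rintegral.

Section complex_integration.
Context {R : realType}.
Variable n : nat.
Local Notation Rn := 'rV[R]_n.
Local Notation C := R[i].
Local Notation leb := (@lebesgue_rV R n).
Local Notation normc := (@Normc.normc R).
Implicit Types (f g b : Rn -> C) (D X Y : set Rn).

Lemma cmeasurableS D D' f : measurable D' -> D `<=` D' ->
  cmeasurable D' f -> cmeasurable D f.
Proof. by move=> mD' sub [h1 h2]; split; exact: (measurable_funS mD' sub). Qed.

Lemma cmeasurableTS D f : cmeasurable setT f -> cmeasurable D f.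
Proof. exact: cmeasurableS. Qed.

Lemma cmeasurable_cst D (c : C) : cmeasurable D (fun=> c).
Proof. by split; exact: measurable_cst. Qed.

Lemma cmeasurableD D f g : cmeasurable D f -> cmeasurable D g ->
  cmeasurable D (fun x => f x + g x).
Proof.
move=> [f1 f2] [g1 g2]; split.
  by under eq_fun do rewrite ReD; exact: measurable_funD.
by under eq_fun do rewrite ImD; exact: measurable_funD.
Qed.

Lemma cmeasurableN D f : cmeasurable D f -> cmeasurable D (fun x => - f x).
Proof.
move=> [f1 f2]; split.
  by under eq_fun do rewrite ReN; exact: measurable_funN.
by under eq_fun do rewrite ImN; exact: measurable_funN.
Qed.

Lemma cmeasurableB D f g : cmeasurable D f -> cmeasurable D g ->
  cmeasurable D (fun x => f x - g x).
Proof. by move=> mf mg; apply: cmeasurableD => //; exact: cmeasurableN. Qed.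

Lemma cmeasurableM D f g : cmeasurable D f -> cmeasurable D g ->
  cmeasurable D (fun x => f x * g x).
Proof.
move=> [f1 f2] [g1 g2]; split.
  by under eq_fun do rewrite ReM; apply: measurable_funB; exact: measurable_funM.
by under eq_fun do rewrite ImM; apply: measurable_funD; exact: measurable_funM.
Qed.

Lemma cmeasurableX D f k : cmeasurable D f -> cmeasurable D (fun x => f x ^+ k).
Proof.
move=> mf; elim: k => [|k IH]; first exact: cmeasurable_cst.
by under eq_fun do rewrite exprS; exact: cmeasurableM.
Qed.

Lemma cmeasurableR D (u : Rn -> R) : measurable_fun D u ->
  cmeasurable D (fun x => (u x)%:C%C).
Proof. by move=> mu; split => //; exact: measurable_cst. Qed.

Lemma measurable_normc D f : cmeasurable D f ->
  measurable_fun D (fun x => normc (f x)).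
Proof.
move=> [f1 f2]; under eq_fun do rewrite normcE.
apply: (measurableT_comp (f := @Num.sqrt R)).
  by apply: continuous_measurable_fun; exact: sqrt_continuous.
by apply: measurable_funD; exact: measurable_funX.
Qed.

Lemma measurable_inv_ge0 D (u : Rn -> R) : (forall x, 0 <= u x) ->
  measurable_fun D u -> measurable_fun D (fun x => (u x)^-1).
Proof.
move=> u0 mu; under eq_fun do rewrite -powR_inv1//.
exact: (measurableT_comp (measurable_powR _)).
Qed.

Lemma cmeasurable_phase D f : cmeasurable D f ->
  cmeasurable D (fun x => phase (f x)).
Proof.
move=> mf; apply: cmeasurableM.
  apply: cmeasurableR; apply: measurable_inv_ge0 => [x|]; first exact: normc_ge0.
  exact: measurable_normc.
move: mf => [f1 f2]; split.
  by under eq_fun do rewrite ReJ.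
by under eq_fun do rewrite ImJ; exact: measurable_funN.
Qed.

Definition cintegrable D f :=
  leb.-integrable D (fun x => (complex.Re (f x))%:E) /\
  leb.-integrable D (fun x => (complex.Im (f x))%:E).

Lemma cintegrableP D f : measurable D -> cmeasurable D f ->
  (\int[leb]_(x in D) (normc (f x))%:E < +oo)%E -> cintegrable D f.
Proof.
move=> mD mf fi; have [f1 f2] := mf.
have ni : leb.-integrable D (fun x => (normc (f x))%:E).
  apply/integrableP; split; first by apply/measurable_EFinP; exact: measurable_normc.
  by under eq_integral do rewrite gee0_abs ?lee_fin ?normc_ge0//.
split; apply: (le_integrable mD _ _ ni); try exact/measurable_EFinP.
  move=> x _; rewrite /= lee_fin [leRHS]ger0_norm ?normc_ge0//.
  exact: Re_le_normc.
move=> x _; rewrite /= lee_fin [leRHS]ger0_norm ?normc_ge0//.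
exact: Im_le_normc.
Qed.

Lemma cintegralZl D (c : C) f : measurable D -> cintegrable D f ->
  cintegral D (fun x => c * f x) = c * cintegral D f.
Proof.
move=> mD [f1 f2]; have [e1 e2] := Rintegral_complexZ c mD f1 f2.
by apply: complex_ext; rewrite ?(ReM, ImM); [exact: e1|exact: e2].
Qed.

Lemma cintegralB D f g : measurable D -> cintegrable D f -> cintegrable D g ->
  cintegral D (fun x => f x - g x) = cintegral D f - cintegral D g.
Proof.
move=> mD [f1 f2] [g1 g2]; apply: complex_ext; rewrite ?(ReD, ImD, ReN, ImN).
  rewrite -[RHS](RintegralB mD f1 g1); congr fine; apply: eq_integral => x _.
  by rewrite ReD ReN.
rewrite -[RHS](RintegralB mD f2 g2); congr fine; apply: eq_integral => x _.
by rewrite ImD ImN.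
Qed.

Lemma eq_cintegral D f g : (forall x, D x -> f x = g x) ->
  cintegral D f = cintegral D g.
Proof.
by move=> fg; congr Complex; apply: eq_Rintegral => x; rewrite inE => /fg ->.
Qed.

Lemma cintegral_supp D f : (forall x, ~ D x -> f x = 0) ->
  cintegral setT f = cintegral D f.
Proof.
move=> f0; congr Complex; rewrite [RHS]Rintegral_mkcond; congr fine; apply: eq_integral => x _;
  by rewrite patchE; case: ifPn => //; rewrite notin_setE => /f0 ->.
Qed.

Lemma integral_supp D (u : Rn -> R) : measurable D -> (forall x, ~ D x -> u x = 0) ->
  (\int[leb]_x (u x)%:E = \int[leb]_(x in D) (u x)%:E)%E.
Proof.
move=> mD u0; rewrite [RHS]integral_mkcond; apply: eq_integral => x _.
by rewrite patchE; case: ifPn => //; rewrite notin_setE => /u0 ->.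
Qed.

(** By induction on [j]: one more commutator turns [C h] into [b (C h) - C (b h)],
    and both terms are integral operators off the support of [h].  The weight
    [(1 + |b|)^j] is what the [j] multiplications by [b] absorb. *)
Lemma iter_commutator_kernel K T b X Y : operator_with_kernel K T ->
  cmeasurable setT b -> measurable Y -> compact Y -> X `&` Y = set0 ->
  (forall x, X x -> cmeasurable Y (K x)) ->
  (forall u : Rn -> R, measurable_fun setT u -> (forall y, 0 <= u y) ->
     (\int[leb]_(y in Y) (u y)%:E < +oo)%E ->
     {ae leb, forall x, X x ->
        (\int[leb]_(y in Y) (u y * normc (K x y))%:E < +oo)%E}) ->
  forall j h, cmeasurable setT h -> (forall y, ~ Y y -> h y = 0) ->
    (\int[leb]_(y in Y) ((1 + normc (b y)) ^+ j * normc (h y))%:E < +oo)%E ->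
  cmeasurable setT (iter_commutator b j T h) /\
  {ae leb, forall x, X x -> iter_commutator b j T h x =
     cintegral Y (fun y => (b x - b y) ^+ j * (K x y * h y))}.
Proof.
move=> [Tm _ TK] mb mY cY XY mK Kfin.
have cY' : closed Y by apply: compact_closed => //; exact: norm_hausdorff.
elim=> [|j IH] h mh h0 hfin.
  have hsub : csupp h `<=` Y.
    rewrite /csupp (closure_id Y).1//; apply: closureS => y /=.
    by apply: contra_neqP => /h0.
  have hL : L1_c h.
    split => //; first exact: subclosed_compact (@closed_closure _ _) cY hsub.
    rewrite (@integral_supp Y (fun x => normc (h x)))//.
      by move: hfin; under eq_integral do rewrite expr0 mul1r.
    by move=> x /h0 ->; rewrite Normc.normc0.
  split; first exact: Tm.
  apply: filterS (TK h hL) => x hx Xx; rewrite /iter_commutator/= hx; last first.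
    by move=> /hsub Yx; have : (X `&` Y) x by []; rewrite XY.
  rewrite (@cintegral_supp Y); last by move=> y /h0 ->; rewrite mulr0.
  by apply: eq_cintegral => y _; rewrite expr0 mul1r.
have mn : measurable_fun setT (fun y => 1 + normc (b y)).
  by apply: measurable_funD => //; exact: measurable_normc.
have n1 y : 1 <= 1 + normc (b y) by rewrite lerDl normc_ge0.
have hfin' : (\int[leb]_(y in Y)
    ((1 + normc (b y)) ^+ j * normc (h y))%:E < +oo)%E.
  apply: le_lt_trans hfin; apply: ge0_le_integral => //.
  - by move=> x _; rewrite lee_fin mulr_ge0 ?normc_ge0// exprn_ge0// addr_ge0 ?normc_ge0.
  - apply/measurable_EFinP/measurable_funTS/measurable_funM.
      exact: measurable_funX.
    exact: measurable_normc.
  - apply/measurable_EFinP/measurable_funTS/measurable_funM.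
      exact: measurable_funX.
    exact: measurable_normc.
  move=> x _; rewrite lee_fin ler_wpM2r ?normc_ge0//.
  by rewrite exprS ler_peMl// exprn_ge0// (le_trans _ (n1 x)).
have [m1 e1] := IH h mh h0 hfin'.
have mbh : cmeasurable setT (fun y => b y * h y) by exact: cmeasurableM.
have [m2 e2] : cmeasurable setT (iter_commutator b j T (fun y => b y * h y)) /\
    {ae leb, forall x, X x -> iter_commutator b j T (fun y => b y * h y) x =
     cintegral Y (fun y => (b x - b y) ^+ j * (K x y * (b y * h y)))}.
  apply: IH => //; first by move=> y /h0 ->; rewrite mulr0.
  apply: le_lt_trans hfin; apply: ge0_le_integral => //.
  - by move=> x _; rewrite lee_fin mulr_ge0 ?normc_ge0// exprn_ge0// addr_ge0 ?normc_ge0.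
  - apply/measurable_EFinP/measurable_funTS/measurable_funM.
      exact: measurable_funX.
    exact: measurable_normc.
  - apply/measurable_EFinP/measurable_funTS/measurable_funM.
      exact: measurable_funX.
    exact: measurable_normc.
  move=> x _; rewrite lee_fin Normc.normcM mulrA ler_wpM2r ?normc_ge0//.
  by rewrite exprSr ler_wpM2l ?lerDr// exprn_ge0// (le_trans _ (n1 x)).
split.
  apply: cmeasurableB => //; exact: cmeasurableM.
pose u y := (1 + normc (b y)) ^+ j.+1 * normc (h y).
have mu : measurable_fun setT u.
  apply: measurable_funM; last exact: measurable_normc.
  exact: measurable_funX.
have u0 y : 0 <= u y.
  by rewrite mulr_ge0 ?normc_ge0// exprn_ge0// addr_ge0 ?normc_ge0.
apply: filterS3 e1 e2 (Kfin u mu u0 hfin) => x e1 e2 fin Xx.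
rewrite [LHS](_ : _ = b x * iter_commutator b j T h x -
  iter_commutator b j T (fun y => b y * h y) x)// e1// e2//.
have mKx := mK _ Xx.
have mbx : cmeasurable Y (fun y => (b x - b y) ^+ j).
  by apply: cmeasurableX; apply: cmeasurableB; [exact: cmeasurable_cst|exact: cmeasurableTS].
have bnd g : cmeasurable setT g -> (forall y, normc (g y) <= (1 + normc (b y)) * normc (h y)) ->
    cintegrable Y (fun y => (b x - b y) ^+ j * (K x y * g y)).
  move=> mg gh; have mfull : cmeasurable Y (fun y => (b x - b y) ^+ j * (K x y * g y)).
    by apply: cmeasurableM => //; apply: cmeasurableM => //; exact: cmeasurableTS.
  apply: cintegrableP => //.
  have := fin Xx; have -> : (fun y => (u y * normc (K x y))%:E) =
    (fun y => (u y * normc (K x y))%:E) by [].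
  move=> fin'.
  apply: (@le_lt_trans _ _ (\int[leb]_(y in Y)
      (((1 + normc (b x)) ^+ j)%:E * (u y * normc (K x y))%:E))%E).
    apply: ge0_le_integral => //.
    - by move=> y _; rewrite lee_fin normc_ge0.
    - by apply/measurable_EFinP; exact: measurable_normc.
    - apply: measurable_funeM; apply/measurable_EFinP/measurable_funM.
        exact: measurable_funTS.
      exact: measurable_normc.
    move=> y _; rewrite -EFinM lee_fin !Normc.normcM normcX.
    have -> : (1 + normc (b x)) ^+ j * (u y * normc (K x y)) =
      ((1 + normc (b x)) * (1 + normc (b y))) ^+ j *
        (normc (K x y) * ((1 + normc (b y)) * normc (h y))).
      by rewrite /u exprMn exprSr; ring.
    apply: ler_pM; rewrite ?exprn_ge0 ?mulr_ge0 ?normc_ge0//.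
      apply: lerXn2r; rewrite ?nnegrE ?normc_ge0 ?mulr_ge0 ?addr_ge0 ?normc_ge0//.
      apply: (le_trans (normcB _ _)).
      by have := normc_ge0 (b x); have := normc_ge0 (b y); nra.
    by rewrite ler_wpM2l ?normc_ge0.
  rewrite ge0_integralZl_EFin//.
  - apply: lte_mul_pinfty => //; rewrite lee_fin exprn_ge0// addr_ge0 ?normc_ge0//.
  - by move=> y _; rewrite lee_fin mulr_ge0 ?normc_ge0.
  - apply/measurable_EFinP/measurable_funM; first exact: measurable_funTS.
    exact: measurable_normc.
  - by rewrite exprn_ge0// addr_ge0 ?normc_ge0.
have i1 := bnd _ mh (fun y => ler_peMl (normc_ge0 _) (n1 y)).
have i2 : cintegrable Y (fun y => (b x - b y) ^+ j * (K x y * (b y * h y))).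
  apply: (bnd (fun y => b y * h y)) => // y.
  by rewrite Normc.normcM ler_wpM2r ?normc_ge0// lerDr.
rewrite -cintegralZl// -cintegralB//; last first.
  have [q1 q2] := i1; split.
    under [X in integrable _ _ X]eq_fun do rewrite ReM EFinB !EFinM.
    by apply: integrableB => //; exact: integrableZl.
  under [X in integrable _ _ X]eq_fun do rewrite ImM EFinD !EFinM.
  by apply: integrableD => //; exact: integrableZl.
by apply: eq_cintegral => y _; rewrite exprS; ring.
Qed.

End complex_integration.

(** * Hoelder's inequality for test functions *)

Section hoelder_weights.
Context {R : realType}.
Variable n : nat.
Local Notation Rn := 'rV[R]_n.
Local Notation C := R[i].
Local Notation leb := (@lebesgue_rV R n).
Local Notation normc := (@Normc.normc R).
Implicit Types (f g : Rn -> C) (X Y : set Rn) (mu lam : Rn -> R) (p : R).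

Lemma hoelder_dual_weight p lam (g : Rn -> R) X s : 1 < p -> weight lam ->
  measurable_fun setT g -> (forall x, 0 <= g x) -> measurable X ->
  (\int[leb]_(x in X) (dual_weight p lam x)%:E = s%:E)%E ->
  (\int[leb]_(x in X) (g x)%:E <=
   (\int[leb]_x (g x `^ p * lam x)%:E) `^ p^-1 * (s `^ ((p - 1) / p))%:E)%E.
Proof.
move=> p1 [mlam lam0 _] mg g0 mX hs.
have p0 : 0 < p by apply: lt_trans p1.
have p10 : 0 < p - 1 by rewrite subr_gt0.
pose f1 x := g x * lam x `^ p^-1.
pose f2 x := lam x `^ (- p^-1) * \1_X x.
have mf1 : measurable_fun setT f1 by apply: measurable_funM => //; exact: measurable_powRf.
have mf2 : measurable_fun setT f2.
  by apply: measurable_funM => //; exact: measurable_powRf.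
have q0 : 0 < p / (p - 1) by rewrite divr_gt0.
have pq : p^-1 + (p / (p - 1))^-1 = 1.
  by rewrite invf_div; field; rewrite gt_eqF.
have := hoelder leb mf1 mf2 p0 q0 pq.
rewrite Lnorm1 unlock invf_div.
rewrite [X in (X <= _)%E -> _](_ : _ = \int[leb]_(x in X) (g x)%:E)%E; last first.
  rewrite [RHS]integral_mkcond; apply: eq_integral => x _.
  rewrite patchE /f1 /f2/= /indic; case: ifPn => _; last by rewrite !mulr0 normr0.
  rewrite mulr1 -mulrA -powRD ?subrr ?powRr0 ?mulr1 ?ger0_norm//.
  by apply/implyP => _; rewrite gt_eqF.
rewrite [X in (_ <= X `^ _ * _)%E -> _](_ : _ =
    \int[leb]_x (g x `^ p * lam x)%:E)%E; last first.
  apply: eq_integral => x _; rewrite /f1/= ger0_norm ?mulr_ge0 ?powR_ge0//.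
  by rewrite powRM ?powR_ge0// -powRrM mulVf ?gt_eqF// powRr1// ltW.
rewrite [X in (_ <= _ * X `^ _)%E -> _](_ : _ = s%:E)//.
rewrite -hs [RHS]integral_mkcond; apply: eq_integral => x _.
rewrite patchE /f2/= /indic; case: ifPn => _; last first.
  by rewrite mulr0 normr0 powR0// gt_eqF.
rewrite mulr1 ger0_norm ?powR_ge0// -powRrM /dual_weight.
by congr (_ `^ _)%:E; field; rewrite !gt_eqF.
Qed.

(** A function bounded by 1 on [Y] has norm at most [mu(Y)^(1/p)], and passing from
    the norm in [L^p(lam)] to the integral over [X] costs a power of the dual weight. *)
Lemma test_bound p mu lam (S : (Rn -> C) -> Rn -> C) N u s X Y f : 1 < p ->
  weight mu -> weight lam -> measurable X -> measurable Y ->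
  (\int[leb]_(x in Y) (mu x)%:E = u%:E)%E ->
  (\int[leb]_(x in X) (dual_weight p lam x)%:E = s%:E)%E ->
  cmeasurable setT f -> (forall y, normc (f y) <= 1) ->
  (forall y, ~ Y y -> f y = 0) -> cmeasurable setT (S f) -> 0 <= N ->
  (wLnorm p lam (S f) <= N%:E * wLnorm p mu f)%E ->
  (\int[leb]_(x in X) (normc (S f x))%:E <=
    (N * (u `^ p^-1 * s `^ ((p - 1) / p)))%:E)%E.
Proof.
move=> p1 wmu wlam mX mY hu hs mf f1 f0 mS N0 hN.
have p0 : 0 < p by apply: lt_trans p1.
have [mmu mu0 _] := wmu.
have := hoelder_dual_weight p1 wlam (measurable_normc mS) (fun x => normc_ge0 _) mX hs.
move=> /le_trans; apply; rewrite mulrA EFinM; apply: lee_wpmul2r.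
  by rewrite lee_fin powR_ge0.
apply: (le_trans hN); rewrite EFinM; apply: lee_wpmul2l => //.
rewrite /wLnorm -poweR_EFin; apply: gt0_ler_poweR.
- by rewrite invr_ge0 ltW.
- rewrite in_itv/= leey andbT; apply: integral_ge0 => x _.
  by rewrite lee_fin mulr_ge0 ?powR_ge0// ltW.
- rewrite in_itv/= leey andbT -hu; apply: integral_ge0 => x _.
  by rewrite lee_fin ltW.
rewrite -hu (@integral_supp _ _ Y (fun x => normc (f x) `^ p * mu x))//; last first.
  by move=> x /f0 ->; rewrite Normc.normc0 powR0 ?mul0r// gt_eqF.
apply: ge0_le_integral => //.
- by move=> x _; rewrite lee_fin mulr_ge0 ?powR_ge0// ltW.
- apply/measurable_EFinP/measurable_funTS/measurable_funM => //.
  by apply: measurable_powRf; exact: measurable_normc.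
- by apply/measurable_EFinP; exact: measurable_funTS.
move=> x _; rewrite lee_fin ler_piMl//; first exact: ltW.
have -> : 1 = 1 `^ p :> R by rewrite powR1.
 apply: ge0_ler_powR; rewrite ?nnegrE ?normc_ge0//.
exact: ltW.
Qed.

End hoelder_weights.

(** * Lower bounds for the kernel integral *)

Section test_functions.
Context {R : realType}.
Local Notation C := R[i].
Local Notation normc := (@Normc.normc R).
Implicit Types z w K : C.

Lemma phase_powB z w k : w != 0 ->
  phase w ^+ k * (w - z) ^+ k = (normc w ^+ k)%:C%C * (1 - z / w) ^+ k.
Proof.
move=> w0; rewrite (_ : w - z = w * (1 - z / w)); last by field.
rewrite [(w * _) ^+ k]exprMn mulrA -[phase _ ^+ k * _]exprMn phaseE.
by rewrite rmorphXn.
Qed.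

Lemma phase_powM z w k : w != 0 ->
  phase (- w) ^+ k * (z - w) ^+ k = (normc w ^+ k)%:C%C * (1 - z / w) ^+ k.
Proof.
move=> w0; rewrite -normcN (_ : z - w = - w - - z); last by ring.
by rewrite phase_powB ?oppr_eq0// invrN mulrNN.
Qed.

Lemma test_Re z w K K0 k (t : R) : w != 0 -> spread k * normc z <= normc w ->
  0 <= t ->
  3 / 4 * normc K0 * t - 5 / 4 * (t * normc (K - K0)) <=
  complex.Re (phase K0 * (t%:C%C * (1 - z / w) ^+ k * K)).
Proof.
move=> w0 zw t0.
rewrite (_ : phase K0 * _ = t%:C%C * (phase K0 * ((1 - z / w) ^+ k * K))); last by ring.
rewrite ReRM; have := ler_wpM2l t0 (Re_phase_ge K K0 (normc_1BX_div w0 zw)).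
by move=> h; apply: le_trans h; rewrite mulrBr; lra.
Qed.

Lemma test_normc z w K K0 k (t : R) : w != 0 -> spread k * normc z <= normc w ->
  0 <= t ->
  normc (t%:C%C * (1 - z / w) ^+ k * K) <=
  5 / 4 * normc K0 * t + 5 / 4 * (t * normc (K - K0)).
Proof.
move=> w0 zw t0; rewrite !Normc.normcM normcR ger0_norm//.
have h1 : normc ((1 - z / w) ^+ k) <= 5 / 4.
  have := normcD ((1 - z / w) ^+ k - 1) 1; rewrite subrK Normc.normc1.
  by have := normc_1BX_div w0 zw; lra.
have h2 : normc K <= normc K0 + normc (K - K0).
  by have := normcD K0 (K - K0); rewrite addrC subrK.
have := ler_pM (normc_ge0 _) (normc_ge0 _) h1 h2.
by move=> /(ler_wpM2l t0); lra.
Qed.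

End test_functions.

Section lower_bounds.
Context {R : realType}.
Variable n : nat.
Local Notation Rn := 'rV[R]_n.
Local Notation C := R[i].
Local Notation leb := (@lebesgue_rV R n).
Local Notation normc := (@Normc.normc R).
Implicit Types (D X Y : set Rn).

Lemma measurable_superlevel D (u : Rn -> R) s : measurable D ->
  measurable_fun setT u -> measurable (D `&` [set x | s <= u x]).
Proof.
move=> mD mu; rewrite (_ : [set x | s <= u x] = u @^-1` `[s, +oo[).
  by apply: measurable_funTS.
by apply/seteqP; split => x /=; rewrite in_itv/= andbT.
Qed.

Lemma sub_measure_real D A (V : R) : measurable D -> measurable A -> A `<=` D ->
  leb D = V%:E -> exists a : R, [/\ 0 <= a, a <= V & leb A = a%:E].
Proof.
move=> mD mA AD DV.
have : (leb A <= leb D)%E by apply: le_measure; rewrite ?inE.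
have : (0 <= leb A)%E by exact: measure_ge0.
rewrite DV; case: (leb A) => // a; rewrite !lee_fin => a0 aV.
by exists a.
Qed.

(** If the errors [q * kappa] have infinite integral there is nothing to prove;
    otherwise the integrand is integrable and the real part is integrated. *)
Lemma cintegral_lower Y (H : Rn -> C) (th : C) (q kappa : Rn -> R)
    (c c' c2 I : R) : measurable Y -> cmeasurable Y H ->
  measurable_fun Y q -> measurable_fun Y kappa ->
  (forall y, Y y -> 0 <= q y) -> (forall y, Y y -> 0 <= kappa y) ->
  normc th <= 1 -> 0 <= c -> 0 < c' -> 0 <= c2 ->
  (forall y, Y y -> normc (H y) <= c2 * q y + c' * (q y * kappa y)) ->
  (forall y, Y y -> c * q y - c' * (q y * kappa y) <= complex.Re (th * H y)) ->
  (\int[leb]_(y in Y) (q y)%:E = I%:E)%E ->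
  ((c * I)%:E <= (normc (cintegral Y H))%:E +
     c'%:E * \int[leb]_(y in Y) (q y * kappa y)%:E)%E.
Proof.
move=> mY mH mq mk q0 k0 th1 c0 c'0 c20 nH ReH hI.
have qk0 y : Y y -> (0 <= (q y * kappa y)%:E)%E.
  by move=> Yy; rewrite lee_fin mulr_ge0 ?q0 ?k0.
have mqk : measurable_fun Y (fun y => (q y * kappa y)%:E).
  by apply/measurable_EFinP; exact: measurable_funM.
have : (0 <= \int[leb]_(y in Y) (q y * kappa y)%:E)%E by exact: integral_ge0.
case hW : (\int[leb]_(y in Y) (q y * kappa y)%:E)%E => [W| |]//; last first.
  by move=> _; rewrite gt0_muley ?lte_fin// addey// leey.
rewrite lee_fin => W0.
have iq : leb.-integrable Y (fun y => (q y)%:E).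
  apply/integrableP; split; first exact/measurable_EFinP.
  rewrite (eq_integral (fun y => (q y)%:E)) ?hI ?ltry// => y; rewrite inE => Yy.
  by rewrite gee0_abs// lee_fin q0.
have iqk : leb.-integrable Y (fun y => (q y * kappa y)%:E).
  apply/integrableP; split => //.
  rewrite (eq_integral (fun y => (q y * kappa y)%:E)) ?hW ?ltry// => y.
  by rewrite inE => Yy; rewrite gee0_abs// qk0.
have icomb (r r' : R) : leb.-integrable Y (fun y => (r * q y + r' * (q y * kappa y))%:E).
  under [X in integrable _ _ X]eq_fun do rewrite EFinD !EFinM -!EFinM (EFinM r) (EFinM r').
  by apply: integrableD => //; exact: integrableZl.
have iH : cintegrable Y H.
  apply: cintegrableP => //; apply: (@le_lt_trans _ _
    (\int[leb]_(y in Y) (c2 * q y + c' * (q y * kappa y))%:E)%E).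
    apply: ge0_le_integral => //.
    - by move=> y _; rewrite lee_fin normc_ge0.
    - by apply/measurable_EFinP; exact: measurable_normc.
    - exact: measurable_int (icomb c2 c').
  exact: (integrable_lty mY (icomb c2 c')).
rewrite -EFinM -EFinD lee_fin -lerBlDr.
apply: (@le_trans _ _ (complex.Re (cintegral Y (fun y => th * H y)))); last first.
  rewrite cintegralZl//; apply: (le_trans (le_trans (ler_norm _) (Re_le_normc _))).
  by rewrite Normc.normcM ler_piMl ?normc_ge0.
have iRe : leb.-integrable Y (fun y => (complex.Re (th * H y))%:E).
  have [h1 h2] := iH.
  under [X in integrable _ _ X]eq_fun do rewrite ReM EFinB !EFinM.
  by apply: integrableB => //; exact: integrableZl.
rewrite -lee_fin [X in (_ <= X)%E](_ : _ =
    \int[leb]_(y in Y) (complex.Re (th * H y))%:E)%E; last first.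
  by rewrite /= fineK//; exact: integrable_fin_num.
apply: (@le_trans _ _ (\int[leb]_(y in Y) (c * q y + (- c') * (q y * kappa y))%:E)%E).
  under eq_integral do rewrite EFinD.
  rewrite integralD//=.
  - under eq_integral do rewrite EFinM.
    rewrite integralZl// hI; under eq_integral do rewrite EFinM.
    by rewrite integralZl// hW -!EFinM -EFinD lee_fin mulNr.
  - under [X in integrable _ _ X]eq_fun do rewrite EFinM; exact: integrableZl.
  - under [X in integrable _ _ X]eq_fun do rewrite EFinM; exact: integrableZl.
apply: (le_integral mY (icomb c (- c')) iRe).
by move=> y; rewrite inE => Yy; rewrite lee_fin mulNr ReH.
Qed.

(** The error [K - K0] is measured in mean, because a kernel with a merely
    integrable [Omega] admits no pointwise bound: over [X] against any mass [u] on
    [Y], and over [Y] for each point of [X].  The bound [v] stands for the inner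
    integral, whose measurability in [x] a pointwise estimate does not provide. *)
Definition nearly_constant (K : Rn -> Rn -> C) (K0 : C) (eps : R) X Y :=
  [/\ (forall x, X x -> cmeasurable Y (K x)),
      (forall u : Rn -> R, measurable_fun setT u -> (forall y, 0 <= u y) ->
        (\int[leb]_(y in Y) (u y)%:E < +oo)%E ->
        exists v : Rn -> \bar R, [/\ measurable_fun X v,
          forall x, X x ->
            (\int[leb]_(y in Y) (u y * normc (K x y - K0))%:E <= v x)%E &
          (\int[leb]_(x in X) v x <=
            (eps * normc K0)%:E * leb X * \int[leb]_(y in Y) (u y)%:E)%E]) &
      (forall x, X x -> (\int[leb]_(y in Y) (normc (K x y - K0))%:E <=
        (eps * normc K0)%:E * leb Y)%E)].

End lower_bounds.

(** * Mean oscillation from test functions *)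

Section oscillation.
Context {R : realType}.
Variable n : nat.
Local Notation Rn := 'rV[R]_n.
Local Notation C := R[i].
Local Notation leb := (@lebesgue_rV R n).
Local Notation normc := (@Normc.normc R).
Variables (k : nat) (b : Rn -> C) (K : Rn -> Rn -> C) (K0 : C).
Variables (X Y : set Rn) (V eps B : R) (S : (Rn -> C) -> Rn -> C).
Hypothesis k_gt0 : (0 < k)%N.
Hypothesis mb : cmeasurable setT b.
Hypotheses (mX : measurable X) (mY : measurable Y).
Hypothesis V_gt0 : 0 < V.
Hypotheses (XV : leb X = V%:E) (YV : leb Y = V%:E).
Hypothesis K0_neq0 : K0 != 0.
Hypothesis KK0 : nearly_constant K K0 eps X Y.
Hypothesis bX : (\int[leb]_(x in X) (normc (b x))%:E < +oo)%E.
Hypothesis bY : (\int[leb]_(y in Y) (normc (b y))%:E < +oo)%E.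
Hypothesis S_test : forall f, cmeasurable setT f -> (forall y, normc (f y) <= 1) ->
  (forall y, ~ Y y -> f y = 0) ->
  [/\ cmeasurable setT (S f),
    {ae leb, forall x, X x -> S f x =
      cintegral Y (fun y => (b x - b y) ^+ k * (K x y * f y))} &
    (\int[leb]_(x in X) (normc (S f x))%:E <= B%:E)%E].

Implicit Types (m : C) (r s delta : R) (F : set Rn).

Definition osc m (x : Rn) : R := normc (b x - m).

Definition far D m s : set Rn := D `&` [set x | s <= osc m x].

Let mosc m : measurable_fun setT (osc m).
Proof. by apply: measurable_normc; apply: cmeasurableB => //; exact: cmeasurable_cst. Qed.

Let osc_fin Z m : measurable Z -> leb Z = V%:E ->
  (\int[leb]_(y in Z) (normc (b y))%:E < +oo)%E ->
  (\int[leb]_(y in Z) (osc m y)%:E < +oo)%E.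
Proof.
move=> mZ ZV bZ.
apply: (@le_lt_trans _ _ (\int[leb]_(y in Z) ((normc (b y))%:E + (normc m)%:E))%E).
  apply: ge0_le_integral => //.
  - by move=> y _; rewrite lee_fin normc_ge0.
  - by apply/measurable_EFinP; exact: measurable_funTS.
  - apply: emeasurable_funD => //; apply/measurable_EFinP.
    by apply: measurable_funTS; exact: measurable_normc.
  - by move=> y _; rewrite -EFinD lee_fin /osc normcB.
rewrite ge0_integralD//; last 3 first.
- by move=> y _; rewrite lee_fin normc_ge0.
- by apply/measurable_EFinP; apply: measurable_funTS; exact: measurable_normc.
- by move=> y _; rewrite lee_fin normc_ge0.
by rewrite lte_add_pinfty// integral_cst// [X in (_ * X)%E]ZV -EFinM ltry.
Qed.

Let mKK0 x : X x -> measurable_fun Y (fun y => normc (K x y - K0)).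
Proof.
have [mK _ _] := KK0 => Xx; apply: measurable_normc; apply: cmeasurableB.
  exact: mK.
exact: cmeasurable_cst.
Qed.

(** Where [b y] is far from [m], the factor [(b x - b y)^k] is nearly [(m - b y)^k]
    for every [x] in [F], and the phase of the latter depends on [y] alone: the
    test function cancels it.  Its modulus [(s / |b y - m|)^(k-1)] is at most 1 and
    brings the [k]-th power of the oscillation down to the first. *)
Lemma far_in_Y F m r s delta : measurable F -> F `<=` X ->
  0 < delta -> 5 * eps <= delta -> ((delta * V)%:E <= leb F)%E ->
  (forall x, F x -> osc m x <= r) -> 0 < s -> spread k * r <= s ->
  exists2 I : R, (\int[leb]_(y in far Y m s) (osc m y)%:E = I%:E)%E &
    0 <= I /\ delta / 2 * normc K0 * V * s ^+ k.-1 * I <= B.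
Proof.
move=> mF FX d0 epsd dF hr s0 rs.
set E := far Y m s.
have mE : measurable E by apply: measurable_superlevel => //; exact: mosc.
have osc0 y : 0 <= osc m y by exact: normc_ge0.
pose q y := osc m y * \1_E y.
have mq : measurable_fun setT q by apply: measurable_funM => //; exact: mosc.
have q0 y : 0 <= q y by rewrite mulr_ge0.
have qE : (\int[leb]_(y in Y) (q y)%:E = \int[leb]_(y in E) (osc m y)%:E)%E.
  rewrite [RHS]integral_mkcond [LHS]integral_mkcond; apply: eq_integral => y _.
  rewrite !patchE /q indicE; case: ifPn => [_|].
    by case: ifPn; rewrite ?mulr1 ?mulr0.
  by rewrite notin_setE => nY; rewrite memNset// => -[].
have : (\int[leb]_(y in Y) (q y)%:E < +oo)%E.
  apply: le_lt_trans (osc_fin m mY YV bY); apply: ge0_le_integral => //.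
  - by move=> y _; rewrite lee_fin.
  - by apply/measurable_EFinP; exact: measurable_funTS.
  - by apply/measurable_EFinP; exact: measurable_funTS.
  by move=> y _; rewrite lee_fin /q indicE; case: (y \in E); rewrite ?mulr1 ?mulr0.
have : (0 <= \int[leb]_(y in Y) (q y)%:E)%E by apply: integral_ge0 => y _; rewrite lee_fin.
case hI : (\int[leb]_(y in Y) (q y)%:E)%E => [I| |]//; rewrite lee_fin => I0 _.
exists I; first by rewrite -qE.
split => //.
have q_fin : (\int[leb]_(y in Y) (q y)%:E < +oo)%E by rewrite hI ltry.
have [mK /(_ q mq q0 q_fin) [v [mv vx vI]] _] := KK0.
pose t y := s ^+ k.-1 * osc m y / osc m y ^+ k * \1_E y.
pose f y := phase K0 * phase (- (b y - m)) ^+ k * (t y)%:C%C.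
have mt : measurable_fun setT t.
  apply: measurable_funM => //; apply: measurable_funM.
    by apply: measurable_funM => //; exact: mosc.
  apply: measurable_inv_ge0 => [y|]; first by rewrite exprn_ge0.
  by apply: measurable_funX; exact: mosc.
have mf : cmeasurable setT f.
  apply: cmeasurableM; last exact: cmeasurableR.
  apply: cmeasurableM; first exact: cmeasurable_cst.
  apply: cmeasurableX; apply: cmeasurable_phase; apply: cmeasurableN.
  by apply: cmeasurableB => //; exact: cmeasurable_cst.
have s0k : 0 < s ^+ k.-1 by rewrite exprn_gt0.
have t0 y : 0 <= t y.
  by rewrite /t mulr_ge0// divr_ge0 ?exprn_ge0// mulr_ge0// ltW.
have tE y : E y -> t y * osc m y ^+ k = s ^+ k.-1 * osc m y.
  move=> Ey; have u0 : 0 < osc m y by apply: lt_le_trans s0 _; case: Ey.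
  by rewrite /t indicE mem_set// mulr1 divfK// gt_eqF// exprn_gt0.
have tNE y : ~ E y -> t y = 0 by move=> nE; rewrite /t indicE memNset// mulr0.
have t1 y : t y <= 1.
  have [Ey|nE] := pselect (E y); last by rewrite tNE.
  have u0 : 0 < osc m y by apply: lt_le_trans s0 _; case: Ey.
  rewrite -(ler_pM2r (exprn_gt0 k u0)) mul1r tE//.
  rewrite -[X in _ <= _ ^+ X](prednK k_gt0) exprSr ler_pM2r//.
  by apply: lerXn2r; rewrite ?nnegrE ?(ltW s0) ?osc0//; case: Ey.
have f1 y : normc (f y) <= 1.
  rewrite /f 2!Normc.normcM normcR normcX (ger0_norm (t0 y)).
  have pk : normc (phase (- (b y - m))) ^+ k <= 1.
    by rewrite exprn_ile1 ?normc_ge0 ?normc_phase.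
  have e0 : 0 <= normc (phase (- (b y - m))) ^+ k by rewrite exprn_ge0// normc_ge0.
  apply: mulr_ile1 => //; first by rewrite mulr_ge0// normc_ge0.
  by apply: mulr_ile1 => //; [exact: normc_ge0|exact: normc_phase].
have f0 y : ~ Y y -> f y = 0.
  by move=> nY; rewrite /f tNE ?mulr0// => -[].
have [mS Sf SB] := S_test mf f1 f0.
pose c := 3 / 4 * normc K0 * s ^+ k.-1.
pose c' := 5 / 4 * s ^+ k.-1.
have nK0 : 0 < normc K0 by rewrite normc_gt0.
have c0 : 0 <= c by rewrite /c !mulr_ge0// ltW.
have c'0 : 0 < c' by rewrite /c' mulr_gt0.
have key x : F x -> S f x = cintegral Y (fun y => (b x - b y) ^+ k * (K x y * f y)) ->
    ((c * I)%:E <= (normc (S f x))%:E + c'%:E * v x)%E.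
  move=> Fx ->; have Xx := FX _ Fx.
  apply: (@le_trans _ _ ((normc (cintegral Y (fun y =>
      (b x - b y) ^+ k * (K x y * f y))))%:E +
      c'%:E * \int[leb]_(y in Y) (q y * normc (K x y - K0))%:E)%E); last first.
    by rewrite leeD2l// lee_pmul2l//; exact: vx.
  have HE y : E y -> (b x - b y) ^+ k * (K x y * f y) = phase K0 *
      ((s ^+ k.-1 * osc m y)%:C%C * (1 - (b x - m) / (b y - m)) ^+ k * K x y).
    move=> Ey; have u0 : 0 < osc m y by apply: lt_le_trans s0 _; case: Ey.
    have w0 : b y - m != 0 by rewrite -normc_gt0.
    have e1 := phase_powM (b x - m) k w0.
    rewrite (_ : b x - m - (b y - m) = b x - b y) in e1; last by ring.
    transitivity (phase K0 * ((t y)%:C%C *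
      (phase (- (b y - m)) ^+ k * (b x - b y) ^+ k) * K x y)).
      by rewrite /f; ring.
    by rewrite e1 -tE// [(t y * _)%:C%C]rmorphM/=; ring.
  have HNE y : ~ E y -> (b x - b y) ^+ k * (K x y * f y) = 0.
    by move=> nE; rewrite /f tNE// !mulr0.
  have side y : E y -> b y - m != 0 /\ spread k * normc (b x - m) <= normc (b y - m).
    move=> Ey; have u0 : 0 < osc m y by apply: lt_le_trans s0 _; case: Ey.
    rewrite -normc_gt0; split => //; case: Ey => _ /= sy.
    apply: le_trans sy; apply: le_trans rs.
    by rewrite ler_pM2l ?spread_gt0//; exact: hr.
  apply: (@cintegral_lower _ _ _ _ 1 q _ c c' (5 / 4 * normc K0 * s ^+ k.-1) I) => //.
  - apply: cmeasurableM; last by apply: cmeasurableM; [exact: mK|exact: cmeasurableTS].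
    apply: cmeasurableX; apply: cmeasurableB; first exact: cmeasurable_cst.
    exact: cmeasurableTS.
  - exact: measurable_funTS.
  - exact: mKK0.
  - by move=> y _; exact: normc_ge0.
  - by rewrite Normc.normc1.
  - by rewrite !mulr_ge0// ltW.
  - move=> y Yy; have [Ey|nE] := pselect (E y); last first.
      rewrite HNE// Normc.normc0 /q addr_ge0// mulr_ge0 ?mulr_ge0 ?normc_ge0//.
        exact: ltW.
      exact: ltW.
    have [w0 zw] := side y Ey; rewrite HE// Normc.normcM.
    apply: (@le_trans _ _ (normc ((s ^+ k.-1 * osc m y)%:C%C *
        (1 - (b x - m) / (b y - m)) ^+ k * K x y))).
      by rewrite ler_piMl ?normc_ge0// normc_phase.
    have tt0 : 0 <= s ^+ k.-1 * osc m y by rewrite mulr_ge0// ltW.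
    apply: le_trans (test_normc (K x y) K0 w0 zw tt0) _.
    by rewrite /q indicE mem_set// mulr1 /c'; lra.
  - move=> y Yy; rewrite mul1r; have [Ey|nE] := pselect (E y); last first.
      by rewrite HNE// /q indicE memNset// mulr0 mul0r !mulr0 subrr.
    have [w0 zw] := side y Ey; rewrite HE//.
    have tt0 : 0 <= s ^+ k.-1 * osc m y by rewrite mulr_ge0// ltW.
    apply: le_trans (test_Re (K x y) K0 w0 zw tt0).
    by rewrite /q indicE mem_set// mulr1 /c' /c; lra.
have mSf : measurable_fun setT (fun x => normc (S f x)) by exact: measurable_normc.
have v0 x : X x -> (0 <= v x)%E.
  move=> Xx; apply: le_trans (vx x Xx); apply: integral_ge0 => y _.
  by rewrite lee_fin mulr_ge0// normc_ge0.
have [phi [phi0 phiV lF]] := sub_measure_real mX mF FX XV.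
have mvF : measurable_fun F v by exact: measurable_funS mv.
have : ((c * I)%:E * phi%:E <= B%:E + c'%:E * ((eps * normc K0)%:E * V%:E * I%:E))%E.
  rewrite -lF -integral_cst//.
  apply: (@le_trans _ _ (\int[leb]_(x in F) ((normc (S f x))%:E + c'%:E * v x))%E).
    apply: ae_ge0_le_integral => //.
    - by move=> x Fx; rewrite lee_fin mulr_ge0.
    - move=> x Fx; rewrite adde_ge0 ?lee_fin ?normc_ge0// mule_ge0//.
        by rewrite lee_fin ltW.
      by apply: v0; exact: FX.
    - apply: emeasurable_funD; last exact: measurable_funeM.
      by apply/measurable_EFinP; exact: measurable_funTS.
    by apply: filterS Sf => x Sfx Fx; apply: key => //; apply: Sfx; exact: FX.
  rewrite ge0_integralD//; last 4 first.
  - by move=> x _; rewrite lee_fin normc_ge0.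
  - by apply/measurable_EFinP; exact: measurable_funTS.
  - by move=> x Fx; apply: mule_ge0; [rewrite lee_fin ltW|apply: v0; exact: FX].
  - exact: measurable_funeM.
  apply: leeD.
    apply: le_trans SB; apply: ge0_subset_integral => //.
      by apply/measurable_EFinP; exact: measurable_funTS.
    by move=> x _; rewrite lee_fin normc_ge0.
  rewrite ge0_integralZl_EFin//; last 2 first.
  - by move=> x Fx; apply: v0; exact: FX.
  - exact: ltW.
  rewrite lee_pmul2l// -XV -hI; apply: le_trans vI.
  by apply: ge0_subset_integral.
rewrite -!EFinM -EFinD lee_fin /c /c' => main.
have dphi : delta * V <= phi by rewrite -lee_fin -lF.
set T := normc K0 * s ^+ k.-1 * I.
have T0 : 0 <= T by rewrite !mulr_ge0// ltW.
have h1 : T * (delta * V) <= T * phi by rewrite ler_wpM2l.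
have h2 : T * V * (5 * eps) <= T * V * delta by rewrite ler_wpM2l// mulr_ge0// ltW.
rewrite (_ : delta / 2 * _ * _ * _ * _ = 3 / 4 * (T * (delta * V)) - T * V * delta / 4);
  last by rewrite /T; field.
have : 3 / 4 * (T * phi) <= B + T * V * (5 * eps) / 4 by rewrite /T; lra.
lra.
Qed.

(** The companion of [far_in_Y] with the two cubes exchanged.  The test function is
    the indicator of [F], since the phase now depends on the point [x] at which
    the commutator is evaluated. *)
Lemma far_in_X F m r s : measurable F -> F `<=` Y ->
  10 * eps <= 1 -> ((V / 2)%:E <= leb F)%E ->
  (forall y, F y -> osc m y <= r) -> 0 < s -> spread k * r <= s ->
  exists2 e : R, leb (far X m s) = e%:E &
    normc K0 * V / 4 * s ^+ k * e <= B.
Proof.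
move=> mF FY epsd dF hr s0 rs.
set E := far X m s.
have mE : measurable E by apply: measurable_superlevel => //; exact: mosc.
have EX : E `<=` X by move=> x [].
have [e [e0 _ lE]] := sub_measure_real mX mE EX XV.
exists e => //.
have [phi [phi0 phiV lF]] := sub_measure_real mY mF FY YV.
pose q : Rn -> R := \1_F.
have q0 y : 0 <= q y by rewrite /q indicE.
have mq : measurable_fun setT q by exact: measurable_indic.
have qI : (\int[leb]_(y in Y) (q y)%:E = phi%:E)%E.
  by rewrite integral_indic// setIidl.
have [mK _ Kx] := KK0.
pose f : Rn -> C := fun y => (q y)%:C%C.
have mf : cmeasurable setT f by exact: cmeasurableR.
have f1 y : normc (f y) <= 1.
  by rewrite normcR ger0_norm// /q indicE; case: (_ \in _).
have f0 y : ~ Y y -> f y = 0.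
  by move=> nY; rewrite /f /q indicE memNset// => /FY.
have [mS Sf SB] := S_test mf f1 f0.
have nK0 : 0 < normc K0 by rewrite normc_gt0.
have dphi : V / 2 <= phi by rewrite -lee_fin -lF.
pose c := normc K0 * V / 4 * s ^+ k.
have c0 : 0 <= c by rewrite /c !mulr_ge0// ?exprn_ge0// ltW.
have key x : E x -> S f x = cintegral Y (fun y => (b x - b y) ^+ k * (K x y * f y)) ->
    (c%:E <= (normc (S f x))%:E)%E.
  move=> Ex ->; have Xx := EX _ Ex; have sx : s <= osc m x by case: Ex.
  have u0 : 0 < osc m x by apply: lt_le_trans sx.
  have w0 : b x - m != 0 by rewrite -normc_gt0.
  pose t := osc m x ^+ k; have t0 : 0 < t by rewrite exprn_gt0.
  pose th := phase K0 * phase (b x - m) ^+ k.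
  have HF y : F y -> (b x - b y) ^+ k * (K x y * f y) =
      (b x - b y) ^+ k * K x y.
    by move=> Fy; rewrite /f /q indicE mem_set// mulr1.
  have HNF y : ~ F y -> (b x - b y) ^+ k * (K x y * f y) = 0.
    by move=> nF; rewrite /f /q indicE memNset// !mulr0.
  have ReF y : F y -> th * ((b x - b y) ^+ k * (K x y * f y)) =
      phase K0 * (t%:C%C * (1 - (b y - m) / (b x - m)) ^+ k * K x y).
    move=> Fy; rewrite HF// /t -(phase_powB (b y - m) k w0) /th.
    by rewrite (_ : b x - m - (b y - m) = b x - b y); ring.
  have side y : F y -> spread k * normc (b y - m) <= normc (b x - m).
    move=> Fy; apply: le_trans sx; apply: le_trans rs.
    by rewrite ler_pM2l ?spread_gt0//; exact: hr.
  have nth : normc th <= 1.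
    rewrite Normc.normcM normcX mulr_ile1 ?exprn_ge0 ?normc_ge0 ?normc_phase//.
    by rewrite exprn_ile1 ?normc_ge0 ?normc_phase.
  have low : ((3 / 4 * normc K0 * t * phi)%:E <= (normc (cintegral Y
      (fun y => (b x - b y) ^+ k * (K x y * f y))))%:E + (5 / 4 * t)%:E *
      \int[leb]_(y in Y) (q y * normc (K x y - K0))%:E)%E.
    apply: (@cintegral_lower _ _ _ _ th q (fun y => normc (K x y - K0))
      (3 / 4 * normc K0 * t) (5 / 4 * t) (5 / 4 * normc K0 * t)) => //.
    - apply: cmeasurableM; last by apply: cmeasurableM; [exact: mK|exact: cmeasurableTS].
      apply: cmeasurableX; apply: cmeasurableB; first exact: cmeasurable_cst.
      exact: cmeasurableTS.
    - exact: measurable_funTS.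
    - exact: mKK0.
    - by move=> y _; exact: normc_ge0.
    - by rewrite !mulr_ge0// ltW.
    - by rewrite mulr_gt0.
    - by rewrite !mulr_ge0// ltW.
    - move=> y Yy; have [Fy|nF] := pselect (F y); last first.
        by rewrite HNF// Normc.normc0 /q indicE memNset// mulr0 mul0r mulr0 addr0.
      have tb : normc ((b x - b y) ^+ k * (K x y * f y)) =
          normc (t%:C%C * (1 - (b y - m) / (b x - m)) ^+ k * K x y).
        rewrite HF// /t -(phase_powB (b y - m) k w0).
        rewrite (_ : b x - m - (b y - m) = b x - b y); last by ring.
        by rewrite -mulrA [RHS]Normc.normcM normcX normc_phase1// expr1n mul1r.
      rewrite tb; apply: le_trans (test_normc (K x y) K0 w0 (side y Fy) (ltW t0)) _.
      by rewrite /q indicE mem_set// mulr1 mul1r; lra.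
    - move=> y Yy; have [Fy|nF] := pselect (F y); last first.
        by rewrite HNF// /q indicE memNset// mulr0 mul0r !mulr0 subrr.
      rewrite ReF//; apply: le_trans (test_Re (K x y) K0 w0 (side y Fy) (ltW t0)).
      by rewrite /q indicE mem_set// mulr1 mul1r; lra.
  have err : (\int[leb]_(y in Y) (q y * normc (K x y - K0))%:E <=
      (eps * normc K0 * V)%:E)%E.
    rewrite EFinM -YV; apply: le_trans (Kx x Xx); apply: ge0_le_integral => //.
    - by move=> y _; rewrite lee_fin mulr_ge0// normc_ge0.
    - by apply/measurable_EFinP; apply: measurable_funM; [exact: measurable_funTS|exact: mKK0].
    - by apply/measurable_EFinP; exact: mKK0.
    move=> y _; rewrite lee_fin ler_piMl ?normc_ge0// /q indicE.
    by case: (_ \in _).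
  have : ((3 / 4 * normc K0 * t * phi)%:E <= (normc (cintegral Y
      (fun y => (b x - b y) ^+ k * (K x y * f y))))%:E +
      (5 / 4 * t)%:E * (eps * normc K0 * V)%:E)%E.
    by apply: le_trans low _; rewrite leeD2l// lee_pmul2l// lte_fin mulr_gt0.
  rewrite -EFinM -EFinD !lee_fin => low'.
  have st : s ^+ k <= t by apply: lerXn2r; rewrite ?nnegrE ?(ltW s0) ?(ltW u0).
  pose T := normc K0 * t; have T0 : 0 <= T by rewrite mulr_ge0 ?normc_ge0// ltW.
  have h1 : T * (V / 2) <= T * phi by rewrite ler_wpM2l.
  have h2 : T * V * (10 * eps) <= T * V * 1.
    by rewrite ler_wpM2l// mulr_ge0// ltW.
  have h3 : normc K0 * V * s ^+ k <= T * V.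
    by rewrite /T mulrAC ler_wpM2r ?(ltW V_gt0)// ler_wpM2l ?normc_ge0.
  have h4 : 3 / 4 * (T * phi) - T * V * (10 * eps) / 8 <=
      normc (cintegral Y (fun y => (b x - b y) ^+ k * (K x y * f y))).
    by rewrite /T; lra.
  by rewrite /c; lra.
have mSf : measurable_fun setT (fun x => normc (S f x)) by exact: measurable_normc.
rewrite -lee_fin -/c EFinM -lE -integral_cst//; apply: le_trans SB.
apply: (@le_trans _ _ (\int[leb]_(x in E) (normc (S f x))%:E)%E).
  apply: ae_ge0_le_integral => //.
  - by move=> x _; rewrite lee_fin normc_ge0.
  - by apply/measurable_EFinP; exact: measurable_funTS.
  by apply: filterS Sf => x Sfx Ex; apply: key => //; apply: Sfx; exact: EX.
apply: ge0_subset_integral => //.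
  by apply/measurable_EFinP; exact: measurable_funTS.
by move=> x _; rewrite lee_fin normc_ge0.
Qed.

Definition square D m r : set Rn :=
  D `&` [set x | `|complex.Re (b x - m)| <= r /\ `|complex.Im (b x - m)| <= r].

Definition concentrated delta r := exists m, ((delta * V)%:E <= leb (square X m r))%E.

Lemma measurable_square D m r : measurable D -> measurable (square D m r).
Proof.
move=> mD; have [m1 m2] := cmeasurableB mb (@cmeasurable_cst R n setT m).
rewrite (_ : square D m r = D `&`
  (((fun x => complex.Re (b x - m)) @^-1` `[- r, r]) `&`
   ((fun x => complex.Im (b x - m)) @^-1` `[- r, r]))).
  apply: measurableI => //; apply: measurableI; rewrite -[X in measurable X]setTI.
    exact: m1.
  exact: m2.
by apply/seteqP; split => x /=; rewrite !in_itv/= -!ler_norml => -[Dx];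
  [move=> [h1 h2]|move=> [h1 h2]].
Qed.

Lemma square_osc D m r x : square D m r x -> osc m x <= 2 * r.
Proof. by move=> [_ /= [h1 h2]]; apply: (le_trans (normc_le_ReIm _)); lra. Qed.

Lemma concentrated_mono delta r r' : r <= r' ->
  concentrated delta r -> concentrated delta r'.
Proof.
move=> rr [m h]; exists m; apply: (le_trans h); apply: le_measure;
  rewrite ?inE; try exact: measurable_square.
by move=> x [Xx [h1 h2]]; split => //; split; exact: le_trans rr.
Qed.

(** A square is covered by its four quarters. *)
Lemma concentrated_half delta r : concentrated delta r ->
  concentrated (delta / 4) (r / 2).
Proof.
move=> [m h]; apply: contrapT => /forallNP no.
pose q (s t : R) : C := m + Complex s t.
have sub : square X m r `<=` square X (q (r / 2) (r / 2)) (r / 2) `|`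
    square X (q (r / 2) (- (r / 2))) (r / 2) `|`
    (square X (q (- (r / 2)) (r / 2)) (r / 2) `|`
     square X (q (- (r / 2)) (- (r / 2))) (r / 2)).
  move=> x [Xx /=]; rewrite /square /= !ReD !ImD !ReN !ImN !ReD !ImD/= !ler_norml.
  set s := complex.Re (b x) - _; set t := complex.Im (b x) - _ => -[/andP[s1 s2] /andP[t1 t2]].
  rewrite !opprD !addrA -/s -/t.
  case: (leP 0 s) => s0; case: (leP 0 t) => t0; [left; left|left; right|right; left|right; right];
    by split => //; split; apply/andP; split; lra.
have ms m' := measurable_square m' (r / 2) mX.
have mU s t s' t' : measurable (square X (q s t) (r / 2) `|` square X (q s' t') (r / 2)).
  exact: measurableU.
have lt4 m' : (leb (square X m' (r / 2)) < (delta / 4 * V)%:E)%E.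
  by rewrite ltNge; apply/negP/no.
have sum2 A A' (a a' : R) : measurable A -> measurable A' -> (leb A < a%:E)%E ->
    (leb A' < a'%:E)%E -> (leb (A `|` A') < (a + a')%:E)%E.
  move=> mA mA' hA hA'; apply: le_lt_trans (measureU2 _ mA mA') _.
  by rewrite EFinD lteD.
have := sum2 _ _ _ _ (mU _ _ _ _) (mU _ _ _ _)
  (sum2 _ _ _ _ (ms _) (ms _) (lt4 (q (r / 2) (r / 2))) (lt4 (q (r / 2) (- (r / 2)))))
  (sum2 _ _ _ _ (ms _) (ms _) (lt4 (q (- (r / 2)) (r / 2))) (lt4 (q (- (r / 2)) (- (r / 2))))).
rewrite (_ : _ + _ = delta * V); last by field.
move=> lt; move: h; rewrite leNgt => /negP; apply; apply: le_lt_trans lt.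
by apply: le_measure => //; rewrite inE; [exact: measurable_square|exact: measurableU].
Qed.

Lemma concentrated_iter delta r j : concentrated delta r ->
  concentrated (delta / 4 ^+ j) (r / 2 ^+ j).
Proof.
move=> h; elim: j => [|j IH]; first by rewrite !expr0 !divr1.
by rewrite !exprSr !invfM !mulrA; exact: concentrated_half.
Qed.

Lemma concentrated_ex : exists2 r, 0 < r & concentrated (1 / 2) r.
Proof.
have : (0 <= \int[leb]_(x in X) (normc (b x))%:E)%E.
  by apply: integral_ge0 => x _; rewrite lee_fin normc_ge0.
case hI : (\int[leb]_(x in X) (normc (b x))%:E)%E bX => [I| |]// _.
rewrite lee_fin => I0; pose r := 2 * I / V + 1.
have r0 : 0 < r by rewrite /r ltr_wpDl// divr_ge0 ?mulr_ge0// ltW.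
exists r => //; exists 0.
have mnb : measurable_fun setT (fun x => normc (b x)) by exact: measurable_normc.
have mS := measurable_square 0 r mX.
have mD : measurable (X `\` square X 0 r) by exact: measurableD.
have [e [e0 eV le]] := sub_measure_real mX mS (@subIsetl _ _ _) XV.
have [d [d0 dV ld]] := sub_measure_real mX mD (@subDsetl _ _ _) XV.
have rd : r * d <= I.
  rewrite -lee_fin EFinM -ld -hI -integral_cst//.
  apply: (@le_trans _ _ (\int[leb]_(x in X `\` square X 0%R r) (normc (b x))%:E)%E).
    apply: ge0_le_integral => //.
    - by move=> x _; rewrite lee_fin ltW.
    - by apply/measurable_EFinP; exact: measurable_funTS.
    move=> x [Xx nS]; rewrite lee_fin leNgt; apply/negP => br; apply: nS.
    split => //=; rewrite subr0; split; apply: le_trans (ltW br).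
      exact: Re_le_normc.
    exact: Im_le_normc.
  apply: ge0_subset_integral => //.
    by apply/measurable_EFinP; exact: measurable_funTS.
  by move=> x _; rewrite lee_fin normc_ge0.
have ed : V <= e + d.
  rewrite -lee_fin EFinD -le -ld -XV; apply: le_trans (measureU2 _ mS mD).
  apply: le_measure; rewrite ?inE//; first exact: measurableU.
  by move=> x Xx; have [|] := pselect (square X 0 r x); [left|right].
rewrite le lee_fin; suff : d <= V / 2 by lra.
rewrite leNgt; apply/negP => dV2.
have : r * (V / 2) <= I by apply: le_trans rd; rewrite ler_pM2l// ltW.
rewrite /r mulrDl (_ : 2 * I / V * (V / 2) = I); last by field; rewrite gt_eqF.
by lra.
Qed.

(* [J] halvings reduce the scale by the factor [4 * spread k ^ 2]: two successive
   spreads then amount to one halving *)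
Let J := (2 * k + 6)%N.
(* what [J] quarterings of a square holding one half of [X] leave *)
Let share : R := 1 / 2 / 4 ^+ J.
Definition tolerance : R := share / 5.
Definition threshold : R := 2 ^+ J * (4 / share).

Let share_gt0 : 0 < share.
Proof. by rewrite /share divr_gt0// exprn_gt0. Qed.

Let share_le : share <= 1 / 2.
Proof. by rewrite /share ler_pdivrMr ?exprn_gt0// ler_peMr// exprn_ege1// ler1n. Qed.

Let pow2J : 2 ^+ J = 4 * spread k ^+ 2 :> R.
Proof. by rewrite /J exprD mulnC exprM /spread; ring. Qed.

Lemma tolerance_gt0 : 0 < tolerance. Proof. by rewrite divr_gt0. Qed.

Lemma threshold_ge1 : 1 <= threshold.
Proof.
rewrite /threshold mulr_ege1// ?exprn_ege1 ?ler1n//.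
by rewrite ler_pdivlMr// mul1r; have := share_le; lra.
Qed.

Hypothesis eps_le : eps <= tolerance.
Variable tau : R.
Hypothesis tau_gt0 : 0 < tau.
Hypothesis B_le : B <= normc K0 * V * V * tau ^+ k.

Let nK0 : 0 < normc K0. Proof. by rewrite normc_gt0. Qed.

Let root_le (A x : R) : 1 <= A -> 0 <= x -> x ^+ k <= A * tau ^+ k -> x <= A * tau.
Proof.
move=> A1 x0 h; have A0 : 0 <= A by lra.
have t0 := ltW tau_gt0.
rewrite -(ler_pXn2r k_gt0) ?nnegrE ?mulr_ge0//.
apply: (le_trans h); rewrite exprMn ler_wpM2r ?exprn_ge0//.
by rewrite -[leLHS]expr1 ler_weXn2l.
Qed.

Let near_half D m s : measurable D -> leb D = V%:E ->
  (forall a : R, leb (far D m s) = a%:E -> a < V / 2) ->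
  ((V / 2)%:E <= leb (D `\` far D m s))%E.
Proof.
move=> mD DV small.
have mF : measurable (far D m s) by exact: measurable_superlevel.
have mN : measurable (D `\` far D m s) by exact: measurableD.
have [a [a0 aV la]] := sub_measure_real mD mF (@subIsetl _ _ _) DV.
have [d [d0 dV ld]] := sub_measure_real mD mN (@subDsetl _ _ _) DV.
have : V <= a + d.
  rewrite -lee_fin EFinD -la -ld -DV; apply: le_trans (measureU2 _ mF mN).
  apply: le_measure; rewrite ?inE//; first exact: measurableU.
  by move=> x Xx; have [|] := pselect (far D m s x); [left|right].
have := small _ la; rewrite ld lee_fin; lra.
Qed.

(** Suppose [b] is concentrated on [X] at scale [r].  By pigeonhole a fixed
    share of [X] is concentrated at a much smaller scale about some [m].  That
    share sees half of [Y] in a narrow cone unless half of [Y] is close to [m];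
    in the latter case half of [Y] sees half of [X] in a narrow cone, unless [b]
    is concentrated on [X] at scale [r / 2]. *)
Lemma concentrated_descent r : 0 < r -> concentrated (1 / 2) r ->
  r <= threshold * tau \/ concentrated (1 / 2) (r / 2).
Proof.
move=> r0 /(concentrated_iter J); rewrite -/share => -[m hm].
set r' := r / 2 ^+ J in hm.
have J0 : 0 < 2 ^+ J :> R by rewrite exprn_gt0.
have r'0 : 0 < r' by rewrite divr_gt0.
have S0 := @spread_gt0 R k; have S4 := @spread_ge4 R k.
pose s := spread k * (2 * r').
have s0 : 0 < s by rewrite !mulr_gt0.
have e5 : 5 * eps <= share by have := eps_le; rewrite /tolerance; lra.
have rE : r = 2 ^+ J * r' by rewrite /r' mulrC divfK// gt_eqF.
have r's : r' <= s by rewrite /s; nra.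
have [I hI [I0 main]] := @far_in_Y (square X m r') m (2 * r') s share
  (measurable_square _ _ mX) (@subIsetl _ _ _) share_gt0 e5 hm
  (@square_osc _ _ _) s0 (lexx _).
have mF : measurable (far Y m s) by exact: measurable_superlevel.
have [a [a0 aV la]] := sub_measure_real mY mF (@subIsetl _ _ _) YV.
have [aV2|aV2] := leP (V / 2) a.
  left.
  have sI : s * a <= I.
    rewrite -lee_fin EFinM -la -hI -integral_cst//.
    apply: ge0_le_integral => //.
    - by move=> y _; rewrite lee_fin ltW.
    - by apply/measurable_EFinP; exact: measurable_funTS.
    by move=> y [_ sy]; rewrite lee_fin.
  have st : s <= 4 / share * tau.
    apply: root_le; [|exact: ltW|].
      by rewrite ler_pdivlMr// mul1r; have := share_le; lra.
    rewrite -mulrA mulrC -mulrA -ler_pdivrMl; last by rewrite invr_gt0.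
    rewrite invrK mulrC.
    rewrite -(ler_pM2l (_ : 0 < normc K0 * V * V)) ?mulr_gt0//.
    have h : share / 2 * normc K0 * V * s ^+ k.-1 * (s * (V / 2)) <= B.
      apply: le_trans main; rewrite ler_wpM2l//.
        by rewrite !mulr_ge0 ?exprn_ge0// ltW.
      by apply: le_trans sI; rewrite ler_pM2l.
    have sk : s ^+ k = s ^+ k.-1 * s by rewrite -exprSr prednK.
    have := le_trans h B_le; rewrite sk.
    by move: (s ^+ k.-1) (tau ^+ k) => u v; lra.
  rewrite rE /threshold -mulrA ler_pM2l//; exact: le_trans st.
set s2 := spread k * s.
have s20 : 0 < s2 by rewrite mulr_gt0.
have e10 : 10 * eps <= 1 by have := share_le; lra.
have hF : ((V / 2)%:E <= leb (Y `\` far Y m s))%E.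
  by apply: near_half => // a'; rewrite la => -[<-].
have F_osc y : (Y `\` far Y m s) y -> osc m y <= s.
  by move=> [Yy nf]; rewrite leNgt; apply/negP => sy; apply: nf; split => //; exact: ltW.
have [e le main2] := @far_in_X (Y `\` far Y m s) m s s2
  (measurableD mY mF) (@subDsetl _ _ _) e10 hF F_osc s20 (lexx _).
have [eV2|eV2] := leP (V / 2) e.
  left.
  have st : s2 <= 8 * tau.
    apply: root_le; [by lra|exact: ltW|].
    have h : normc K0 * V / 4 * s2 ^+ k * (V / 2) <= B.
      apply: le_trans main2; rewrite ler_wpM2l//.
      by rewrite !mulr_ge0 ?exprn_ge0// ltW.
    rewrite -(ler_pM2l (_ : 0 < normc K0 * V * V)) ?mulr_gt0//.
    have := le_trans h B_le.
    by move: (s2 ^+ k) (tau ^+ k) => u v; lra.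
  have sh8 : 8 <= 4 / share by rewrite ler_pdivlMr//; have := share_le; lra.
  rewrite rE /threshold -mulrA ler_pM2l//.
  have : r' <= s2 by rewrite /s2; nra.
  have : 8 * tau <= 4 / share * tau by rewrite ler_pM2r.
  lra.
right.
have half : ((V / 2)%:E <= leb (X `\` far X m s2))%E.
  by apply: near_half => // a'; rewrite le => -[<-].
exists m; rewrite mulrC mul1r (_ : V / 2 = V / 2)//; apply: (le_trans half).
have mfX : measurable (far X m s2) by exact: measurable_superlevel.
apply: le_measure; rewrite ?inE//; [exact: measurableD|exact: measurable_square|].
have r2 : r / 2 = s2 by rewrite rE pow2J /s2 /s; field.
move=> x [Xx nf]; split => //=; have : osc m x < s2.
  by rewrite ltNge; apply/negP => sx; apply: nf.
by move=> h; split; rewrite r2; apply: le_trans (ltW h);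
  [exact: Re_le_normc|exact: Im_le_normc].
Qed.

(** At a large scale [b] is concentrated on [X]; the descent halves the scale until
    it reaches the threshold. *)
Lemma concentrated_threshold : concentrated (1 / 2) (threshold * tau).
Proof.
have c0 : 0 < threshold by apply: lt_le_trans threshold_ge1.
have T0 : 0 < threshold * tau by rewrite mulr_gt0.
have [r r0 hr] := concentrated_ex.
suff H j : forall r, 0 < r -> r <= 2 ^+ j * (threshold * tau) ->
    concentrated (1 / 2) r -> concentrated (1 / 2) (threshold * tau).
  apply: (H (Num.truncn (r / (threshold * tau))).+1 r) => //.
  rewrite -ler_pdivrMr//; apply: (le_trans (ltW (truncnS_gt _))).
  by rewrite -natrX ler_nat ltnW// ltn_expl.
elim: j => [|j IH] {}r {}r0 rj {}hr.
  by apply: (concentrated_mono _ hr); move: rj; rewrite expr0 mul1r.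
have [rt|h] := concentrated_descent r0 hr; first exact: (concentrated_mono rt hr).
apply: IH h; first by rewrite divr_gt0.
by rewrite ler_pdivrMr//; move: rj; rewrite exprS; lra.
Qed.

Definition oscillation_constant : R := 2 * spread k * threshold + 4.

(** Around the centre [m] given by [concentrated_threshold], the points of [Y] near
    [m] contribute at most their distance, and the far ones are controlled by
    [far_in_Y]. *)
Lemma mean_oscillation_le : exists m,
  (\int[leb]_(y in Y) (osc m y)%:E <= (oscillation_constant * tau * V)%:E)%E.
Proof.
have c1 := threshold_ge1; have S4 := @spread_ge4 R k.
have [m hm] := concentrated_threshold; exists m.
set r := threshold * tau in hm.
have tr : tau <= r by rewrite /r ler_peMl// ltW.
have r0 : 0 < r by apply: lt_le_trans tr.
pose s := spread k * (2 * r).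
have s0 : 0 < s by rewrite mulr_gt0 ?spread_gt0// mulr_gt0.
have e5 : 5 * eps <= 1 / 2 by have := eps_le; have := share_le; rewrite /tolerance; lra.
have [I hI [I0 main]] := @far_in_Y (square X m r) m (2 * r) s (1 / 2)
  (measurable_square _ _ mX) (@subIsetl _ _ _) ltac:(lra) e5 hm
  (@square_osc _ _ _) s0 (lexx _).
have ts : tau <= s by rewrite /s; nra.
have I_le : I <= 4 * tau * V.
  have tk : tau ^+ k = tau ^+ k.-1 * tau by rewrite -exprSr prednK.
  have ts' : tau ^+ k.-1 <= s ^+ k.-1 by apply: lerXn2r => //; rewrite nnegrE ltW.
  have t0' : 0 < tau ^+ k.-1 by rewrite exprn_gt0.
  rewrite -(ler_pM2l t0'); apply: (@le_trans _ _ (s ^+ k.-1 * I)).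
    by rewrite ler_wpM2r.
  rewrite -(ler_pM2l (_ : 0 < normc K0 * V)) ?mulr_gt0//.
  have := le_trans main B_le; rewrite tk.
  by move: (s ^+ k.-1) (tau ^+ k.-1) => u v; lra.
have mF : measurable (far Y m s) by exact: measurable_superlevel.
have mN : measurable (Y `\` far Y m s) by exact: measurableD.
have YU : Y = (Y `\` far Y m s) `|` far Y m s.
  by rewrite setUC setDUK//; exact: subIsetl.
rewrite [X in (\int[_]_(_ in X) _)%E]YU ge0_integral_setU//; last 3 first.
- by apply/measurable_EFinP; apply: measurable_funTS.
- by move=> y _; rewrite lee_fin normc_ge0.
- by apply/disj_setPS => y [[_ nf] /nf].
rewrite hI (_ : (_ * V)%:E = ((s * V)%:E + (4 * tau * V)%:E)%E); last first.
  by rewrite -EFinD /oscillation_constant /s /r; congr EFin; ring.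
rewrite leeD ?lee_fin//.
have [d [d0 dV ld]] := sub_measure_real mY mN (@subDsetl _ _ _) YV.
apply: (@le_trans _ _ (\int[leb]_(y in Y `\` far Y m s) (cst s%:E y))%E).
  apply: ge0_le_integral => //.
  - by move=> y _; rewrite lee_fin normc_ge0.
  - by apply/measurable_EFinP; exact: measurable_funTS.
  move=> y [Yy nf]; rewrite lee_fin leNgt; apply/negP => sy; apply: nf.
  by split => //; exact: ltW.
by rewrite integral_cst// [X in (_ * X)%E]ld -EFinM lee_fin ler_pM2l.
Qed.

End oscillation.

(** * The Euclidean norm *)

Section euclidean_norm.
Context {R : realType}.
Variable n : nat.
Local Notation Rn := 'rV[R]_n.
Implicit Types (x y z : Rn) (c r : R).

Let sumsq_ge0 x : 0 <= \sum_(i < n) x ord0 i ^+ 2.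
Proof. by apply: sumr_ge0 => i _; exact: sqr_ge0. Qed.

Lemma enorm_ge0 x : 0 <= enorm x.
Proof. exact: sqrtr_ge0. Qed.

Lemma enorm_sqr x : enorm x ^+ 2 = \sum_(i < n) x ord0 i ^+ 2.
Proof. by rewrite sqr_sqrtr. Qed.

Lemma enormZ c x : enorm (c *: x) = `|c| * enorm x.
Proof.
rewrite /enorm -sqrtr_sqr -sqrtrM ?sqr_ge0//; congr Num.sqrt.
by rewrite mulr_sumr; apply: eq_bigr => i _; rewrite mxE exprMn.
Qed.

Lemma enormN x : enorm (- x) = enorm x.
Proof. by rewrite -scaleN1r enormZ normrN1 mul1r. Qed.

Lemma enorm_distC x y : enorm (x - y) = enorm (y - x).
Proof. by rewrite -enormN opprB. Qed.

Lemma enorm_coord x i : `|x ord0 i| <= enorm x.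
Proof.
rewrite /enorm -sqrtr_sqr ler_wsqrtr// (bigD1 i)//= lerDl.
by apply: sumr_ge0 => j _; exact: sqr_ge0.
Qed.

Lemma enorm_eq0 x : (enorm x == 0) = (x == 0).
Proof.
apply/eqP/eqP => [h|->]; last first.
  rewrite /enorm big1 ?sqrtr0// => i _; by rewrite mxE expr0n.
apply/rowP => i; rewrite mxE; apply/eqP.
by rewrite -normr_eq0 eq_le normr_ge0 andbT -h enorm_coord.
Qed.

Lemma enorm0 : enorm (0 : Rn) = 0.
Proof. by apply/eqP; rewrite enorm_eq0. Qed.

Let sum_mul_le x y : \sum_(i < n) x ord0 i * y ord0 i <= enorm x * enorm y.
Proof.
have [x0|x0] := eqVneq (enorm x) 0.
  rewrite x0 mul0r; move/eqP: x0; rewrite enorm_eq0 => /eqP ->.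
  by rewrite big1// => i _; rewrite mxE mul0r.
have [y0|y0] := eqVneq (enorm y) 0.
  rewrite y0 mulr0; move/eqP: y0; rewrite enorm_eq0 => /eqP ->.
  by rewrite big1// => i _; rewrite mxE mulr0.
have xy0 : 0 < enorm x * enorm y.
  by rewrite mulr_gt0// lt_neqAle eq_sym enorm_ge0 ?x0 ?y0.
rewrite -(ler_pM2l xy0).
have : 0 <= \sum_(i < n) (enorm y * x ord0 i - enorm x * y ord0 i) ^+ 2.
  by apply: sumr_ge0 => i _; exact: sqr_ge0.
under eq_bigr => i _.
  rewrite (_ : _ ^+ 2 = enorm y ^+ 2 * x ord0 i ^+ 2 + enorm x ^+ 2 * y ord0 i ^+ 2
    - 2 * (enorm x * enorm y) * (x ord0 i * y ord0 i)); last by ring.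
  over.
rewrite sumrB big_split/= -!mulr_sumr -!enorm_sqr; nra.
Qed.

Lemma enormD x y : enorm (x + y) <= enorm x + enorm y.
Proof.
rewrite -(ler_pXn2r (_ : 0 < 2)%N) ?nnegrE ?enorm_ge0 ?addr_ge0 ?enorm_ge0//.
rewrite enorm_sqr.
under eq_bigr => i _.
  rewrite mxE (_ : _ ^+ 2 = x ord0 i ^+ 2 + y ord0 i ^+ 2 +
    2 * (x ord0 i * y ord0 i)); last by ring.
  over.
rewrite !big_split/= -mulr_sumr -!enorm_sqr.
have := sum_mul_le x y; lra.
Qed.

Lemma enormB_ge x y : enorm x - enorm y <= enorm (x - y).
Proof. by rewrite lerBlDr; have := enormD (x - y) y; rewrite subrK. Qed.

Lemma enorm_le_coord x r : (forall i, `|x ord0 i| <= r) -> enorm x <= n%:R * r.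
Proof.
move=> xr; case: (posnP n) => [n0|n0].
  suff -> : enorm x = 0 by rewrite n0 mul0r.
  by rewrite /enorm big1 ?sqrtr0// => i; suff : (i < 0)%N by []; rewrite -[X in (_ < X)%N]n0; exact: ltn_ord.
have r0 : 0 <= r by apply: le_trans (xr (Ordinal n0)).
have n1 : 1 <= n%:R :> R by rewrite ler1n.
rewrite -(ler_pXn2r (_ : 0 < 2)%N) ?nnegrE ?enorm_ge0 ?mulr_ge0//.
rewrite enorm_sqr; apply: (@le_trans _ _ (\sum_(i < n) r ^+ 2)).
  apply: ler_sum => i _; rewrite -real_normK ?num_real//.
  by apply: lerXn2r; rewrite ?nnegrE.
rewrite sumr_const card_ord -[leLHS]mulr_natl exprMn ler_wpM2r ?sqr_ge0//.
by rewrite expr2 ler_peMl.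
Qed.

Lemma cube_enorm (a : Rn) l x y : cube a l x -> cube a l y ->
  enorm (x - y) <= n%:R * l.
Proof.
move=> hx hy; apply: enorm_le_coord => i; rewrite !mxE.
have /andP[h1 h2] := hx i; have /andP[h3 h4] := hy i.
by rewrite ler_norml; apply/andP; split; lra.
Qed.

Lemma cube_corner (a : Rn) l : 0 <= l -> cube a l a.
Proof. by move=> l0 i; rewrite lexx lerDl l0. Qed.

(** Every point of the preimage of an open half-line lies in a rational box whose
    trace on [D] stays in the preimage, and there are countably many such boxes. *)
Lemma measurable_locally_uniform (D : set Rn) (f : Rn -> R) : measurable D ->
  (forall y, D y -> forall e, 0 < e -> exists2 d, 0 < d &
     forall z, D z -> enorm (y - z) < d -> `|f y - f z| < e) ->
  measurable_fun D f.
Proof.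
move=> mD fc _; apply: (measurability _ (RGenOInfty.measurableE R)) => //.
move=> _ [_ [r ->] <-].
pose rbox (q : 'rV[rat]_n * nat) : set Rn :=
  box (fun i => `](ratr (q.1 ord0 i) - q.2.+1%:R^-1), (ratr (q.1 ord0 i) + q.2.+1%:R^-1)[%classic).
pose G (q : 'rV[rat]_n * nat) : set Rn :=
  [set x | rbox q x /\ (D `&` rbox q `<=` f @^-1` `]r, +oo[)].
have mG q : measurable (G q).
  have [h|h] := pselect (D `&` rbox q `<=` f @^-1` `]r, +oo[).
    rewrite (_ : G q = rbox q); first by apply: measurable_box.
    by apply/seteqP; split => [x []|x hx].
  by rewrite (_ : G q = set0)//; apply/seteqP; split => // x [].
rewrite (_ : _ `&` _ = D `&` \bigcup_q G q).
  by apply: measurableI => //; exact: countable_bigcupT_measurable.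
apply/seteqP; split => [y [Dy /=]|y [Dy [q _ [yq h]]]]; last first.
  by split => //; exact: h.
rewrite in_itv/= andbT => ry; split => //.
have [d d0 hd] := fc y Dy (f y - r) ltac:(by rewrite subr_gt0).
have [N hN] : exists N : nat, n%:R * (2 * N.+1%:R^-1) < d :> R.
  exists (Num.truncn (2 * n%:R / d)).
  have := truncnS_gt (2 * n%:R / d); rewrite mulrA !ltr_pdivrMr//.
  by rewrite [n%:R * 2]mulrC [d * _]mulrC.
have /choice[c hc] : forall i : 'I_n, exists c : rat,
    ratr c \in `](y ord0 i - N.+1%:R^-1), (y ord0 i + N.+1%:R^-1)[.
  move=> i; have [c hc] := @rat_in_itvoo R (y ord0 i - N.+1%:R^-1) (y ord0 i + N.+1%:R^-1)
    ltac:(by rewrite ltrBlDr -addrA ltrDl addr_gt0 ?invr_gt0).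
  by exists c.
have lem (q u v d' : R) : u - d' < q -> q < u + d' -> q - d' < v -> v < q + d' ->
    - (2 * d') <= u - v <= 2 * d'.
  by move=> *; apply/andP; split; lra.
exists (\row_i c i, N) => //; split.
  move=> i /=; rewrite in_itv/= mxE; have := hc i; rewrite in_itv/= => /andP[h1 h2].
  by rewrite ltrBlDr h2 -ltrBlDr h1.
move=> z [Dz hz] /=; rewrite in_itv/= andbT.
have : `|f y - f z| < f y - r.
  apply: hd => //; apply: le_lt_trans hN; apply: enorm_le_coord => i; rewrite !mxE.
  have := hz i; have := hc i; rewrite /= !in_itv/= mxE => /andP[h1 h2] /andP[h3 h4].
  by rewrite ler_norml; exact: lem h1 h2 h3 h4.
by rewrite ltr_norml => /andP[_]; lra.
Qed.

End euclidean_norm.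

(** * Companion cubes for Calderon-Zygmund kernels *)

Section kernels.
Context {R : realType}.
Variable n : nat.
Hypothesis n_gt0 : (0 < n)%N.
Local Notation Rn := 'rV[R]_n.
Local Notation C := R[i].
Local Notation leb := (@lebesgue_rV R n).
Local Notation normc := (@Normc.normc R).
Implicit Types (X Y : set Rn) (K : Rn -> Rn -> C) (eps l : R).

(** What the lower bound asks of the kernel.  The two kinds of operators meet here:
    [eps] is the accuracy, [L] the relative distance of the cubes, and [c] the size
    of the constant, scaled as homogeneity of degree [-n] dictates. *)
Definition has_companion_cubes K := forall eps, 0 < eps -> exists L c : R,
  [/\ 0 <= L, 0 < c & forall (a : Rn) l, 0 < l -> exists (a' : Rn) (K0 : C),
    [/\ cube a' l `&` cube a l = set0,
        (forall i, `|a' ord0 i - a ord0 i| <= L * l),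
        c <= normc K0 * l ^+ n &
        nearly_constant K K0 eps (cube a' l) (cube a l)]].

Lemma nearly_constant_pointwise K (K0 : C) eps X Y : measurable X -> measurable Y ->
  0 <= eps -> (forall x, X x -> cmeasurable Y (K x)) ->
  (forall x y, X x -> Y y -> normc (K x y - K0) <= eps * normc K0) ->
  nearly_constant K K0 eps X Y.
Proof.
move=> mX mY eps0 mK KK0.
have mKK x : X x -> measurable_fun Y (fun y => normc (K x y - K0)).
  move=> Xx; apply: measurable_normc; apply: cmeasurableB; first exact: mK.
  exact: cmeasurable_cst.
have e0 : 0 <= eps * normc K0 by rewrite mulr_ge0 ?normc_ge0.
split => //.
- move=> u mu u0 ufin.
  exists (fun=> (eps * normc K0)%:E * \int[leb]_(y in Y) (u y)%:E)%E; split => //.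
  + move=> x Xx; rewrite -ge0_integralZl_EFin//; last 2 first.
    * by move=> y _; rewrite lee_fin.
    * by apply/measurable_EFinP; exact: measurable_funTS.
    apply: ge0_le_integral => //.
    * by move=> y _; rewrite lee_fin mulr_ge0 ?normc_ge0.
    * apply/measurable_EFinP; apply: measurable_funM; last exact: mKK.
      exact: measurable_funTS.
    * by apply: measurable_funeM; apply/measurable_EFinP; exact: measurable_funTS.
    by move=> y Yy; rewrite -EFinM lee_fin mulrC ler_wpM2r ?KK0.
  + by rewrite integral_cst// muleAC.
- move=> x Xx; rewrite -integral_cst//; apply: ge0_le_integral => //.
  + by move=> y _; rewrite lee_fin normc_ge0.
  + by apply/measurable_EFinP; exact: mKK.
  by move=> y Yy; rewrite lee_fin KK0.
Qed.

(** The regularity condition makes [K x] continuous away from [x]. *)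
Lemma CZ_kernel_measurable omega K x Y : CZ_kernel omega K ->
  omega t @[t --> 0^'+] --> (0 : R) -> measurable Y -> ~ Y x ->
  cmeasurable Y (K x).
Proof.
move=> [om0 omle _ Kreg] om_cvg mY nYx.
have K_unif y : Y y -> forall e, 0 < e -> exists2 d, 0 < d &
    forall z, Y z -> enorm (y - z) < d -> normc (K x y - K x z) < e.
  move=> Yy e e0.
  have D0 : 0 < enorm (y - x).
    rewrite lt_neqAle enorm_ge0 andbT eq_sym enorm_eq0 subr_eq0.
    by apply/eqP => yx; apply: nYx; rewrite -yx.
  set D := enorm (y - x) in D0.
  have Dn : 0 < D ^+ n by rewrite exprn_gt0.
  have /cvgrPdist_lt/(_ (e * D ^+ n)) := om_cvg.
  rewrite mulr_gt0// => /(_ isT) [t0 /= t00 ht].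
  exists (Num.min (t0 / 2) 4^-1 * D).
    by rewrite mulr_gt0// lt_min divr_gt0//= invr_gt0.
  move=> z Yz; rewrite -ltr_pdivrMr// lt_min => /andP[h1 h2].
  have hz : enorm (y - z) < enorm (y - x) / 2.
    by move: h2; rewrite -/D ltr_pdivrMr//; lra.
  have := Kreg _ _ _ hz; rewrite -/D.
  have q0 : 0 <= enorm (y - z) / D by rewrite divr_ge0 ?enorm_ge0// ltW.
  have om_lt : omega (enorm (y - z) / D) < e * D ^+ n.
    have h3 : 0 < t0 / 2 by rewrite divr_gt0.
    have m0 : 0 < Num.min (t0 / 2) 4^-1 by rewrite lt_min h3 invr_gt0/=.
    set m := Num.min _ _ in m0.
    have m1 : m <= 4^-1 by rewrite ge_min lexx orbT.
    have m2 : m <= t0 / 2 by rewrite ge_min lexx.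
    apply: (@le_lt_trans _ _ (omega m)).
      by apply: omle => //; [rewrite ltW// lt_min h1 h2|lra].
    have : `|0 - omega m| < e * D ^+ n.
      apply: ht => //=; rewrite sub0r normrN gtr0_norm//; lra.
    by rewrite sub0r normrN; apply: le_lt_trans; exact: ler_norm.
  have := normc_ge0 (K y x - K z x).
  set A := normc _; set B := normc _ => A0 hAB.
  apply: (@le_lt_trans _ _ ((D ^+ n)^-1 * omega (enorm (y - z) / D))).
    by apply: le_trans hAB; rewrite lerDr.
  by rewrite mulrC ltr_pdivrMr.
split; apply: measurable_locally_uniform => // y Yy e e0;
  have [d d0 hd] := K_unif y Yy e e0; exists d => // z Yz yz;
  apply: le_lt_trans (hd z Yz yz).
  by rewrite -ReN -ReD Re_le_normc.
by rewrite -ImN -ImD Im_le_normc.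
Qed.

(** Non-degeneracy gives a point [x0] at distance comparable to the side of the
    cube where [K x0 a] is large; regularity spreads this value over the cubes at
    [x0] and [a], with a relative error governed by [omega]. *)
Lemma CZ_companion_cubes omega K : CZ_kernel omega K ->
  omega t @[t --> 0^'+] --> (0 : R) ->
  (exists2 c0 : R, 0 < c0 & forall y r, 0 < r ->
     exists2 x, ~ eball y r x & (c0 * r ^+ n)^-1 <= normc (K x y)) ->
  has_companion_cubes K.
Proof.
move=> CZ om_cvg [c0 c00 nondeg] eps eps0.
have [om0 omle [CK Kbound] Kreg] := CZ.
have n1 : 1 <= n%:R :> R by rewrite ler1n.
pose M : R := 1 + 2 ^+ n.
have M0 : 0 < M by rewrite addr_gt0// exprn_gt0.
pose eta := eps / (M * c0).
have eta0 : 0 < eta by rewrite divr_gt0// mulr_gt0.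
have [t [t0 t1 t_eta]] : exists t : R, [/\ 0 < t, t < 2^-1 & omega t <= eta].
  have /cvgrPdist_lt/(_ _ eta0)[t0 /= t00 ht] := om_cvg.
  have h3 : 0 < t0 / 2 by rewrite divr_gt0.
  have m0 : 0 < Num.min (t0 / 2) 4^-1 by rewrite lt_min h3 invr_gt0/=.
  set m := Num.min _ _ in m0.
  have m1 : m <= 4^-1 by rewrite ge_min lexx orbT.
  have m2 : m <= t0 / 2 by rewrite ge_min lexx.
  exists m; split => //; first by lra.
  have : `|0 - omega m| < eta.
    apply: ht => //=; rewrite sub0r normrN gtr0_norm//; lra.
  by rewrite sub0r normrN => h; apply: le_trans (ltW h); exact: ler_norm.
pose A := 2 * n%:R / t.
have A0 : 0 < A by rewrite divr_gt0// mulr_gt0// (lt_le_trans _ n1).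
have At : A * t = 2 * n%:R by rewrite /A divfK// gt_eqF.
have A4 : 4 * n%:R < A.
  rewrite -(ltr_pM2r t0) At; have : 0 < n%:R :> R by lra.
  by move=> h; nra.
pose D := 1 + `|CK| * c0.
have D1 : 1 <= D by rewrite lerDl mulr_ge0// ltW.
exists (D * A), (c0 * A ^+ n)^-1; split.
- by rewrite mulr_ge0// ltW// (lt_le_trans _ D1).
- by rewrite invr_gt0 mulr_gt0// exprn_gt0.
move=> a l l0; have Al : 0 < A * l by rewrite mulr_gt0.
have [x0 far_x0 big] := nondeg a (A * l) Al.
have dA : A * l <= enorm (x0 - a) by rewrite leNgt; apply/negP.
set d := enorm (x0 - a) in dA.
have d0 : 0 < d by apply: lt_le_trans dA.
have dn : 0 < d ^+ n by rewrite exprn_gt0.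
have nl : n%:R * l < A * l / 4 by rewrite -[n%:R * l]mulr1; nra.
exists x0, (K x0 a); split.
- apply/seteqP; split => // z [zx za].
  have h1 := cube_enorm (cube_corner x0 (ltW l0)) zx.
  have h2 := cube_enorm za (cube_corner a (ltW l0)).
  have := enormD (x0 - z) (z - a); rewrite addrA subrK -/d; lra.
- move=> i; have := enorm_coord (x0 - a) i; rewrite !mxE => /le_trans; apply.
  have Aln : 0 < (A * l) ^+ n by rewrite exprn_gt0.
  have : (c0 * (A * l) ^+ n)^-1 <= CK / d ^+ n.
    apply: le_trans big _; apply: Kbound; rewrite -subr_eq0 -enorm_eq0 gt_eqF//.
  rewrite ler_pdivlMr// ler_pdivrMl ?mulr_gt0// => h.
  have h' : d ^+ n <= D * (A * l) ^+ n.
    apply: (le_trans h); rewrite /D.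
    have : c0 * (A * l) ^+ n * CK <= c0 * (A * l) ^+ n * `|CK|.
      by rewrite ler_wpM2l ?ler_norm// mulr_ge0// ltW.
    lra.
  have DAl0 : 0 <= D * (A * l) by rewrite mulr_ge0 ?(ltW Al)//; lra.
  rewrite -mulrA -(ler_pXn2r n_gt0) ?nnegrE ?(ltW d0) ?DAl0//.
  apply: (le_trans h'); rewrite [leRHS]exprMn ler_wpM2r ?(ltW Aln)//.
  by rewrite -[leLHS]expr1 ler_weXn2l.
- move: big; rewrite exprMn mulrA invfM => big.
  by rewrite -ler_pdivrMr ?exprn_gt0.
apply: nearly_constant_pointwise; try exact: measurable_cube; try exact: ltW.
  move=> x Xx; apply: CZ_kernel_measurable CZ om_cvg _ _; first exact: measurable_cube.
  move=> Yx; have h1 := cube_enorm (cube_corner x0 (ltW l0)) Xx.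
  have h2 := cube_enorm Yx (cube_corner a (ltW l0)).
  have := enormD (x0 - x) (x - a); rewrite addrA subrK -/d; lra.
move=> x y Xx Yy.
have hx := cube_enorm (cube_corner x0 (ltW l0)) Xx.
have hy := cube_enorm (cube_corner a (ltW l0)) Yy.
have omt s : 0 <= s -> s <= t -> omega s <= eta.
  by move=> s0 st; apply: le_trans t_eta; apply: omle => //; lra.
have nlt : 2 * (n%:R * l) <= t * (A * l).
  by have := congr1 ( *%R^~ l) At; rewrite /=; lra.
have dist2 : d / 2 <= enorm (x0 - y).
  have := enormB_ge (x0 - a) (y - a); rewrite opprB addrA subrK -/d.
  rewrite [enorm (y - a)]enorm_distC; lra.
set d' := enorm (x0 - y) in dist2.
have d'0 : 0 < d' by lra.
have e1 : normc (K x0 a - K x0 y) <= (d ^+ n)^-1 * eta.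
  have : enorm (a - y) < enorm (a - x0) / 2.
    by rewrite [enorm (a - x0)]enorm_distC -/d; lra.
  move=> /(Kreg _ _ _); rewrite [enorm (a - x0)]enorm_distC -/d => h.
  apply: (@le_trans _ _ ((d ^+ n)^-1 * omega (enorm (a - y) / d))).
    by apply: le_trans h; rewrite lerDr normc_ge0.
  rewrite ler_wpM2l ?invr_ge0 ?(ltW dn)//; apply: omt.
    by rewrite divr_ge0 ?enorm_ge0// ltW.
  by rewrite ler_pdivrMr//; nra.
have e2 : normc (K x0 y - K x y) <= 2 ^+ n * (d ^+ n)^-1 * eta.
  have : enorm (x0 - x) < enorm (x0 - y) / 2 by rewrite -/d'; lra.
  move=> /(Kreg _ _ _); rewrite -/d' => h.
  apply: (@le_trans _ _ ((d' ^+ n)^-1 * omega (enorm (x0 - x) / d'))).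
    by apply: le_trans h; rewrite lerDl normc_ge0.
  apply: ler_pM.
  - by rewrite invr_ge0 exprn_ge0// ltW.
  - apply: om0; rewrite divr_ge0 ?enorm_ge0 ?(ltW d'0)//=.
    by rewrite ltr_pdivrMr//; lra.
  - rewrite -[2 ^+ n]invrK -invfM -exprVn -exprMn lef_pV2 ?posrE ?exprn_gt0//; last first.
      by rewrite mulr_gt0 ?invr_gt0.
    by apply: lerXn2r; rewrite ?nnegrE; [rewrite mulr_ge0 ?invr_ge0 ?(ltW d0)|exact: ltW|rewrite mulrC].
  - apply: omt; first by rewrite divr_ge0 ?enorm_ge0// ltW.
    by rewrite ler_pdivrMr//; nra.
have -> : K x y - K x0 a = - ((K x0 a - K x0 y) + (K x0 y - K x y)) by ring.
rewrite normcN; apply: (le_trans (normcD _ _)); apply: (le_trans (lerD e1 e2)).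
rewrite -[X in X + _]mul1r -mulrA -mulrDl -/M.
have hd : (d ^+ n)^-1 <= ((A * l) ^+ n)^-1.
  rewrite lef_pV2 ?posrE ?exprn_gt0//; apply: lerXn2r => //; rewrite nnegrE ltW//.
apply: (@le_trans _ _ (eps * (c0 * (A * l) ^+ n)^-1)); last first.
  by rewrite ler_pM2l.
have -> : eps * (c0 * (A * l) ^+ n)^-1 = M * (((A * l) ^+ n)^-1 * eta).
  by rewrite /eta; field; rewrite !gt_eqF// exprn_gt0.
by rewrite ler_pM2l// ler_pM2r.
Qed.

End kernels.

(** * Polar coordinates *)

Section polar_coordinates.
Context {R : realType}.
Variable n : nat.
Hypothesis n_gt0 : (0 < n)%N.
Local Notation Rn := 'rV[R]_n.
Local Notation leb := (@lebesgue_rV R n).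
Local Notation sphere := (@unit_sphere R n).
Implicit Types (x y w : Rn) (A D : set Rn) (r : R).

Let n_neq0 : n%:R != 0 :> R. Proof. by rewrite pnatr_eq0 -lt0n. Qed.

Lemma preimage_measurable d (T : measurableType d) (f : T -> Rn) A :
  measurable_fun setT f -> measurable A -> measurable (f @^-1` A).
Proof. by move=> mf mA; rewrite -[X in measurable X]setTI; exact: mf. Qed.

Lemma normalize_sphere w : w != 0 -> sphere (normalize w).
Proof.
move=> w0; rewrite /unit_sphere /= /normalize enormZ.
have q : enorm w != 0 by rewrite enorm_eq0.
by rewrite ger0_norm ?invr_ge0 ?enorm_ge0// mulVf.
Qed.

Lemma normalizeZ c w : 0 < c -> normalize (c *: w) = normalize w.
Proof.
move=> c0; rewrite /normalize enormZ gtr0_norm// scalerA invfM.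
by rewrite mulrAC mulVf ?mul1r// gt_eqF.
Qed.

Lemma measurable_unit_sphere : measurable sphere.
Proof.
rewrite (_ : sphere = @enorm R n @^-1` [set 1]).
  by rewrite -[X in measurable X]setTI; exact: measurable_enorm.
by apply/seteqP; split.
Qed.

Definition shell (r r' : R) : set Rn := [set w | r <= enorm w < r'].
Definition cone (r : R) A : set Rn := [set w | 0 < enorm w < r] `&` @normalize R n @^-1` A.

Lemma measurable_shell r r' : measurable (shell r r').
Proof.
rewrite (_ : shell r r' = @enorm R n @^-1` `[r, r'[).
  by rewrite -[X in measurable X]setTI; exact: measurable_enorm.
by apply/seteqP; split => x /=; rewrite in_itv.
Qed.

Lemma measurable_cone r A : measurable A -> measurable (cone r A).
Proof.
move=> mA; apply: measurableI; last exact: preimage_measurable (@measurable_normalize _ _) mA.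
rewrite (_ : mkset _ = @enorm R n @^-1` `]0, r[).
  by rewrite -[X in measurable X]setTI; exact: measurable_enorm.
by apply/seteqP; split => x /=; rewrite in_itv.
Qed.

Lemma sphere_measureE A : sphere_measure n A = (n%:R%:E * leb (cone 1 A))%E.
Proof. by []. Qed.

Lemma lebesgue_cone r A : 0 < r -> measurable A ->
  leb (cone r A) = ((r ^+ n)%:E * leb (cone 1 A))%E.
Proof.
move=> r0 mA; have rV0 : 0 < r^-1 by rewrite invr_gt0.
have -> : cone r A = (fun w => r^-1 *: w + 0) @^-1` cone 1 A.
  apply/seteqP; split => w; rewrite /cone /= addr0 enormZ gtr0_norm// normalizeZ//.
    by move=> [/andP[w0 wr] Aw]; rewrite mulr_gt0//= mulrC ltr_pdivrMr// mul1r.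
  by rewrite pmulr_rgt0// mulrC ltr_pdivrMr// mul1r.
rewrite lebesgue_rV_affine//; [|by rewrite gt_eqF|exact: measurable_cone].
by rewrite gtr0_norm// invrK.
Qed.

Lemma lebesgue_cone_fin A : measurable A -> exists2 kappa : R, 0 <= kappa &
  leb (cone 1 A) = kappa%:E.
Proof.
move=> mA; have := lebesgue_cube (const_mx (-1) : Rn) (ltac:(lra) : 0 <= 2 :> R).
move=> /(sub_measure_real (measurable_cube _ _) (measurable_cone 1 mA)) [].
  move=> w [/andP[_ w1] _] i; have := le_trans (enorm_coord w i) (ltW w1).
  by rewrite ler_norml mxE => /andP[h1 h2]; apply/andP; split; lra.
by move=> kappa [k0 _ ->]; exists kappa.
Qed.

Lemma lebesgue_shell r r' A kappa : 0 < r -> r <= r' -> measurable A ->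
  leb (cone 1 A) = kappa%:E ->
  leb (shell r r' `&` @normalize R n @^-1` A) = ((r' ^+ n - r ^+ n) * kappa)%:E.
Proof.
move=> r0 rr mA hk; have r'0 : 0 < r' by apply: lt_le_trans rr.
have mN : measurable (@normalize R n @^-1` A).
  exact: preimage_measurable (@measurable_normalize _ _) mA.
have mS := measurableI _ _ (measurable_shell r r') mN.
have := lebesgue_cone r'0 mA; rewrite (_ : cone r' A = cone r A `|`
    (shell r r' `&` @normalize R n @^-1` A)); last first.
  apply/seteqP; split => [w [/= /andP[w0 wr] Aw]|w].
    by have [wl|wl] := ltP (enorm w) r; [left|right]; split => //=; apply/andP.
  move=> [[/= /andP[w0 wr] Aw]|[/= /andP[w0 wr] Aw]]; split => //=; apply/andP; split => //.
    exact: lt_le_trans rr.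
  exact: lt_le_trans w0.
have dj : cone r A `&` (shell r r' `&` @normalize R n @^-1` A) = set0.
  apply/seteqP; split => // w [[/= /andP[_ wr] _] [/= /andP[rw _] _]].
  by have := lt_le_trans wr rw; rewrite ltxx.
rewrite measureU//; last exact: measurable_cone.
rewrite [X in (X + _)%E](lebesgue_cone r0 mA) hk -!EFinM => h.
have -> : leb (shell r r' `&` @normalize R n @^-1` A) =
    ((r' ^+ n * kappa)%:E - (r ^+ n * kappa)%:E)%E.
  by rewrite -h addeAC subee// add0e.
by rewrite -EFinB; congr EFin; ring.
Qed.

(** Polar coordinates for a function of the direction alone. *)
Lemma integral_shell r r' (h : Rn -> \bar R) : 0 < r -> r <= r' ->
  measurable_fun sphere h -> (forall x, sphere x -> (0 <= h x)%E) ->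
  (\int[leb]_(w in shell r r') h (normalize w) =
   ((r' ^+ n - r ^+ n) / n%:R)%:E * \int[sphere_measure n]_(x in sphere) h x)%E.
Proof.
move=> r0 rr mh h0.
pose phi w : Rn := \1_(shell r r') w *: normalize w.
have mphi : measurable_fun setT phi.
  apply: measurable_fun_coordP => i.
  rewrite [X in measurable_fun _ X](_ : _ =
    (fun w => \1_(shell r r') w * normalize w ord0 i)); last by apply/funext => w; rewrite mxE.
  apply: measurable_funM; first by apply: measurable_indic; exact: measurable_shell.
  exact: (measurableT_comp (@measurable_coord R n i) (@measurable_normalize R n)).
have phiE w : shell r r' w -> phi w = normalize w.
  by move=> Sw; rewrite /phi indicE mem_set// scale1r.
have phi0 w : ~ shell r r' w -> phi w = 0.
  by move=> Sw; rewrite /phi indicE memNset// scale0r.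
have nz : ~ sphere 0.
  by rewrite /unit_sphere /= enorm0 => /eqP; rewrite eq_sym oner_eq0.
have pre A : A `<=` sphere -> phi @^-1` A = shell r r' `&` @normalize R n @^-1` A.
  move=> AS; apply/seteqP; split => w /=.
    have [Sw|nS] := pselect (shell r r' w); first by rewrite phiE.
    by rewrite phi0// => /AS.
  by move=> [Sw Aw]; rewrite phiE.
have preS : phi @^-1` sphere = shell r r'.
  rewrite pre//; apply/seteqP; split => [w []//|w Sw]; split => //=.
  apply: normalize_sphere; rewrite -enorm_eq0 gt_eqF//.
  by case/andP: Sw => rw _; exact: lt_le_trans rw.
have rn : 0 <= (r' ^+ n - r ^+ n) / n%:R.
  rewrite divr_ge0// subr_ge0; apply: lerXn2r => //; rewrite nnegrE ltW//.
  exact: lt_le_trans rr.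
(* [phi] is [normalize] on the shell and 0, a point off the sphere, elsewhere *)
transitivity (\int[pushforward leb phi]_(x in sphere) h x)%E.
  rewrite ge0_integral_pushforward//; last 2 first.
  - exact: measurable_unit_sphere.
  - by move=> x; rewrite inE; exact: h0.
  rewrite preS; apply: eq_integral => w; rewrite inE => Sw.
  by rewrite /= phiE.
have := ge0_integral_mscale (sphere_measure n) measurable_unit_sphere (NngNum rn) mh h0.
move=> /= <-.
apply: eq_measure_integral => //= A mA AS.
rewrite /pushforward pre// /mscale/= /sphere_measure.
have [kappa k0 hk] := lebesgue_cone_fin mA.
rewrite (lebesgue_shell r0 rr mA hk).
rewrite (_ : leb _ = kappa%:E)//.
by rewrite -!EFinM; congr EFin; field.
Qed.

Lemma bernoulli_ge r : r <= 1 -> 0 <= r -> 1 - n%:R * r <= (1 - r) ^+ n.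
Proof.
move=> r1 r0; elim: n => [|m IH]; first by rewrite expr0 mul0r subr0.
rewrite exprS; have : (1 - r) * (1 - m%:R * r) <= (1 - r) * (1 - r) ^+ m.
  by rewrite ler_wpM2l// subr_ge0.
apply: le_trans; rewrite -natr1.
have : 0 <= m%:R * r ^+ 2 by rewrite mulr_ge0// sqr_ge0.
lra.
Qed.

Lemma pow1D_le r : r <= 1 -> 0 <= r -> (1 + r) ^+ n <= 1 + 2 ^+ n * r.
Proof.
move=> r1 r0.
suff : (1 + r) ^+ n <= 1 + (2 ^+ n - 1) * r by lra.
elim: n => [|m IH]; first by rewrite !expr0; lra.
rewrite !exprS; have : (1 + r) * (1 + r) ^+ m <= (1 + r) * (1 + (2 ^+ m - 1) * r).
  by rewrite ler_wpM2l// addr_ge0.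
move/le_trans; apply.
have p1 : 1 <= 2 ^+ m :> R by rewrite exprn_ege1// ler1n.
have : 0 <= (2 ^+ m - 1) * r * (1 - r) by rewrite !mulr_ge0// subr_ge0.
lra.
Qed.

Lemma measurable_cap theta r : measurable (sphere `&` eball theta r).
Proof.
apply: measurableI; first exact: measurable_unit_sphere.
rewrite (_ : eball theta r = (fun x => enorm (1 *: x + - theta)) @^-1` `]-oo, r[).
  have mg : measurable_fun setT (fun x : Rn => enorm (1 *: x + - theta)).
    exact: (measurableT_comp (@measurable_enorm R n) (measurable_affine 1 (- theta))).
  by rewrite -[X in measurable X]setTI; exact: mg.
by apply/seteqP; split => x /=; rewrite in_itv/= scale1r.
Qed.

(** The part of the shell of thickness [r] below the sphere that lies over a cap
    of radius [r] fits in a cube of side [4 r]. *)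
Lemma sphere_measure_cap theta r : sphere theta -> 0 < r -> r < 1 ->
  (sphere_measure n (sphere `&` eball theta r) <=
   (n%:R * 4 ^+ n * r ^+ n.-1)%:E)%E.
Proof.
move=> th r0 r1.
have mA := measurable_cap theta r.
set A := sphere `&` _ in mA *.
have [kappa k0 hk] := lebesgue_cone_fin mA.
have r'0 : 0 < 1 - r by rewrite subr_gt0.
have r'1 : 1 - r <= 1 by lra.
have := lebesgue_shell r'0 r'1 mA hk; rewrite expr1n.
have l0 : 0 <= 4 * r by lra.
have := lebesgue_cube (theta - const_mx (2 * r)) l0.
have mS : measurable (shell (1 - r) 1 `&` @normalize R n @^-1` A).
  apply: measurableI; first exact: measurable_shell.
  exact: preimage_measurable (@measurable_normalize _ _) mA.
move=> /(sub_measure_real (measurable_cube _ _) mS) [].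
  move=> w [/= /andP[w1 w2] [_ hw]] i.
  have w0 : enorm w != 0 by rewrite gt_eqF//; lra.
  have : enorm (w - theta) <= 2 * r.
    have -> : w - theta = (w - normalize w) + (normalize w - theta) by rewrite addrA subrK.
    apply: (le_trans (enormD _ _)).
    have : enorm (w - normalize w) <= r.
      rewrite /normalize -[X in X - _]scale1r -scalerBl enormZ.
      have -> : `|1 - (enorm w)^-1| = (enorm w)^-1 - 1.
        rewrite ler0_norm ?opprB// subr_le0 invf_ge1 ?ltW//; lra.
      rewrite mulrBl mulVf// mul1r; lra.
    by move: hw; rewrite /eball /=; lra.
  move=> /(le_trans (enorm_coord _ i)); rewrite !mxE ler_norml => /andP[h1 h2].
  by apply/andP; split; lra.
move=> m [_ mr ->] [hm].
rewrite sphere_measureE hk -EFinM lee_fin.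
have b : r <= 1 - (1 - r) ^+ n.
  suff : (1 - r) ^+ n <= 1 - r by lra.
  by rewrite -[leRHS]expr1; apply: ler_wiXn2l => //; exact: ltW.
rewrite -(ler_pM2l r0).
have : r * kappa <= (4 * r) ^+ n.
  by apply: le_trans mr; rewrite hm ler_wpM2r.
move=> /(ler_wpM2l (ler0n R n)).
rewrite exprMn (_ : r * (n%:R * 4 ^+ n * r ^+ n.-1) = n%:R * (4 ^+ n * r ^+ n)); last first.
  by rewrite -[X in _ = _ * (_ * r ^+ X)](prednK n_gt0) exprS; ring.
by move=> h; apply: le_trans h; rewrite mulrCA.
Qed.

End polar_coordinates.

(** * Companion cubes for homogeneous kernels *)

Section homogeneous_kernels.
Context {R : realType}.
Variable n : nat.
Hypothesis n_gt0 : (0 < n)%N.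
Local Notation Rn := 'rV[R]_n.
Local Notation C := R[i].
Local Notation leb := (@lebesgue_rV R n).
Local Notation normc := (@Normc.normc R).
Local Notation sphere := (@unit_sphere R n).
Variables (Omega : Rn -> C) (theta0 : Rn).

(** [Omega], extended by zero off the sphere, to have it measurable on [R^n]. *)
Definition sphere_ext x : C := if pselect (sphere x) then Omega x else 0.
Local Notation Om := sphere_ext.

Definition convolution_kernel z : C := ((enorm z ^+ n)^-1)%:C%C * Om (normalize z).
Local Notation ker := convolution_kernel.

Hypothesis Omega_int : integrable_on_sphere Omega.
Hypothesis theta0_sphere : sphere theta0.
Hypothesis theta0_pt : sphere_lebesgue_pt Omega theta0.
Hypothesis Omega0_neq0 : Omega theta0 != 0.

Let OmE x : sphere x -> Om x = Omega x.
Proof. by move=> Sx; rewrite /sphere_ext; case: pselect. Qed.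

Let mOm : cmeasurable setT Om.
Proof.
have [[m1 m2] _] := Omega_int; split.
  rewrite (_ : (fun x => complex.Re (Om x)) = (fun x => complex.Re (Omega x)) \_ sphere).
    exact: ((measurable_restrictT _ (@measurable_unit_sphere R n)).1 m1).
  by apply/funext => x; rewrite patchE /sphere_ext; case: pselect => Sx; [rewrite mem_set|rewrite memNset].
rewrite (_ : (fun x => complex.Im (Om x)) = (fun x => complex.Im (Omega x)) \_ sphere).
  exact: ((measurable_restrictT _ (@measurable_unit_sphere R n)).1 m2).
by apply/funext => x; rewrite patchE /sphere_ext; case: pselect => Sx; [rewrite mem_set|rewrite memNset].
Qed.

Lemma measurable_convolution_kernel : cmeasurable setT ker.
Proof.
apply: cmeasurableM.
  apply: cmeasurableR; apply: measurable_inv_ge0 => [x|]; first by rewrite exprn_ge0// enorm_ge0.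
  by apply: measurable_funX; exact: measurable_enorm.
have [m1 m2] := mOm; split.
  exact: (measurableT_comp m1 (@measurable_normalize R n)).
exact: (measurableT_comp m2 (@measurable_normalize R n)).
Qed.

Let O0 : R := normc (Omega theta0).
Let O0_gt0 : 0 < O0. Proof. by rewrite /O0 normc_gt0. Qed.

Let dev x : R := normc (Omega x - Omega theta0).

Let mdev : measurable_fun sphere dev.
Proof.
have [mO _] := Omega_int; apply: measurable_normc; apply: cmeasurableB => //.
Qed.

(** The Lebesgue point condition in multiplied form, with the size of the cap
    inserted. *)
Lemma cap_deviation e : 0 < e -> exists2 r0 : R, 0 < r0 & forall r, 0 < r ->
  r < r0 -> r < 1 -> (\int[sphere_measure n]_(x in sphere `&` eball theta0 r)
    (dev x)%:E <= (e * (n%:R * 4 ^+ n * r ^+ n.-1))%:E)%E.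
Proof.
move=> e0; have /fine_cvgP[fin cvg] := theta0_pt.
have /cvgrPdist_lt/(_ _ e0)[r1 /= r10 h1] := cvg.
have [r2 /= r20 h2] := fin.
exists (Num.min r1 r2); first by rewrite lt_min r10 r20.
move=> r r0; rewrite lt_min => /andP[rr1 rr2] r_1.
have := h1 r; rewrite /ball/= sub0r normrN gtr0_norm// => /(_ rr1 r0).
have := h2 r; rewrite /ball/= sub0r normrN gtr0_norm// => /(_ rr2 r0).
set A := sphere `&` eball theta0 r.
have mA : measurable A by exact: measurable_cap.
set I := (\int[_]_(_ in _) _)%E.
have I0 : (0 <= I)%E by apply: integral_ge0 => x _; rewrite lee_fin normc_ge0.
have cap := sphere_measure_cap n_gt0 theta0_sphere r0 r_1.
rewrite -/A in cap.
have [s0|s0] := eqVneq (sphere_measure n A) 0%E.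
  move=> _ _; have -> : I = 0%E.
    apply: null_set_integral => //.
    apply/measurable_EFinP; apply: measurable_funS mdev; last exact: subIsetl.
    exact: measurable_unit_sphere.
  rewrite lee_fin; apply: mulr_ge0; first exact: ltW.
  by apply: mulr_ge0; [apply: mulr_ge0; rewrite ?exprn_ge0|rewrite exprn_ge0// ltW].
have : (0 <= sphere_measure n A)%E by exact: measure_ge0.
move: cap s0; case: (sphere_measure n A) => // s cap s_neq0 s_ge0.
have s_gt0 : 0 < s by rewrite lt_neqAle eq_sym -eqe s_neq0 -lee_fin.
rewrite inver gt_eqF// => q1 q2.
have Ifin : I \is a fin_num.
  rewrite ge0_fin_numE// ltey; apply/eqP => Iy; move: q1.
  by rewrite Iy gt0_muley// lte_fin invr_gt0.
move: q2; rewrite -(fineK Ifin) in I0 *; rewrite /= sub0r normrN => q2.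
rewrite lee_fin; apply: (@le_trans _ _ (e * s)); last first.
  by rewrite ler_wpM2l ?(ltW e0)//; rewrite lee_fin in cap.
have : s^-1 * fine I < e by apply: le_lt_trans q2; exact: ler_norm.
by rewrite mulrC ltr_pdivrMr// => /ltW.
Qed.

Definition target (A l : R) : Rn := (A * l) *: theta0.

(** Split [ker z - K0] into the deviation of [Omega] and that of the radial factor;
    the latter is of relative size [t = n / A]. *)
Lemma target_estimate (A l t : R) (z : Rn) : 0 < A -> 0 < l -> n%:R / A = t -> 2 ^+ n * t <= 4^-1 ->
  t <= 4^-1 -> (forall i, `|z ord0 i - target A l ord0 i| <= l) ->
  [/\ shell ((1 - 2 * t) * (A * l)) ((1 + 2 * t) * (A * l)) z,
      eball theta0 (3 * t) (normalize z) &
      normc (ker z - ((A * l) ^- n)%:C%C * Omega theta0) <=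
        2 * (A * l) ^- n * dev (normalize z) +
        2 * 2 ^+ n * t * ((A * l) ^- n * O0)].
Proof.
move=> A0 l0 tE nt t4 hz.
have Al : 0 < A * l by rewrite mulr_gt0.
have n1 : 1 <= n%:R :> R by rewrite ler1n.
have t0 : 0 < t by rewrite -tE divr_gt0// (lt_le_trans _ n1).
have tAl : n%:R * l = t * (A * l) by rewrite -tE; field; rewrite gt_eqF.
have hz' : enorm (z - target A l) <= t * (A * l).
  by rewrite -tAl; apply: enorm_le_coord => i; move: (hz i); rewrite !mxE.
have th1 : enorm theta0 = 1 by [].
have nT : enorm (target A l) = A * l.
  by rewrite /target enormZ th1 mulr1 gtr0_norm.
have z1 : (1 - t) * (A * l) <= enorm z.
  have := enormB_ge (target A l) (target A l - z).
  rewrite subKr nT enorm_distC; lra.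
have z2 : enorm z <= (1 + t) * (A * l).
  have := enormD (z - target A l) (target A l).
  rewrite subrK nT; lra.
have z0 : 0 < enorm z by nra.
have z_neq0 : z != 0 by rewrite -enorm_eq0 gt_eqF.
pose p := enorm z / (A * l).
have p1 : 1 - t <= p by rewrite ler_pdivlMr.
have p2 : p <= 1 + t by rewrite ler_pdivrMr.
have p0 : 0 < p by rewrite divr_gt0.
have pz : enorm z = p * (A * l) by rewrite divfK// gt_eqF.
split.
- rewrite /shell /=; apply/andP; split; nra.
- rewrite /eball /=.
  have -> : normalize z - theta0 = (p^-1 - 1) *: ((A * l)^-1 *: z) +
      (A * l)^-1 *: (z - target A l).
    rewrite /target scalerBr !scalerA mulVf ?gt_eqF// scale1r addrA -scalerDl.
    rewrite /normalize; congr (_ *: _ - _); rewrite /p; field.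
    by rewrite !gt_eqF.
  apply: (le_lt_trans (enormD _ _)); rewrite !enormZ.
  have -> : `|(A * l)^-1| = (A * l)^-1 by rewrite gtr0_norm// invr_gt0.
  have e1 : (A * l)^-1 * enorm (z - target A l) <= t by rewrite mulrC ler_pdivrMr.
  have e2 : `|p^-1 - 1| * ((A * l)^-1 * enorm z) <= t.
    rewrite [(A * l)^-1 * _]mulrC -/p -[X in _ * X]gtr0_norm// -normrM.
    rewrite mulrBl mulVf ?gt_eqF// mul1r ler_norml; apply/andP; split; lra.
  lra.
have Aln : 0 < (A * l) ^- n by rewrite invr_gt0 exprn_gt0.
have SN : sphere (normalize z) by exact: normalize_sphere.
have kE : ker z - ((A * l) ^- n)%:C%C * Omega theta0 =
    (p ^- n * (A * l) ^- n)%:C%C * (Omega (normalize z) - Omega theta0) +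
    ((p ^- n - 1) * (A * l) ^- n)%:C%C * Omega theta0.
  rewrite /convolution_kernel OmE// pz exprMn invfM mulrBl mul1r [X in _ + X * _]rmorphB /=; ring.
rewrite kE; apply: (le_trans (normcD _ _)); rewrite !Normc.normcM !normcR.
have pn1 : 2^-1 <= p ^+ n.
  have := bernoulli_ge n (ltac:(lra) : t <= 1) (ltW t0).
  have : (1 - t) ^+ n <= p ^+ n by apply: lerXn2r => //; rewrite nnegrE; lra.
  have : n%:R <= 2 ^+ n :> R by rewrite -natrX ler_nat ltnW// ltn_expl.
  nra.
have pn2 : p ^+ n <= 1 + 2 ^+ n * t.
  have := pow1D_le n (ltac:(lra) : t <= 1) (ltW t0).
  have : p ^+ n <= (1 + t) ^+ n by apply: lerXn2r => //; rewrite nnegrE; lra.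
  lra.
have pn3 : 1 - 2 ^+ n * t <= p ^+ n.
  have := bernoulli_ge n (ltac:(lra) : t <= 1) (ltW t0).
  have : (1 - t) ^+ n <= p ^+ n by apply: lerXn2r => //; rewrite nnegrE; lra.
  have : n%:R <= 2 ^+ n :> R by rewrite -natrX ler_nat ltnW// ltn_expl.
  nra.
have pn0 : 0 < p ^+ n by rewrite exprn_gt0.
have pnV : p ^- n <= 2 by rewrite invf_ple ?posrE.
have pnV0 : 0 < p ^- n by rewrite invr_gt0.
apply: lerD.
  rewrite gtr0_norm ?mulr_gt0// -/(dev _) ler_wpM2r ?normc_ge0//.
  by rewrite ler_pM2r.
rewrite normrM (gtr0_norm Aln) -/O0 -[leLHS]mulrA ler_pM2r ?mulr_gt0//.
have -> : p ^- n - 1 = p ^- n * (1 - p ^+ n).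
  by rewrite mulrBr mulr1 mulVf// gt_eqF.
rewrite normrM (gtr0_norm pnV0) -[leRHS]mulrA; apply: ler_pM => //; first exact: ltW.
by rewrite ler_norml; apply/andP; split; lra.
Qed.

(** The direction of [z] ranges over a cap of radius proportional to [1 / A] and
    its length over an interval of relative size [1 / A]; the gain of the latter
    makes up for the ratio between the volumes of the cap and of the cube. *)
Lemma kernel_near_target e : 0 < e -> exists2 A : R, n%:R < A & forall l : R, 0 < l ->
  (\int[leb]_(z in cube (target A l - const_mx l) (2 * l))
     (normc (ker z - ((A * l) ^- n)%:C%C * Omega theta0))%:E <=
   (e * normc (((A * l) ^- n)%:C%C * Omega theta0) * l ^+ n)%:E)%E.
Proof.
move=> e0.
have n1 : 1 <= n%:R :> R by rewrite ler1n.
have n0 : 0 < n%:R :> R by lra.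
pose c1 : R := 2 * 2 ^+ n * 4 / n%:R * (n%:R * 4 ^+ n * 3 ^+ n.-1) * n%:R ^+ n.
have c10 : 0 < c1.
  by rewrite /c1 !mulr_gt0 ?invr_gt0 ?exprn_gt0.
pose e1 := e * O0 / (2 * c1).
have e10 : 0 < e1 by apply: divr_gt0; apply: mulr_gt0.
have [r0 r00 hcap] := cap_deviation e10.
have p20 : 0 < 2 ^+ n :> R by rewrite exprn_gt0.
have p21 : 1 <= 2 ^+ n :> R by rewrite exprn_ege1// ler1n.
pose c2 : R := 4 * 2 ^+ n * 2 ^+ n.
have c20 : 0 < c2 by rewrite !mulr_gt0.
pose t := Num.min (4^-1 / 2 ^+ n) (Num.min (r0 / 4) (e / c2)).
have t0 : 0 < t by rewrite !lt_min !divr_gt0 ?invr_gt0.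
have t1 : 2 ^+ n * t <= 4^-1.
  by rewrite mulrC -ler_pdivlMr// ge_min lexx.
have t2 : t <= r0 / 4 by rewrite !ge_min lexx orbT.
have t3 : t <= e / c2 by rewrite !ge_min lexx !orbT.
have t4 : t <= 4^-1 by apply: le_trans t1; rewrite ler_peMl// ltW.
exists (n%:R / t); first by rewrite ltr_pdivlMr// -[ltRHS]mulr1 ltr_pM2l//; lra.
set A := n%:R / t.
have A0 : 0 < A by rewrite divr_gt0.
have tE : n%:R / A = t by rewrite /A; field; rewrite !gt_eqF.
move=> l l0.
have Al : 0 < A * l by rewrite mulr_gt0.
have Aln : 0 < (A * l) ^- n by rewrite invr_gt0 exprn_gt0.
have l20 : 0 <= 2 * l by rewrite mulr_ge0// ltW.
set Z := cube _ _.
have mZ : measurable Z by exact: measurable_cube.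
have hZ z : Z z -> forall i, `|z ord0 i - target A l ord0 i| <= l.
  move=> Zz i; have := Zz i; rewrite !mxE => /andP[h1 h2].
  by rewrite ler_norml; apply/andP; split; lra.
have est z (Zz : Z z) := target_estimate A0 l0 tE t1 t4 (hZ z Zz).
set K0 := _ * Omega theta0.
have nK0 : normc K0 = (A * l) ^- n * O0.
  by rewrite /K0 Normc.normcM normcR gtr0_norm.
pose al := (1 - 2 * t) * (A * l); pose be := (1 + 2 * t) * (A * l).
have al0 : 0 < al by rewrite mulr_gt0//; lra.
have albe : al <= be by rewrite ler_pM2r//; lra.
pose capt := sphere `&` eball theta0 (3 * t).
have mcap : measurable capt by exact: measurable_cap.
pose h := (fun x => (dev x)%:E) \_ capt.
have mh : measurable_fun setT h.
  apply/(measurable_restrictT _ mcap); apply/measurable_EFinP.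
  by apply: measurable_funS mdev; [exact: measurable_unit_sphere|exact: subIsetl].
have h0 x : (0 <= h x)%E.
  by rewrite /h patchE; case: ifP => // _; rewrite lee_fin normc_ge0.
have mhN : measurable_fun setT (fun z => h (normalize z)).
  exact: (measurableT_comp mh (@measurable_normalize R n)).
have mk : measurable_fun setT (fun z => (normc (ker z - K0))%:E).
  apply/measurable_EFinP; apply: measurable_normc.
  by apply: cmeasurableB; [exact: measurable_convolution_kernel|exact: cmeasurable_cst].
pose c := 2 * 2 ^+ n * t * ((A * l) ^- n * O0).
have c0 : 0 <= c by rewrite !mulr_ge0// ltW.
have q0 : 0 <= 2 * (A * l) ^- n by rewrite mulr_ge0// ltW.
have mS : measurable (shell al be : set Rn) by exact: measurable_shell.
have shellI : (\int[leb]_(z in shell al be) h (normalize z) <=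
    ((be ^+ n - al ^+ n) / n%:R * (e1 * (n%:R * 4 ^+ n * (3 * t) ^+ n.-1)))%:E)%E.
  rewrite (integral_shell n_gt0 al0 albe (measurable_funTS mh) (fun x _ => h0 x)).
  rewrite [leRHS]EFinM; apply: lee_wpmul2l.
    rewrite lee_fin divr_ge0// subr_ge0; apply: lerXn2r => //; rewrite nnegrE ltW//.
    exact: lt_le_trans albe.
  apply: le_trans (hcap (3 * t) _ _ _); [|lra|lra|lra].
  rewrite /h -integral_mkcondr (_ : sphere `&` capt = capt)//.
  by rewrite /capt setIA setIid.
have low : (\int[leb]_(z in Z) (normc (ker z - K0))%:E <=
   (2 * (A * l) ^- n)%:E * \int[leb]_(z in shell al be) h (normalize z) +
   c%:E * ((2 * l) ^+ n)%:E)%E.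
  apply: (@le_trans _ _ (\int[leb]_(z in Z)
      ((2 * (A * l) ^- n)%:E * h (normalize z) + c%:E))%E).
    apply: ge0_le_integral => //.
    - by move=> z _; rewrite lee_fin normc_ge0.
    - exact: measurable_funTS.
    - by apply: emeasurable_funD => //; apply: measurable_funeM; exact: measurable_funTS.
    move=> z Zz; have [_ cz kz] := est z Zz.
    have z_neq0 : z != 0.
      have [] := est z Zz; rewrite /shell /= => /andP[h1 _] _ _.
      by rewrite -enorm_eq0 gt_eqF//; exact: lt_le_trans h1.
    rewrite /h patchE mem_set; last by split => //; exact: normalize_sphere.
    by rewrite -EFinM -EFinD lee_fin.
  rewrite ge0_integralD//; last 2 first.
  - by move=> z _; apply: mule_ge0.
  - by apply: measurable_funeM; exact: measurable_funTS.
  rewrite integral_cst// [X in (_ + _ * X <= _)%E]lebesgue_cube// leeD2r//.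
  rewrite ge0_integralZl_EFin//; last exact: measurable_funTS.
  apply: lee_wpmul2l => //; apply: ge0_subset_integral => //.
    exact: measurable_funTS.
  by move=> z Zz; have [] := est z Zz.
apply: (le_trans low).
apply: (@le_trans _ _ ((2 * (A * l) ^- n)%:E * ((be ^+ n - al ^+ n) / n%:R *
    (e1 * (n%:R * 4 ^+ n * (3 * t) ^+ n.-1)))%:E + c%:E * ((2 * l) ^+ n)%:E)%E).
  by rewrite leeD2r//; apply: lee_wpmul2l.
rewrite -!EFinM -EFinD lee_fin nK0.
have Anl : (A * l) ^- n * l ^+ n = t ^+ n / n%:R ^+ n.
  rewrite /A -exprVn -exprMn -expr_div_n; congr (_ ^+ n); field.
  by rewrite !gt_eqF.
have hd : be ^+ n - al ^+ n <= (A * l) ^+ n * (4 * 2 ^+ n * t).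
  rewrite /be /al ![(_ * (A * l)) ^+ n]exprMn -mulrBl mulrC ler_wpM2l ?exprn_ge0 ?(ltW Al)//.
  have u1 : 2 * t <= 1 by lra.
  have u0 : 0 <= 2 * t by lra.
  have := bernoulli_ge n u1 u0; have := pow1D_le n u1 u0.
  have : n%:R * (2 * t) <= 2 ^+ n * (2 * t).
    by rewrite ler_wpM2r// -natrX ler_nat ltnW// ltn_expl.
  lra.
have part1 : 2 * (A * l) ^- n * ((be ^+ n - al ^+ n) / n%:R *
    (e1 * (n%:R * 4 ^+ n * (3 * t) ^+ n.-1))) <= e / 2 * ((A * l) ^- n * O0) * l ^+ n.
  have tn : t ^+ n = t * t ^+ n.-1 by rewrite -exprS prednK.
  apply: (@le_trans _ _ (2 * (A * l) ^- n * ((A * l) ^+ n * (4 * 2 ^+ n * t) / n%:R *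
    (e1 * (n%:R * 4 ^+ n * (3 * t) ^+ n.-1))))).
    rewrite ler_wpM2l//; apply: ler_wpM2r.
      apply: mulr_ge0; first exact: ltW.
      apply: mulr_ge0; first by apply: mulr_ge0; rewrite ?exprn_ge0.
      by apply: exprn_ge0; apply: mulr_ge0; [|exact: ltW].
    by rewrite ler_wpM2r// invr_ge0 ltW.
  have regroup : e / 2 * ((A * l) ^- n * O0) * l ^+ n =
      e / 2 * O0 * ((A * l) ^- n * l ^+ n).
    by rewrite (mulrC _ O0) !mulrA.
  rewrite regroup.
  rewrite Anl /e1 /c1 [(3 * t) ^+ _]exprMn tn le_eqVlt; apply/orP; left; apply/eqP.
  have i1 := lt0r_neq0 (exprn_gt0 n Al).
  have i2 := lt0r_neq0 n0.
  have i3 := lt0r_neq0 (exprn_gt0 n n0).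
  have i4 := lt0r_neq0 p20.
  have i5 : 3 ^+ n.-1 != 0 :> R by rewrite expf_neq0.
  have i6 : 4 ^+ n != 0 :> R by rewrite expf_neq0.
  move: ((A * l) ^+ n) (n%:R ^+ n) (2 ^+ n) (3 ^+ n.-1) (4 ^+ n) (t ^+ n.-1)
    i1 i3 i4 i5 i6 => P N E U F T0 i1 i3 i4 i5 i6.
  by field; rewrite i1 i2 i3 i4 i5 i6.
have part2 : c * (2 * l) ^+ n <= e / 2 * ((A * l) ^- n * O0) * l ^+ n.
  rewrite /c [(2 * l) ^+ n]exprMn.
  have c2t : c2 * t <= e by rewrite mulrC -ler_pdivlMr.
  have P0 : 0 <= (A * l) ^- n * O0 * l ^+ n.
    by rewrite !mulr_ge0 ?exprn_ge0// ltW.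
  move: (ler_wpM2r P0 c2t); rewrite /c2; lra.
lra.
Qed.

End homogeneous_kernels.

Section homogeneous_companions.
Context {R : realType}.
Variable n : nat.
Hypothesis n_gt0 : (0 < n)%N.
Local Notation Rn := 'rV[R]_n.
Local Notation C := R[i].
Local Notation leb := (@lebesgue_rV R n).
Local Notation normc := (@Normc.normc R).
Local Notation sphere := (@unit_sphere R n).

Let eq_lee (x y : \bar R) : x = y -> (x <= y)%E. Proof. by move=> ->. Qed.

Lemma integral_isometry (c : R) (v : Rn) (D : set Rn) (h : Rn -> \bar R) :
  `|c| = 1 -> measurable D -> measurable_fun setT h -> (forall x, 0 <= h x)%E ->
  (\int[leb]_(x in (fun x : Rn => c *: x + v)%R @^-1` D) h (c *: x + v)%R =
   \int[leb]_(x in D) h x)%E.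
Proof.
move=> c1 mD mh h0.
have c0 : c != 0 by rewrite -normr_eq0 c1 oner_eq0.
rewrite -(@ge0_integral_pushforward _ _ _ _ _ _ (measurable_affine c v) leb D h)//;
  last exact: measurable_funTS.
apply: eq_measure_integral => [|mf A mA _]; first exact: measurable_affine.
transitivity (((`|c|^-1 ^+ n)%:E * leb A)%E); first exact: lebesgue_rV_affine.
by rewrite c1 invr1 expr1n mul1e.
Qed.

Lemma measurable_difference :
  measurable_fun setT (fun z : Rn * Rn => z.1 - z.2).
Proof.
apply: measurable_fun_coordP => i.
rewrite [X in measurable_fun _ X](_ : _ =
  (fun z : Rn * Rn => z.1 ord0 i - z.2 ord0 i)); last by apply/funext => z; rewrite !mxE.
apply: measurable_funB.
  exact: (measurableT_comp (@measurable_coord R n i) measurable_fst).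
exact: (measurableT_comp (@measurable_coord R n i) measurable_snd).
Qed.

Lemma homogeneous_companion_cubes (Omega : Rn -> C) (K : Rn -> Rn -> C) theta0 :
  integrable_on_sphere Omega -> homogeneous_kernel Omega K ->
  sphere theta0 -> sphere_lebesgue_pt Omega theta0 -> Omega theta0 != 0 ->
  has_companion_cubes K.
Proof.
move=> Om_int K_hom th_sphere th_pt th_neq0 eps eps0.
have [A nA hA] := kernel_near_target n_gt0 Om_int th_sphere th_pt th_neq0 eps0.
have A0 : 0 < A by apply: le_lt_trans nA.
have th1 : enorm theta0 = 1 by [].
have nO : 0 < normc (Omega theta0) by rewrite normc_gt0.
exists A, (A ^- n * normc (Omega theta0)); split; first exact: ltW.
  by rewrite mulr_gt0// invr_gt0 exprn_gt0.
move=> a l l0; have Al : 0 < A * l by rewrite mulr_gt0.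
set T := target theta0 A l.
have nT : enorm T = A * l by rewrite /T /target enormZ th1 mulr1 gtr0_norm.
set K0 : C := ((A * l) ^- n)%:C%C * Omega theta0.
have ln : 0 < l ^+ n by rewrite exprn_gt0.
have nK0 : normc K0 = (A * l) ^- n * normc (Omega theta0).
  by rewrite /K0 Normc.normcM normcR gtr0_norm// invr_gt0 exprn_gt0.
exists (a + T), K0.
set X := cube (a + T) l; set Y := cube a l.
have XY : X `&` Y = set0.
  apply/seteqP; split => // z [zX zY].
  suff : enorm T <= n%:R * l by rewrite nT ler_pM2r// leNgt nA.
  apply: enorm_le_coord => i; have := zX i; have := zY i; rewrite !mxE.
  by move=> /andP[h1 h2] /andP[h3 h4]; rewrite ler_norml; apply/andP; split; lra.
have mX : measurable X by exact: measurable_cube.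
have mY : measurable Y by exact: measurable_cube.
have XV : leb X = (l ^+ n)%:E by apply: lebesgue_cube; exact: ltW.
have YV : leb Y = (l ^+ n)%:E by apply: lebesgue_cube; exact: ltW.
split => //.
- move=> i; have -> : (a + T) ord0 i - a ord0 i = T ord0 i.
    by rewrite mxE addrAC subrr add0r.
  by apply: le_trans (enorm_coord T i) _; rewrite nT.
- rewrite nK0 exprMn invfM [leRHS]mulrAC -[X in _ <= X * _]mulrA mulVf ?mulr1//.
  exact: lt0r_neq0.
pose ker := convolution_kernel Omega.
pose H z := (normc (ker z - K0))%:E.
have mk : cmeasurable setT ker by exact: measurable_convolution_kernel.
have mH : measurable_fun setT H.
  apply/measurable_EFinP; apply: measurable_normc.
  by apply: cmeasurableB; [exact: mk|exact: cmeasurable_cst].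
have H0 z : (0 <= H z)%E by rewrite lee_fin normc_ge0.
have KE x y : X x -> Y y -> K x y = ker (x - y).
  move=> Xx Yy; have xy : x != y.
    apply/eqP => xy; have : (X `&` Y) x by split => //; rewrite xy.
    by rewrite XY.
  rewrite K_hom// /ker /convolution_kernel /sphere_ext; case: pselect => // -[].
  by apply: normalize_sphere; rewrite subr_eq0.
pose Z : set Rn := cube (T - const_mx l) (2 * l).
have mZ : measurable Z by exact: measurable_cube.
have XYZ x y : X x -> Y y -> Z (x - y).
  move=> Xx Yy i; have := Xx i; have := Yy i; rewrite !mxE.
  by move=> /andP[h1 h2] /andP[h3 h4]; apply/andP; split; lra.
pose M := eps * normc K0 * l ^+ n.
have HZ : (\int[leb]_(z in Z) H z <= M%:E)%E by exact: hA.
have HX y : Y y -> (\int[leb]_(x in X) H (x - y)%R <= M%:E)%E.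
  move=> Yy; apply: le_trans HZ.
  rewrite -(@integral_isometry 1 (- y) Z H (normr1 R) mZ mH H0).
  under [X in (_ <= X)%E]eq_integral do rewrite scale1r.
  apply: ge0_subset_integral => //.
  - exact: preimage_measurable (measurable_affine 1 (- y)) mZ.
  - apply: measurable_funTS; have := measurableT_comp mH (measurable_affine 1 (- y)).
    by rewrite /comp; under eq_fun do rewrite scale1r.
  by move=> x Xx /=; rewrite scale1r; exact: XYZ.
have HY x : X x -> (\int[leb]_(y in Y) H (x - y)%R <= M%:E)%E.
  move=> Xx; apply: le_trans HZ.
  rewrite -(@integral_isometry (- 1) x Z H (normrN1 R) mZ mH H0).
  have E y : -1 *: y + x = x - y by rewrite scaleN1r addrC.
  under [X in (_ <= X)%E]eq_integral do rewrite E.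
  apply: ge0_subset_integral => //.
  - exact: preimage_measurable (measurable_affine (-1) x) mZ.
  - apply: measurable_funTS; have := measurableT_comp mH (measurable_affine (-1) x).
    by rewrite /comp; under eq_fun do rewrite E.
  by move=> y Yy /=; rewrite E; exact: XYZ.
have mkx x : cmeasurable setT (fun y => ker (x - y)).
  have E y : -1 *: y + x = x - y by rewrite scaleN1r addrC.
  have [k1 k2] := mk; split.
    have := measurableT_comp k1 (measurable_affine (-1) x).
    by rewrite /comp; under eq_fun do rewrite E.
  have := measurableT_comp k2 (measurable_affine (-1) x).
  by rewrite /comp; under eq_fun do rewrite E.
split.
- move=> x Xx; have [k1 k2] := mkx x; split.
    apply: eq_measurable_fun (measurable_funTS k1) => y; rewrite inE => Yy.
    by rewrite KE.
  apply: eq_measurable_fun (measurable_funTS k2) => y; rewrite inE => Yy.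
  by rewrite KE.
- move=> u mu u0 ufin.
  pose f (z : Rn * Rn) : \bar R :=
    ((u z.2 * \1_Y z.2)%:E * ((\1_X z.1)%:E * H (z.1 - z.2)%R))%E.
  have f0 z : (0 <= f z)%E.
    apply: mule_ge0; first by rewrite lee_fin mulr_ge0// indicE.
    by apply: mule_ge0; [rewrite lee_fin indicE|exact: H0].
  have m1X : measurable_fun setT (\1_X : Rn -> R) by exact: measurable_indic.
  have m1Y : measurable_fun setT (\1_Y : Rn -> R) by exact: measurable_indic.
  have mf : measurable_fun setT f.
    apply: emeasurable_funM.
      apply/measurable_EFinP; apply: measurable_funM.
        exact: (measurableT_comp mu measurable_snd).
      exact: (measurableT_comp m1Y measurable_snd).
    apply: emeasurable_funM.
      apply/measurable_EFinP; exact: (measurableT_comp m1X measurable_fst).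
    exact: (measurableT_comp mH measurable_difference).
  have FE x : X x -> (\int[leb]_y f (x, y) = \int[leb]_(y in Y) ((u y)%:E * H (x - y)%R))%E.
    move=> Xx; rewrite [RHS]integral_mkcond; apply: eq_integral => y _.
    rewrite patchE /f /= !indicE (mem_set Xx) mul1e.
    by case: ifPn => _; rewrite ?mulr1 ?mulr0 ?mul0e.
  exists (fun x => \int[leb]_y f (x, y))%E; split.
  + apply: measurable_funTS.
    exact: (measurable_fun_fubini_tonelli_F (m2 := leb) f mf f0).
  + move=> x Xx; rewrite FE//; apply: eq_lee; apply: eq_integral => y.
    by rewrite inE => Yy; rewrite KE// EFinM.
  rewrite XV.
  have Xr : (\int[leb]_(x in X) \int[leb]_y f (x, y) = \int[leb]_x \int[leb]_y f (x, y))%E.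
    rewrite integral_mkcond; apply: eq_integral => x _; rewrite patchE.
    case: ifPn => //; rewrite notin_setE => nX; apply/esym.
    rewrite (eq_integral (cst 0%E)) ?integral0// => y _.
    by rewrite /f /= [\1_X x]indicE memNset// mul0e mule0.
  rewrite Xr (fubini_tonelli (m1 := leb) (m2 := leb) f mf f0).
  have mfy (y : Rn) : measurable_fun setT (fun x : Rn => ((\1_X x)%:E * H (x - y)%R)%E).
    apply: emeasurable_funM.
      exact/measurable_EFinP.
    have := measurableT_comp mH (measurable_affine 1 (- y)).
    by rewrite /comp; under eq_fun do rewrite scale1r.
  apply: (@le_trans _ _ (\int[leb]_y ((u y * \1_Y y)%:E * M%:E))%E).
    apply: ge0_le_integral => //.
    - by move=> y _; apply: integral_ge0.
    - exact: (measurable_fun_fubini_tonelli_G (m1 := leb) f mf f0).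
    - apply: emeasurable_funM => //; apply/measurable_EFinP.
      exact: measurable_funM.
    move=> y _; rewrite /f/= ge0_integralZl_EFin//; last 2 first.
    - by move=> x _; apply: mule_ge0; [rewrite lee_fin indicE|exact: H0].
    - by rewrite mulr_ge0// indicE.
    have [Yy|nY] := pselect (Y y); last first.
      by rewrite indicE memNset// mulr0 !mul0e.
    apply: lee_wpmul2l; first by rewrite lee_fin mulr_ge0// indicE.
    apply: le_trans (HX y Yy); rewrite [leRHS]integral_mkcond.
    apply: eq_lee; apply: eq_integral => x _; rewrite patchE indicE.
    by case: ifPn => _; rewrite ?mul1e ?mul0e.
  have M0 : 0 <= M by rewrite !mulr_ge0 ?normc_ge0// ltW.
  under eq_integral do rewrite muleC.
  rewrite ge0_integralZl_EFin//; last 2 first.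
  + by move=> y _; rewrite lee_fin mulr_ge0// indicE.
  + apply/measurable_EFinP; exact: measurable_funM.
  rewrite /M EFinM; apply: lee_wpmul2l; first by rewrite -EFinM lee_fin.
  rewrite [leRHS]integral_mkcond; apply: eq_lee; apply: eq_integral => y _.
  by rewrite patchE indicE; case: ifPn => _; rewrite ?mulr1 ?mulr0.
move=> x Xx; rewrite YV -EFinM; apply: le_trans (HY x Xx).
by apply: eq_lee; apply: eq_integral => y; rewrite inE => Yy; rewrite KE.
Qed.

End homogeneous_companions.

(** * The oscillation on a cube *)

Section mean_values.
Context {R : realType}.
Variable n : nat.
Local Notation Rn := 'rV[R]_n.
Local Notation C := R[i].
Local Notation leb := (@lebesgue_rV R n).
Local Notation normc := (@Normc.normc R).
Implicit Types (D : set Rn) (f b : Rn -> C).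

Lemma normc_cintegral_le D f (I : R) : measurable D -> cmeasurable D f ->
  (\int[leb]_(x in D) (normc (f x))%:E = I%:E)%E -> normc (cintegral D f) <= I.
Proof.
move=> mD mf hI; have If : (\int[leb]_(x in D) (normc (f x))%:E < +oo)%E.
  by rewrite hI ltry.
have fi := cintegrableP mD mf If.
set z := cintegral D f; pose th := phase z.
have -> : normc z = complex.Re (cintegral D (fun x => th * f x)).
  by rewrite cintegralZl// -/z phaseE.
have [h1 h2] := fi.
have iRe : leb.-integrable D (fun x => (complex.Re (th * f x))%:E).
  under [X in integrable _ _ X]eq_fun do rewrite ReM EFinB !EFinM.
  by apply: integrableB => //; exact: integrableZl.
rewrite -lee_fin -hI [X in (X <= _)%E](_ : _ =
    \int[leb]_(x in D) (complex.Re (th * f x))%:E)%E; last first.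
  by rewrite /= fineK//; exact: integrable_fin_num.
have inc : leb.-integrable D (fun x => (normc (f x))%:E).
  apply/integrableP; split; first by apply/measurable_EFinP; exact: measurable_normc.
  by under eq_integral do rewrite gee0_abs ?lee_fin ?normc_ge0//.
apply: (le_integral mD iRe inc) => x _; rewrite lee_fin.
apply: (le_trans (le_trans (ler_norm _) (Re_le_normc _))).
by rewrite Normc.normcM ler_piMl ?normc_ge0// normc_phase.
Qed.

Lemma cintegral_cst D (c : C) (V : R) : measurable D -> leb D = V%:E ->
  cintegral D (fun=> c) = V%:C%C * c.
Proof.
move=> mD DV; apply: complex_ext; rewrite ?(ReM, ImM) /cintegral /= /Rintegral.
  by rewrite integral_cst// [X in (_ * X)%E]DV -EFinM /= mul0r subr0 mulrC.
by rewrite integral_cst// [X in (_ * X)%E]DV -EFinM /= mul0r addr0 mulrC.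
Qed.

(** The mean value is, up to a factor 2, the best constant. *)
Lemma caverage_le D b (m : C) (V I : R) : measurable D -> 0 < V -> leb D = V%:E ->
  cmeasurable D b -> (\int[leb]_(x in D) (normc (b x))%:E < +oo)%E ->
  (\int[leb]_(x in D) (normc (b x - m))%:E <= I%:E)%E ->
  (\int[leb]_(x in D) (normc (b x - caverage D b))%:E <= (2 * I)%:E)%E.
Proof.
move=> mD V0 DV mb bfin.
have mbm c : cmeasurable D (fun x => b x - c).
  by apply: cmeasurableB => //; exact: cmeasurable_cst.
have : (0 <= \int[leb]_(x in D) (normc (b x - m))%:E)%E.
  by apply: integral_ge0 => x _; rewrite lee_fin normc_ge0.
case hI' : (\int[leb]_(x in D) (normc (b x - m))%:E)%E => [I'| |]// _.
rewrite lee_fin => II'.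
have cfin : (\int[leb]_(x in D) (normc m)%:E < +oo)%E.
  by rewrite integral_cst// [X in (_ * X)%E]DV -EFinM ltry.
have avg : normc (m - caverage D b) * V <= I'.
  have := normc_cintegral_le mD (mbm m) hI'.
  rewrite cintegralB//; last 2 first.
  - exact: cintegrableP.
  - by apply: cintegrableP => //; exact: cmeasurable_cst.
  rewrite (cintegral_cst _ mD DV) => h; apply: le_trans h.
  rewrite normc_distC -[X in _ * X](ger0_norm (ltW V0)) -normcR -Normc.normcM.
  rewrite (_ : (caverage D b - m) * V%:C%C = cintegral D b - V%:C%C * m)//.
  rewrite mulrBl [m * _]mulrC /caverage [fine _](_ : _ = V); last by rewrite DV.
  by rewrite mulrAC -rmorphM/= mulVf ?gt_eqF// mul1r.
apply: (@le_trans _ _ (\int[leb]_(x in D)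
    ((normc (b x - m))%:E + (normc (m - caverage D b))%:E))%E).
  apply: ge0_le_integral => //.
  - by move=> x _; rewrite lee_fin normc_ge0.
  - by apply/measurable_EFinP; exact: measurable_normc.
  - by apply: emeasurable_funD => //; apply/measurable_EFinP; exact: measurable_normc.
  move=> x _; rewrite -EFinD lee_fin; have := normcD (b x - m) (m - caverage D b).
  by rewrite addrA subrK.
rewrite ge0_integralD//; last 3 first.
- by move=> x _; rewrite lee_fin normc_ge0.
- by apply/measurable_EFinP; exact: measurable_normc.
- by move=> x _; rewrite lee_fin normc_ge0.
rewrite hI' integral_cst// [X in (_ + _ * X <= _)%E]DV -EFinM -EFinD lee_fin; lra.
Qed.

End mean_values.

Section bloom.
Context {R : realType}.
Variable n : nat.
Hypothesis n_gt0 : (0 < n)%N.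
Local Notation Rn := 'rV[R]_n.
Local Notation C := R[i].
Local Notation leb := (@lebesgue_rV R n).
Local Notation normc := (@Normc.normc R).
Implicit Types (T : (Rn -> C) -> Rn -> C) (K : Rn -> Rn -> C) (X Y : set Rn).

(** [|K|] is at most [|K0| + |K - K0|], and the integral of the second term is
    integrable in [x], hence almost everywhere finite. *)
Lemma nearly_constant_ae_fin K (K0 : C) eps X Y (V : R) : measurable X -> measurable Y ->
  leb X = V%:E -> nearly_constant K K0 eps X Y ->
  forall u : Rn -> R, measurable_fun setT u -> (forall y, 0 <= u y) ->
    (\int[leb]_(y in Y) (u y)%:E < +oo)%E ->
  {ae leb, forall x, X x -> (\int[leb]_(y in Y) (u y * normc (K x y))%:E < +oo)%E}.
Proof.
move=> mX mY XV [mK KK0 _] u mu u0 ufin.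
have [v [mv vx vI]] := KK0 u mu u0 ufin.
have v0 x : X x -> (0 <= v x)%E.
  move=> Xx; apply: le_trans (vx x Xx); apply: integral_ge0 => y _.
  by rewrite lee_fin mulr_ge0// normc_ge0.
have iv : leb.-integrable X v.
  apply/integrableP; split => //.
  rewrite (eq_integral v); last by move=> x; rewrite inE => Xx; rewrite gee0_abs// v0.
  apply: (le_lt_trans vI); rewrite [X in (_ * X * _)%E]XV -EFinM.
  have : (0 <= \int[leb]_(y in Y) (u y)%:E)%E by apply: integral_ge0 => y _; rewrite lee_fin.
  by move: ufin; case: (\int[_]_(_ in _) _)%E => // r _ _; rewrite -EFinM ltry.
apply: filterS (integrable_ae mX iv) => x vfin Xx.
have mKx := mK x Xx.
have muY : measurable_fun Y (fun y => (u y)%:E) by apply/measurable_EFinP; exact: measurable_funTS.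
have mKK : measurable_fun Y (fun y => (u y * normc (K x y - K0))%:E).
  apply/measurable_EFinP; apply: measurable_funM; first exact: measurable_funTS.
  apply: measurable_normc; apply: cmeasurableB => //; exact: cmeasurable_cst.
apply: (@le_lt_trans _ _ (\int[leb]_(y in Y)
    ((normc K0)%:E * (u y)%:E + (u y * normc (K x y - K0))%:E))%E).
  apply: ge0_le_integral => //.
  - by move=> y _; rewrite lee_fin mulr_ge0// normc_ge0.
  - apply/measurable_EFinP; apply: measurable_funM; first exact: measurable_funTS.
    exact: measurable_normc.
  - by apply: emeasurable_funD => //; exact: measurable_funeM.
  move=> y _; rewrite -EFinM -EFinD lee_fin [normc K0 * _]mulrC -mulrDr ler_wpM2l//.
  by have := normcD K0 (K x y - K0); rewrite addrC subrK.
rewrite ge0_integralD//; last 3 first.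
- by move=> y _; rewrite -EFinM lee_fin mulr_ge0// normc_ge0.
- exact: measurable_funeM.
- by move=> y _; rewrite lee_fin mulr_ge0// normc_ge0.
rewrite ge0_integralZl_EFin ?normc_ge0//; last by move=> y _; rewrite lee_fin.
apply: lte_add_pinfty.
  by apply: lte_mul_pinfty; rewrite ?lee_fin ?normc_ge0.
apply: le_lt_trans (vx x Xx) _.
by have := vfin Xx; rewrite ge0_fin_numE// v0.
Qed.

Lemma kernel_with_companions T :
  (exists omega : R -> R, nondegenerate_CZ_operator omega T) \/
    nondegenerate_homogeneous_operator T ->
  exists2 K, operator_with_kernel K T & has_companion_cubes K.
Proof.
move=> [[omega [K [KT CZ om nondeg]]] | [K [Om [KT Om_int K_hom [th [Sth pt nz]]]]]].
  by exists K => //; exact: CZ_companion_cubes CZ om nondeg.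
by exists K => //; exact: homogeneous_companion_cubes Om_int K_hom Sth pt nz.
Qed.

Lemma pow1D_le_double (x : R) k : 0 <= x -> (1 + x) ^+ k <= 2 ^+ k * (1 + x ^+ k).
Proof.
move=> x0; have [x1|x1] := leP x 1.
  apply: (@le_trans _ _ (2 ^+ k)).
    by apply: lerXn2r; rewrite ?nnegrE ?addr_ge0//; lra.
  by rewrite ler_peMr ?exprn_ge0// lerDl exprn_ge0.
apply: (@le_trans _ _ ((2 * x) ^+ k)).
  by apply: lerXn2r; rewrite ?nnegrE ?addr_ge0 ?mulr_ge0//; lra.
by rewrite exprMn ler_wpM2l ?exprn_ge0// lerDr.
Qed.

Lemma Lk_loc_cube k (b : Rn -> C) a l : Lk_loc k b -> 0 < l ->
  (\int[leb]_(y in cube a l) ((1 + normc (b y)) ^+ k)%:E < +oo)%E.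
Proof.
move=> [mb bfin] l0; set Y := cube a l.
have mY : measurable Y by exact: measurable_cube.
have mnb : measurable_fun setT (fun y => normc (b y)) by exact: measurable_normc.
have := bfin Y (@compact_cube R n a l) => fin.
apply: (@le_lt_trans _ _ (\int[leb]_(y in Y)
    ((2 ^+ k)%:E * (1%:E + (normc (b y) ^+ k)%:E)))%E).
  apply: ge0_le_integral => //.
  - by move=> y _; rewrite lee_fin exprn_ge0// addr_ge0// normc_ge0.
  - apply/measurable_EFinP; apply: measurable_funX; apply: measurable_funTS.
    exact: measurable_funD.
  - apply: measurable_funeM; apply: emeasurable_funD => //; apply/measurable_EFinP.
    by apply: measurable_funTS; exact: measurable_funX.
  by move=> y _; rewrite -EFinD -EFinM lee_fin pow1D_le_double// normc_ge0.
have mk : measurable_fun Y (fun y => (normc (b y) ^+ k)%:E).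
  by apply/measurable_EFinP/measurable_funTS; exact: measurable_funX.
have g0 y : Y y -> (0 <= 1%:E + (normc (b y) ^+ k)%:E)%E.
  by rewrite -EFinD lee_fin addr_ge0// exprn_ge0// normc_ge0.
have mg : measurable_fun Y (fun y => (1%:E + (normc (b y) ^+ k)%:E)%E).
  exact: emeasurable_funD.
have e0 : 0 <= 2 ^+ k :> R by rewrite exprn_ge0.
rewrite ge0_integralZl_EFin//.
apply: lte_mul_pinfty => //.
rewrite ge0_integralD//; last first.
  by move=> y _; rewrite lee_fin exprn_ge0// normc_ge0.
apply: lte_add_pinfty => //.
by rewrite integral_cst// [X in (_ * X)%E]lebesgue_cube ?ltW// -EFinM ltry.
Qed.

Lemma Lk_loc_integral k (b : Rn -> C) a l : (0 < k)%N -> Lk_loc k b -> 0 < l ->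
  (\int[leb]_(y in cube a l) (normc (b y))%:E < +oo)%E.
Proof.
move=> k0 hb l0; apply: le_lt_trans (Lk_loc_cube a hb l0).
have [mb _] := hb.
have mnb : measurable_fun setT (fun y => normc (b y)) by exact: measurable_normc.
apply: ge0_le_integral => //.
- exact: measurable_cube.
- by move=> y _; rewrite lee_fin normc_ge0.
- by apply/measurable_EFinP; exact: measurable_funTS.
- apply/measurable_EFinP; apply: measurable_funX; apply: measurable_funTS.
  exact: measurable_funD.
move=> y _; rewrite lee_fin; have n0 := normc_ge0 (b y).
apply: (@le_trans _ _ (1 + normc (b y))); first by rewrite lerDr.
by rewrite -[leLHS]expr1 ler_weXn2l// lerDl.
Qed.

Lemma powR_inv_expn (x : R) k : (0 < k)%N -> 0 <= x -> (x `^ k%:R^-1) ^+ k = x.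
Proof.
move=> k0 x0; rewrite -powR_mulrn ?powR_ge0// -powRrM mulVf ?powRr1//.
by rewrite pnatr_eq0 -lt0n.
Qed.

(** The companion cube carries the values of the commutator, and [tau] is the [k]-th
    root of the bound that Hoelder's inequality and [weight_estimate] give for the
    test functions, in the normalization of [mean_oscillation_le]. *)
Lemma cube_oscillation p k mu lam T : 1 < p -> (0 < k)%N -> Ap p mu -> Ap p lam ->
  (exists2 K, operator_with_kernel K T & has_companion_cubes K) ->
  let nu := fun x => mu x `^ p^-1 * lam x `^ (- p^-1) in
  exists2 A : R, 0 < A & forall b N a l J, Lk_loc k b -> 0 < N ->
    (forall f, Linfty_c f ->
       (wLnorm p lam (iter_commutator b k T f) <= N%:E * wLnorm p mu f)%E) ->
    0 < l -> (\int[leb]_(x in cube a l) (nu x `^ k%:R^-1)%:E = J%:E)%E ->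
    0 < J /\
    (\int[leb]_(x in cube a l) (normc (b x - caverage (cube a l) b))%:E <=
      (A * N `^ k%:R^-1 * J)%:E)%E.
Proof.
move=> p1 k0 Amu Alam [K KT Kcomp] nu.
have [L [c [L0 c0 comp]]] := Kcomp _ (@tolerance_gt0 R k).
have [W W0 hW] := weight_estimate p1 k0 Amu Alam L0.
pose OC := @oscillation_constant R k.
have OC0 : 0 < OC.
  have := @threshold_ge1 R k; have := @spread_ge4 R k; rewrite /OC /oscillation_constant; nra.
exists (2 * OC * (W / c) `^ k%:R^-1).
  by rewrite !mulr_gt0// powR_gt0// divr_gt0.
move=> b N a l J hb N0 hN l0 hJ.
have [a' [K0 [XY aa' cK0 KK0]]] := comp a l l0.
set X := cube a' l in XY KK0; set Y := cube a l in XY KK0 hJ *.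
have [J0 [u [s [u0 s0 hu hs us]]]] := hW a a' l J l0 aa' hJ.
split => //.
pose V := l ^+ n; have V0 : 0 < V by rewrite exprn_gt0.
have mX : measurable X by exact: measurable_cube.
have mY : measurable Y by exact: measurable_cube.
have XV : leb X = V%:E by apply: lebesgue_cube; exact: ltW.
have YV : leb Y = V%:E by apply: lebesgue_cube; exact: ltW.
have [mb _] := hb.
have bX := Lk_loc_integral a' k0 hb l0; have bY := Lk_loc_integral a k0 hb l0.
have K0_neq0 : K0 != 0.
  rewrite -normc_gt0; rewrite -(pmulr_lgt0 _ V0); exact: lt_le_trans cK0.
have [mK _ _] := KK0.
have Kfin := nearly_constant_ae_fin mX mY XV KK0.
have formula := iter_commutator_kernel KT mb mY (@compact_cube R n a l) XY mK Kfin.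
pose B := N * (u `^ p^-1 * s `^ ((p - 1) / p)).
have test f : cmeasurable setT f -> (forall y, normc (f y) <= 1) ->
    (forall y, ~ Y y -> f y = 0) ->
    [/\ cmeasurable setT (iter_commutator b k T f),
      {ae leb, forall x, X x -> iter_commutator b k T f x =
        cintegral Y (fun y => (b x - b y) ^+ k * (K x y * f y))} &
      (\int[leb]_(x in X) (normc (iter_commutator b k T f x))%:E <= B%:E)%E].
  move=> mf f1 f0.
  have [] := formula k f mf f0.
    apply: le_lt_trans (Lk_loc_cube a hb l0).
    have mnb : measurable_fun setT (fun y => (1 + normc (b y)) ^+ k).
      apply: measurable_funX; apply: measurable_funD => //; exact: measurable_normc.
    apply: ge0_le_integral => //.
    - by move=> y _; rewrite lee_fin mulr_ge0 ?normc_ge0// exprn_ge0// addr_ge0 ?normc_ge0.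
    - apply/measurable_EFinP/measurable_funTS/measurable_funM => //.
      exact: measurable_normc.
    - by apply/measurable_EFinP/measurable_funTS.
    by move=> y _; rewrite lee_fin ler_piMr// exprn_ge0// addr_ge0 ?normc_ge0.
  move=> mS Sf; split => //.
  have [wmu _] := Amu; have [wlam _] := Alam.
  apply: (test_bound p1 wmu wlam mX mY hu hs mf f1 f0 mS (ltW N0)).
  apply: hN; split => //; last by exists 1.
  have cY := @closed_cube R n a l.
  apply: (subclosed_compact (@closed_closure _ _) (@compact_cube R n a l)).
  rewrite [X in _ `<=` X](closure_id _).1//; apply: closureS => y /=.
  by apply: contra_neqP => /f0.
pose tau := (N * W / c) `^ k%:R^-1 * (J / V).
have NWc : 0 < N * W / c by rewrite divr_gt0// mulr_gt0.
have tau0 : 0 < tau by rewrite mulr_gt0 ?powR_gt0// divr_gt0.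
have B_le : B <= normc K0 * V * V * tau ^+ k.
  rewrite /tau exprMn powR_inv_expn//; last exact: ltW.
  apply: (@le_trans _ _ (N * (W * (J / V) ^+ k * V))).
    by rewrite ler_pM2l.
  have P0 : 0 <= V * (N * W / c * (J / V) ^+ k).
    apply: mulr_ge0; first exact: ltW.
    by apply: mulr_ge0; [exact: ltW|apply: exprn_ge0; apply: divr_ge0; exact: ltW].
  have h := ler_wpM2r P0 cK0; rewrite -!mulrA in h *; apply: le_trans h.
  rewrite le_eqVlt; apply/orP; left; apply/eqP.
  move: ((J / V) ^+ k) => E; field; exact: lt0r_neq0.
have [m hm] := mean_oscillation_le k0 mb mX mY V0 XV YV K0_neq0 KK0 bX bY test
  (lexx _) tau0 B_le.
have := caverage_le mY V0 YV (cmeasurableTS Y mb) bY hm.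
rewrite (_ : 2 * _ = 2 * OC * (W / c) `^ k%:R^-1 * N `^ k%:R^-1 * J)//.
rewrite /tau (_ : N * W / c = W / c * N); last by ring.
rewrite powRM ?(ltW N0) ?divr_ge0 ?(ltW W0) ?(ltW c0)// -/OC.
by move: (N `^ _) ((W / c) `^ _) => x y; field; exact: lt0r_neq0.
Qed.

End bloom.

Theorem mainTheorem3 (R : realType) (n : nat) (n_gt0 : (0 < n)%N)
  (p : R) (p_gt1 : 1 < p) (k : nat) (k_ge1 : (1 <= k)%N)
  (mu lambda : 'rV[R]_n -> R) (Ap_mu : Ap p mu) (Ap_lambda : Ap p lambda)
  (T : ('rV[R]_n -> R[i]) -> ('rV[R]_n -> R[i]))
  (hT : (exists omega : R -> R, nondegenerate_CZ_operator omega T) \/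
        nondegenerate_homogeneous_operator T) :
  let nu := fun x => mu x `^ p^-1 * lambda x `^ (- p^-1) in
  exists2 C : R, 0 < C & forall b : 'rV[R]_n -> R[i], Lk_loc k b ->
    (BMO_norm (fun x => nu x `^ k%:R^-1)%R b <=
     C%:E * operator_norm p mu lambda (iter_commutator b k T) `^ k%:R^-1)%E.

Proof.
move=> nu.
have [A A0 hA] := cube_oscillation p_gt1 k_ge1 Ap_mu Ap_lambda
  (kernel_with_companions n_gt0 hT).
exists A => // b hb.
rewrite /operator_norm; set S := (X in ereal_inf X).
have M0 : (0 <= ereal_inf S)%E.
  by apply: le_ereal_inf_tmp => _ [N [N0 _] <-]; rewrite lee_fin.
case hM : (ereal_inf S) M0 => [r| |]//; last first.
  by move=> _; rewrite poweRyr ?gt0_muley ?lte_fin ?leey// invr_eq0 pnatr_eq0 -lt0n.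
rewrite lee_fin => r0; rewrite poweR_EFin -EFinM.
have rhs0 : 0 <= A * r `^ k%:R^-1 by rewrite mulr_ge0 ?powR_ge0// ltW.
(* the operator norm is an infimum: every larger number is admissible *)
have adm e : 0 < e -> forall f, Linfty_c f -> (wLnorm p lambda
    (iter_commutator b k T f) <= (r + e)%:E * wLnorm p mu f)%E.
  move=> e0 f Lf; have : (ereal_inf S < (r + e)%:E)%E by rewrite hM lte_fin ltrDl.
  move=> /ereal_inf_lt[_ [N [N0 hN] <-]]; rewrite lte_fin => Nr.
  apply: (le_trans (hN f Lf)); apply: lee_wpmul2r; last by rewrite lee_fin ltW.
  exact: poweR_ge0.
apply: ge_ereal_sup => _ [Q [a [l [l0 ->]]] <-].
have : (0 <= \int[lebesgue_rV n]_(x in cube a l) (nu x `^ k%:R^-1)%:E)%E.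
  by apply: integral_ge0 => x _; rewrite lee_fin powR_ge0.
case hJ : (\int[lebesgue_rV n]_(x in cube a l) (nu x `^ k%:R^-1)%:E)%E => [J| |]// _; last first.
  by rewrite invey mul0e lee_fin.
have est e (e0 : 0 < e) := hA b (r + e) a l J hb (ltr_wpDl r0 e0) (adm e e0) l0 hJ.
have [J0 _] := est 1 ltr01.
rewrite inver gt_eqF//.
have : (0 <= \int[lebesgue_rV n]_(x in cube a l)
    (Normc.normc (b x - caverage (cube a l) b))%:E)%E.
  by apply: integral_ge0 => x _; rewrite lee_fin normc_ge0.
case hD : (\int[lebesgue_rV n]_(x in cube a l)
    (Normc.normc (b x - caverage (cube a l) b))%:E)%E => [D| |]// ; last first.
  by have [_] := est 1 ltr01; rewrite hD.
rewrite lee_fin => D0; rewrite -EFinM lee_fin.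
set t := J^-1 * D.
have t0 : 0 <= t by rewrite mulr_ge0// invr_ge0 ltW.
rewrite -ler_pdivrMl// mulrC; set q := t / A.
have q0 : 0 <= q by rewrite divr_ge0// ltW.
have q_le : q ^+ k <= r.
  apply/ler_addgt0Pr => e e0; have [_] := est e e0; rewrite hD lee_fin => De.
  have re0 : 0 <= r + e by rewrite addr_ge0// ltW.
  rewrite -(powR_inv_expn k_ge1 re0).
  apply: lerXn2r; rewrite ?nnegrE ?powR_ge0//.
  by rewrite ler_pdivrMr// ler_pdivrMl// mulrC [_ * A]mulrC.
have -> : q = (q ^+ k) `^ k%:R^-1.
  by rewrite -powR_mulrn// -powRrM mulfV ?powRr1// pnatr_eq0 -lt0n.
by apply: ge0_ler_powR; rewrite ?nnegrE ?invr_ge0 ?exprn_ge0.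
Qed.
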